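(* Let $M$ be a von Neumann algebra in class $\mathscr{M}_0$ and let $(\tilde M,(\alpha_t)_{t\in\mathbb R})$ be the associated s-malleable deformation of $M$. Let $\Gamma$ be a countable non-amenable inner amenable group satisfying $L(\Gamma)\subset M$. Then $L(\Gamma)$ is $\alpha$-rigid, i.e. $\alpha_t\to\mathrm{id}$ uniformly on the unit ball of $L(\Gamma)$: $\lim_{t\to0}\sup_{x\in(L(\Gamma))_1}\|\alpha_t(x)-x\|_2=0$.
   Context: $L(\Gamma)$ is the group von Neumann algebra. A countable group $\Gamma$ is inner amenable if there is an atomless mean on $\Gamma$ which is invariant under the action of $\Gamma$ on itself by conjugation. A tracial von Neumann algebra $(M,\tau)$ is a von Neumann algebra with a faithful normal tracial state and separable $L^2(M)$; $\|x\|_2=\tau(x^*x)^{1/2}$; $(M)_1$ is the operator norm unit ball; inclusions are unital; $E_A$ is the trace preserving conditional expectation onto $A$. Bimodules: an $M$-$M$-bimodule $\mathcal H$ is weakly contained in $\mathcal K$ if $\|\pi_{\mathcal H}(x)\|\le\|\pi_{\mathcal K}(x)\|$ for all $x\in M\odot M^{op}$. For $A\subset M$, an $M$-$M$-bimodule $\mathcal H$ is mixing relative to $A$ if for every sequence $(x_n)_n\subset(M)_1$ with $\|E_A(xx_ny)\|_2\to0$ for all $x,y\in M$, one has $\lim_n\sup_{y\in(M)_1}|\langle x_n\xi y,\eta\rangle|=0$ for all $\xi,\eta\in\mathcal H$. s-malleable deformation of $(M,\tau)$: a pair $(\tilde M,(\alpha_t)_{t\in\mathbb R})$ where $(\tilde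 M,\tilde\tau)$ is tracial, $M\subset\tilde M$, $\tilde\tau|_M=\tau$; $(\alpha_t)$ is a one-parameter group of trace preserving automorphisms of $\tilde M$ with $\lim_{t\to0}\|\alpha_t(x)-x\|_2=0$ for all $x\in\tilde M$; there is a trace preserving automorphism $\beta$ of $\tilde M$ with $\beta|_M=\mathrm{id}$, $\beta^2=\mathrm{id}$, $\beta\alpha_t=\alpha_{-t}\beta$ for all $t$; and $\alpha_t$ does not converge uniformly (in $\|\cdot\|_2$) to the identity on $(M)_1$ as $t\to0$. Class $\mathscr M_0$: a non-amenable tracial von Neumann algebra $M$ belongs to $\mathscr M_0$ if there exists an s-malleable deformation $(\tilde M,(\alpha_t)_{t\in\mathbb R})$ of $M$ such that $L^2(\tilde M)\ominus L^2(M)$ is a mixing $M$-$M$-bimodule relative to $\mathbb C1$ and $L^2(\tilde M)\ominus L^2(M)$ is weakly contained in the coarse bimodule $L^2(M)\otimes L^2(M)$ as $M$-$M$-bimodules; the ''associated'' deformation is such a deformation. *)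

(* Defs.v *)
From mathcomp Require Export all_boot all_order all_algebra.
From mathcomp Require Export complex.
From mathcomp Require Export all_classical all_reals all_analysis.

Set Implicit Arguments.
Unset Strict Implicit.
Unset Printing Implicit Defensive.

Import Order.TTheory GRing.Theory Num.Theory.
Import numFieldNormedType.Exports.

Local Open Scope classical_set_scope.
Local Open Scope ring_scope.

(* The complex scalars are R[i], for R : realType.
   Inner products are linear in the first variable.  Operators on H are plain
   functions H -> H, so that the ring operations on them are + and \o. *)
Record hilbert (R : realType) := Hilbert {
  hcar :> completeNormedModType R[i] ;
  hdot : {dot hcar for (@Num.conj R[i])} ;
  _ : forall x : hcar, `|x| ^+ 2 = hdot x x }.

Notation op H := (hcar H -> hcar H).

Definition dotp (R : realType) (H : hilbert R) (x y : H) : R[i] := hdot H x y.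

Definition modulus (R : realType) (z : R[i]) : R := complex.Re `|z|.

(* The norm of a normed module over R[i] takes its (nonnegative) values in
   R[i]; hnorm is its value in R. *)
Definition hnorm (R : realType) (H : hilbert R) (x : H) : R := complex.Re `|x|.

Definition bounded_op (R : realType) (H K : hilbert R) (T : H -> K) : Prop :=
  linear T /\ continuous T.

Definition opnorm (R : realType) (H : hilbert R) (T : op H) : \bar R :=
  ereal_sup [set (hnorm (T x))%:E | x in [set x : H | hnorm x <= 1]].

(* By Riesz representation, the adjoint exists for every bounded T; it is
   always unique. *)
Definition adj (R : realType) (H : hilbert R) (T : op H) : op H :=
  xget (fun=> 0) [set S : op H | forall x y : H, dotp (T x) y = dotp x (S y)].

Definition op_le (R : realType) (H : hilbert R) (S T : op H) : Prop :=
  forall x : H, dotp (S x) x <= dotp (T x) x.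

Definition commutant (R : realType) (H : hilbert R) (S : set (op H)) :
    set (op H) :=
  [set T : op H | bounded_op T /\ forall X : op H, S X -> T \o X = X \o T].

Definition von_neumann (R : realType) (H : hilbert R) (M : set (op H)) : Prop :=
  [/\ (forall x, M x -> bounded_op x),
      (forall x, M x -> M (adj x)) &
      commutant (commutant M) = M].

Definition unit_ball (R : realType) (H : hilbert R) (M : set (op H)) :
    set (op H) :=
  [set x | M x /\ (opnorm x <= 1)%E].

Definition linear_on (R : realType) (H : hilbert R) (V : lmodType R[i])
    (M : set (op H)) (f : op H -> V) : Prop :=
  forall (c : R[i]) (x y : op H), M x -> M y ->
    f (fun v => c *: x v + y v) = c *: f x + f y.

(* Normality of a positive functional f on M: f (sup D) = sup (f D) for every
   upward directed set D of positive elements having a least upper bound. *)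
Definition normal_on (R : realType) (H : hilbert R) (M : set (op H))
    (f : op H -> R[i]) : Prop :=
  forall (D : set (op H)) (s : op H),
    D `<=` M -> D !=set0 -> (forall x, D x -> op_le (fun=> 0) x) ->
    (forall x y, D x -> D y -> exists z, [/\ D z, op_le x z & op_le y z]) ->
    M s -> (forall x, D x -> op_le x s) ->
    (forall s', M s' -> (forall x, D x -> op_le x s') -> op_le s s') ->
    supremums (f @` D) (f s).

Definition faithful_normal_trace (R : realType) (H : hilbert R)
    (M : set (op H)) (tau : op H -> R[i]) : Prop :=
  linear_on (V := R[i]^o) M tau /\
  [/\ (forall x, M x -> 0 <= tau (adj x \o x)),
      tau id = 1,
      (forall x, M x -> tau (adj x \o x) = 0 -> x = (fun=> 0)),
      (forall x y, M x -> M y -> tau (x \o y) = tau (y \o x)) &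
      normal_on M tau].

Definition norm2 (R : realType) (H : hilbert R) (tau : op H -> R[i])
    (x : op H) : R :=
  Num.sqrt (complex.Re (tau (adj x \o x))).

Definition star_linear (R : realType) (H K : hilbert R) (M : set (op H))
    (pi : op H -> op K) : Prop :=
  [/\ (forall x, M x -> bounded_op (pi x)),
      (forall v : K, linear_on M (fun x => pi x v)),
      pi id = id &
      (forall x, M x -> pi (adj x) = adj (pi x))].

Definition star_hom (R : realType) (H K : hilbert R) (M : set (op H))
    (pi : op H -> op K) : Prop :=
  star_linear M pi /\
  forall x y, M x -> M y -> pi (x \o y) = pi x \o pi y.

Definition star_antihom (R : realType) (H K : hilbert R) (M : set (op H))
    (pi : op H -> op K) : Prop :=
  star_linear M pi /\
  forall x y, M x -> M y -> pi (x \o y) = pi y \o pi x.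

Definition star_iso (R : realType) (H K : hilbert R) (M : set (op H))
    (N : set (op K)) (pi : op H -> op K) : Prop :=
  star_hom M pi /\ set_bij M N pi.

Record bimodule (R : realType) (H : hilbert R) (M : set (op H)) := Bimodule {
  bcar :> hilbert R ;
  lact : op H -> op bcar ;
  ract : op H -> op bcar ;
  _ : star_hom M lact ;
  _ : star_antihom M ract ;
  _ : forall x y, M x -> M y -> lact x \o ract y = ract y \o lact x ;
  _ : forall v : bcar, normal_on M (fun x => dotp (lact x v) v) ;
  _ : forall v : bcar, normal_on M (fun x => dotp (ract x v) v) }.

Arguments lact {R H M} b _ _.
Arguments ract {R H M} b _ _.

(* L is L^2(M, tau), i.e. the completion of M for <x, y> = tau (y^* x), with
   hat : M -> L the canonical dense embedding, and its standard bimodule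
   structure. *)
Definition is_L2 (R : realType) (H : hilbert R) (M : set (op H))
    (tau : op H -> R[i]) (L : bimodule M) (hat : op H -> L) : Prop :=
  [/\ linear_on M hat,
      (forall x y, M x -> M y -> dotp (hat x) (hat y) = tau (adj y \o x)),
      dense (hat @` M),
      (forall x y, M x -> M y -> lact L x (hat y) = hat (x \o y)) &
      (forall x y, M x -> M y -> ract L x (hat y) = hat (y \o x))].

Definition separable (R : realType) (H : hilbert R) : Prop :=
  exists D : set H, countable D /\ dense D.

Definition tracial (R : realType) (H : hilbert R) (M : set (op H))
    (tau : op H -> R[i]) : Prop :=
  [/\ von_neumann M,
      faithful_normal_trace M tau &
      exists (L : bimodule M) (hat : op H -> L), is_L2 tau hat /\ separable L].

(* Amenability: a (not necessarily normal) M-central state on B(L^2(M))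
   restricting to tau on M. *)
Definition amenable_vN (R : realType) (H : hilbert R) (M : set (op H))
    (tau : op H -> R[i]) : Prop :=
  exists (L : bimodule M) (hat : op H -> L) (phi : op L -> R[i]),
    is_L2 tau hat /\
    [/\ linear_on (V := R[i]^o) [set T : op L | bounded_op T] phi,
        (forall T : op L, bounded_op T -> 0 <= phi (adj T \o T)),
        phi id = 1,
        (forall x, M x -> phi (lact L x) = tau x) &
        (forall (x : op H) (T : op L), M x -> bounded_op T ->
           phi (lact L x \o T) = phi (T \o lact L x))].

(* The action of \sum_i a_i (x) b_i^op in M (.) M^op. *)
Definition bimod_rep (R : realType) (H : hilbert R) (M : set (op H))
    (K : bimodule M) (n : nat) (a b : 'I_n -> op H) : op K :=
  fun v => \sum_(i < n) ract K (b i) (lact K (a i) v).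

Arguments bimod_rep {R H M} K {n} a b _.

Definition weakly_contained (R : realType) (H : hilbert R) (M : set (op H))
    (K1 K2 : bimodule M) : Prop :=
  forall (n : nat) (a b : 'I_n -> op H),
    (forall i, M (a i)) -> (forall i, M (b i)) ->
    (opnorm (bimod_rep K1 a b) <= opnorm (bimod_rep K2 a b))%E.

(* T is the Hilbert tensor product L^2(M) (x) L^2(M) with
   x (u (x) v) y = x u (x) v y. *)
Definition is_coarse (R : realType) (H : hilbert R) (M : set (op H))
    (tau : op H -> R[i]) (T : bimodule M) : Prop :=
  exists (L : bimodule M) (hat : op H -> L) (tens : {bilinear L -> L -> T}),
    is_L2 tau hat /\
    [/\ (forall u v u' v' : L,
           dotp (tens u v) (tens u' v') = dotp u u' * dotp v v'),
        dense [set z : T | exists (n : nat) (u v : 'I_n -> L),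
                 z = \sum_(i < n) tens (u i) (v i)],
        (forall x u v, M x -> lact T x (tens u v) = tens (lact L x u) v) &
        (forall x u v, M x -> ract T x (tens u v) = tens u (ract L x v))].

(* K is the M-M-bimodule L^2(Mt) (-) L^2(M), for M contained in Mt; its image
   under U is the orthogonal complement of the closure of hat (M), which is
   L^2(M). *)
Definition is_orth_L2 (R : realType) (H : hilbert R) (M Mt : set (op H))
    (tau : op H -> R[i]) (K : bimodule M) : Prop :=
  exists (L : bimodule Mt) (hat : op H -> L) (U : {linear K -> L}),
    is_L2 tau hat /\
    [/\ (forall u v : K, dotp (U u) (U v) = dotp u v),
        range U = [set w : L | forall x, M x -> dotp w (hat x) = 0],
        (forall x u, M x -> U (lact K x u) = lact L x (U u)) &
        (forall x u, M x -> U (ract K x u) = ract L x (U u))].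

Definition is_cond_exp (R : realType) (H : hilbert R) (M A : set (op H))
    (tau : op H -> R[i]) (E : op H -> op H) : Prop :=
  [/\ (forall x, M x -> A (E x)),
      (forall a, A a -> E a = a),
      (forall v : H, linear_on M (fun x => E x v)),
      (forall x, M x -> op_le (fun=> 0) (E (adj x \o x))) &
      (forall a x b, A a -> M x -> A b -> E (a \o x \o b) = a \o E x \o b) /\
      (forall x, M x -> tau (E x) = tau x)].

(* E_A : M -> A; its values on M are uniquely determined. *)
Definition cond_exp (R : realType) (H : hilbert R) (M A : set (op H))
    (tau : op H -> R[i]) : op H -> op H :=
  xget (id : op H -> op H) [set E : op H -> op H | is_cond_exp M A tau E].

Definition mixing_rel (R : realType) (H : hilbert R) (M A : set (op H))
    (tau : op H -> R[i]) (K : bimodule M) : Prop :=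
  forall x_ : nat -> op H,
    (forall n, unit_ball M (x_ n)) ->
    (forall a b, M a -> M b ->
       norm2 tau (cond_exp M A tau (a \o x_ n \o b)) @[n --> \oo] --> (0 : R)) ->
    forall u v : K,
      ereal_sup [set (modulus (dotp (ract K y (lact K (x_ n) u)) v))%:E
                | y in unit_ball M] @[n --> \oo] --> (0 : \bar R)%E.

Definition scalars (R : realType) (H : hilbert R) : set (op H) :=
  [set T | exists c : R[i], T = fun v => c *: v].

Definition trace_aut (R : realType) (H : hilbert R) (M : set (op H))
    (tau : op H -> R[i]) (f : op H -> op H) : Prop :=
  star_iso M M f /\ forall x, M x -> tau (f x) = tau x.

Definition unif_to_id (R : realType) (H : hilbert R) (tau : op H -> R[i])
    (alpha : R -> op H -> op H) (N : set (op H)) : Prop :=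
  ereal_sup [set (norm2 tau (fun v => alpha t x v - x v))%:E
            | x in unit_ball N] @[t --> (0 : R)] --> (0 : \bar R)%E.

(* M and Mt act on the same space H; the trace of M is the restriction of the
   trace tau of Mt. *)
Definition s_malleable (R : realType) (H : hilbert R) (M Mt : set (op H))
    (tau : op H -> R[i]) (alpha : R -> op H -> op H) : Prop :=
  [/\ tracial Mt tau, M `<=` Mt, von_neumann M &
   [/\ (forall t, trace_aut Mt tau (alpha t)),
       (forall x, Mt x -> alpha 0 x = x),
       (forall s t x, Mt x -> alpha (s + t) x = alpha s (alpha t x)) &
       (forall x, Mt x ->
          norm2 tau (fun v => alpha t x v - x v) @[t --> (0 : R)] --> (0 : R))] /\
   (exists beta : op H -> op H,
      [/\ trace_aut Mt tau beta,
          (forall x, M x -> beta x = x),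
          (forall x, Mt x -> beta (beta x) = x) &
          (forall t x, Mt x -> beta (alpha t x) = alpha (- t) (beta x))]) /\
   ~ unif_to_id tau alpha M].

(* (M, tau) is in the class M_0, with associated deformation (Mt, alpha). *)
Definition class_M0_with (R : realType) (H : hilbert R) (M Mt : set (op H))
    (tau : op H -> R[i]) (alpha : R -> op H -> op H) : Prop :=
  [/\ tracial M tau,
      ~ amenable_vN M tau,
      s_malleable M Mt tau alpha &
      exists K T : bimodule M,
        [/\ is_orth_L2 Mt tau K,
            mixing_rel (@scalars R H) tau K,
            is_coarse tau T &
            weakly_contained K T]].

Definition is_mean (R : realType) (G : groupType) (m : set G -> R) : Prop :=
  [/\ (forall A, 0 <= m A), m setT = 1 &
      (forall A B, A `&` B = set0 -> m (A `|` B) = m A + m B)].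

Definition amenable_group (R : realType) (G : groupType) : Prop :=
  exists m : set G -> R, is_mean m /\
    forall (g : G) (A : set G), m [set (g * x)%g | x in A] = m A.

Definition inner_amenable (R : realType) (G : groupType) : Prop :=
  exists m : set G -> R,
    [/\ is_mean m, (forall g : G, m [set g] = 0) &
        forall (g : G) (A : set G), m [set (g * x * g^-1)%g | x in A] = m A].

(* K is l^2(G), with orthonormal basis delta, and lambda is the left regular
   representation. *)
Definition is_left_regular (R : realType) (G : groupType) (K : hilbert R)
    (delta : G -> K) (lambda : G -> op K) : Prop :=
  [/\ (forall g h, dotp (delta g) (delta h) = (g == h)%:R),
      dense [set z : K | exists (n : nat) (c : 'I_n -> R[i]) (g : 'I_n -> G),
               z = \sum_(i < n) c i *: delta (g i)],
      (forall g, bounded_op (lambda g)) &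
      (forall g h, lambda g (delta h) = delta (g * h)%g)].

(* N is a copy of L(G) = lambda(G)'' acting on H.  No compatibility between a
   trace on N and the canonical trace of L(G) is asked for. *)
Definition is_group_vN (R : realType) (G : groupType) (H : hilbert R)
    (N : set (op H)) : Prop :=
  exists (K : hilbert R) (delta : G -> K) (lambda : G -> op K)
         (theta : op K -> op H),
    [/\ is_left_regular delta lambda, von_neumann N &
        star_iso (commutant (commutant (range lambda))) N theta].

(* Main.v *)
Require Import Defs.
From mathcomp Require Import ring lra.

(** Why the theorem holds.  Suppose first that alpha_t moves most group
    unitaries u_h little, most being measured by the conjugation invariant mean
    m of an inner amenable group.  Any g can be written as k^-1 g h with
    k = g h g^-1; since m vanishes on points, h and k can both be taken among
    the little moved elements and tending to infinity.  Let D be the odd part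
    alpha_s (u_g) - alpha_(-s) (u_g) of the displacement; the symmetry beta
    makes it orthogonal to M, so that mixing applies to it.  Then
    u_k^-1 D u_h is close to D because u_h and u_k are hardly moved, and it is
    asymptotically orthogonal to D by mixing.  So D is small, uniformly in g
    (displacement_everywhere), and an automorphism that is uniformly close to the
    identity on the unitaries u_g is uniformly close to it on the unit
    ball of the algebra they generate: take the vector of least norm in the
    convex hull of the alpha_t (u_g) u_g^* (close_on_group_close_on_ball).

    That most elements are moved little comes from the spectral gap of a
    non-amenable group (nonamenable_gap): on l^2(G) the average over some finite
    set F has norm rho < 1.  Conjugation v |-> u_g v u_g^* on the coarse
    bimodule, hence on the orthogonal complement of L^2(M), is weakly contained
    in the regular representation (coarse_conj_opbd), and tensoring it with the
    permutation representation of G on itself by conjugation preserves the gap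
    (field_opbd).  The odd parts of alpha_t (u_h), seen as a field over h, are
    almost fixed by F once t is small, because alpha_t barely moves the finitely
    many u_g with g in F.  Weighting the field by the square root of a finitely
    supported probability measure that is almost invariant under conjugation by
    F turns it into a vector to which the gap applies.  Such measures
    approximate m by Day's convexity argument (near_invariant_measure), which
    rests on the Hahn-Banach theorem.  The gap makes the field small in the
    mean (large_set_small_mean).

    The trace tau need not restrict to the canonical trace of L(G), and the
    isomorphism theta is only an algebraic one.  It is normal because it
    preserves order, and tau o theta is absolutely continuous with respect to
    the canonical trace: up to a cut-off e close to 1, its 2-norm is dominated
    by x |-> |x delta_1| (trace_absolute_continuity).  This gives the decay of
    tau (u_h c) as h tends to infinity, which is what the mixing hypothesis asks
    for (gunit_decay), and the passage from the group ring to its weak closure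
    (intertwiner_extends).

    Norm estimates in a tensor product are obtained from the moments of a
    positive element: these are log-convex, so an exponential bound on them with
    any constant already gives the sharp bound on the first one (power_trick).
    It is enough then to estimate the coefficients of a dense set of vectors,
    with constants that depend on the vector. *)

Set Implicit Arguments.
Unset Strict Implicit.
Unset Printing Implicit Defensive.

Import Order.TTheory GRing.Theory Num.Theory.
Import numFieldNormedType.Exports.

Local Open Scope classical_set_scope.
Local Open Scope ring_scope.

Local Notation Re := complex.Re.
Local Notation Im := complex.Im.

(** * Complex scalars and real limits *)

Section ComplexScalars.
Context (R : realType).
Implicit Types (z w : R[i]) (r : R).

Notation conj := (@Num.conj R[i]).

Definition rc (r : R) : R[i] := Complex r 0.

Lemma cReD z w : Re (z + w) = Re z + Re w. Proof. by case: z; case: w. Qed.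
Lemma cReN z : Re (- z) = - Re z. Proof. by case: z. Qed.
Lemma cReB z w : Re (z - w) = Re z - Re w. Proof. by rewrite cReD cReN. Qed.
Lemma cReM z w : Re (z * w) = Re z * Re w - Im z * Im w.
Proof. by case: z; case: w. Qed.
Lemma cRe_sum (I : Type) (s : seq I) (F : I -> R[i]) :
  Re (\sum_(i <- s) F i) = \sum_(i <- s) Re (F i).
Proof. by elim/big_rec2: _ => [|i a b _ <-]; rewrite ?cReD. Qed.
Lemma cRe_conj z : Re (conj z) = Re z. Proof. by case: z. Qed.
Lemma cIm_conj z : Im (conj z) = - Im z. Proof. by case: z. Qed.
Lemma rcD (a b : R) : rc (a + b) = rc a + rc b.
Proof. by rewrite /rc; simpc. Qed.
Lemma rcN (a : R) : rc (- a) = - rc a. Proof. by rewrite /rc; simpc. Qed.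
Lemma rcM (a b : R) : rc (a * b) = rc a * rc b.
Proof. by rewrite /rc; simpc. Qed.
Lemma rc1 : rc 1 = 1. Proof. by []. Qed.
Lemma rc0 : rc 0 = 0. Proof. by []. Qed.
Lemma Re_rcM r z : Re (rc r * z) = r * Re z.
Proof. by rewrite cReM /= mul0r subr0. Qed.
Lemma rcV r : rc r^-1 = (rc r)^-1.
Proof.
have [->|r0] := eqVneq r 0; first by rewrite !invr0.
have h : rc r * rc r^-1 = 1 by rewrite -rcM mulfV.
have u : rc r \is a GRing.unit.
  by apply/unitrP; exists (rc r^-1); rewrite h mulrC h.
by apply: (mulrI u); rewrite h mulrV.
Qed.

Lemma complex_ext z w : Re z = Re w -> Im z = Im w -> z = w.
Proof. by case: z; case: w => /= ? ? ? ? -> ->. Qed.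

Lemma modulusE z : modulus z = Num.sqrt (Re z ^+ 2 + Im z ^+ 2).
Proof. by rewrite /modulus normc_def. Qed.
Lemma modulus_ge0 z : 0 <= modulus z.
Proof. by rewrite modulusE sqrtr_ge0. Qed.
Lemma normE z : `|z| = rc (modulus z).
Proof. by rewrite normc_def modulusE. Qed.
Lemma modulusM z w : modulus (z * w) = modulus z * modulus w.
Proof. by rewrite /modulus normrM !normE -rcM. Qed.
Lemma modulus_conj z : modulus (conj z) = modulus z.
Proof. by rewrite !modulusE cRe_conj cIm_conj sqrrN. Qed.
Lemma modulus_rc r : modulus (rc r) = `|r|.
Proof. by rewrite modulusE /= expr0n addr0 sqrtr_sqr. Qed.
Lemma modulus0 : modulus (0 : R[i]) = 0.
Proof. by rewrite (modulus_rc 0) normr0. Qed.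
Lemma modulus1 : modulus (1 : R[i]) = 1.
Proof. by rewrite (modulus_rc 1) normr1. Qed.
Lemma sqr_modulus z : modulus z ^+ 2 = Re z ^+ 2 + Im z ^+ 2.
Proof. by rewrite modulusE sqr_sqrtr // addr_ge0 ?sqr_ge0. Qed.
Lemma Re_le_modulus z : `|Re z| <= modulus z.
Proof.
by rewrite modulusE -(sqrtr_sqr (Re z)) ler_wsqrtr// lerDl sqr_ge0.
Qed.
Lemma modulus_le_ReIm z : modulus z <= `|Re z| + `|Im z|.
Proof.
rewrite -(@ler_pXn2r _ 2) ?nnegrE ?modulus_ge0 ?addr_ge0// sqr_modulus.
rewrite sqrrD !real_normK ?num_real// addrAC lerDl.
by rewrite mulrn_wge0 ?mulr_ge0.
Qed.

Lemma phase_exists z : exists2 c, modulus c <= 1 & c * z = rc (modulus z).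
Proof.
have [->|z0] := eqVneq z 0; first by exists 0; rewrite ?modulus0 ?mul0r.
exists (conj z * (rc (modulus z))^-1).
  rewrite modulusM modulus_conj -rcV modulus_rc ger0_norm ?invr_ge0 ?modulus_ge0//.
  have [->|m0] := eqVneq (modulus z) 0; first by rewrite mul0r.
  by rewrite mulfV.
have e : conj z * z = rc (modulus z) * rc (modulus z).
  by rewrite mulrC -normCK normE expr2.
rewrite mulrAC e mulfK// -normE normr_eq0//.
Qed.

End ComplexScalars.

Section RealSequences.
Context (R : realType).
Implicit Types (u : nat -> R) (l a : R).

Lemma lim_ge_cst u l a : (forall n, a <= u n) -> u @ \oo --> l -> a <= l.
Proof.
move=> h; apply: (@closed_cvg _ _ _ _ u (fun r : R => a <= r)); first exact: closed_ge.
by near=> n; exact: h.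
Unshelve. all: by end_near. Qed.

Lemma lim_le_cst u l a : (forall n, u n <= a) -> u @ \oo --> l -> l <= a.
Proof.
move=> h; apply: (@closed_cvg _ _ _ _ u (fun r : R => r <= a)); first exact: closed_le.
by near=> n; exact: h.
Unshelve. all: by end_near. Qed.

End RealSequences.

(** * Hilbert space geometry *)

Definition rdot (R : realType) (H : hilbert R) (x y : H) : R :=
  complex.Re (dotp x y).

Section HilbertSpace.
Context (R : realType) (H : hilbert R).
Implicit Types (x y z v w : H) (c : R[i]) (r : R).

Lemma dotpDl x y z : dotp (x + y) z = dotp x z + dotp y z.
Proof. exact: linearDl. Qed.
Lemma dotpZl c x y : dotp (c *: x) y = c * dotp x y.
Proof. exact: linearZl_LR. Qed.
Lemma dotpC x y : dotp x y = Num.conj (dotp y x).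
Proof. by rewrite /dotp hermC /= expr0 mul1r. Qed.
Lemma dotpDr x y z : dotp z (x + y) = dotp z x + dotp z y.
Proof. by rewrite dotpC dotpDl rmorphD /= -!dotpC. Qed.
Lemma dotpZr c x y : dotp x (c *: y) = Num.conj c * dotp x y.
Proof. by rewrite dotpC dotpZl rmorphM /= -dotpC. Qed.
Lemma dotp0l x : dotp 0 x = 0.
Proof. by rewrite -(scale0r (0:H)) dotpZl mul0r. Qed.
Lemma dotp0r x : dotp x 0 = 0.
Proof. by rewrite dotpC dotp0l rmorph0. Qed.
Lemma dotpNl x y : dotp (- x) y = - dotp x y.
Proof. by rewrite -scaleN1r dotpZl mulN1r. Qed.
Lemma dotpNr x y : dotp x (- y) = - dotp x y.
Proof. by rewrite dotpC dotpNl rmorphN /= -dotpC. Qed.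
Lemma dotpBl x y z : dotp (x - y) z = dotp x z - dotp y z.
Proof. by rewrite dotpDl dotpNl. Qed.
Lemma dotp_suml (I : Type) (s : seq I) (P : pred I) (F : I -> H) x :
  dotp (\sum_(i <- s | P i) F i) x = \sum_(i <- s | P i) dotp (F i) x.
Proof. by elim/big_rec2: _ => [|i a b _ <-]; rewrite ?dotp0l ?dotpDl. Qed.
Lemma dotp_sumr (I : Type) (s : seq I) (P : pred I) (F : I -> H) x :
  dotp x (\sum_(i <- s | P i) F i) = \sum_(i <- s | P i) dotp x (F i).
Proof. by elim/big_rec2: _ => [|i a b _ <-]; rewrite ?dotp0r ?dotpDr. Qed.

Lemma rdotC x y : rdot x y = rdot y x.
Proof. by rewrite /rdot dotpC cRe_conj. Qed.
Lemma rdotDl x y z : rdot (x + y) z = rdot x z + rdot y z.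
Proof. by rewrite /rdot dotpDl cReD. Qed.
Lemma rdotDr x y z : rdot z (x + y) = rdot z x + rdot z y.
Proof. by rewrite /rdot dotpDr cReD. Qed.
Lemma rdotNl x y : rdot (- x) y = - rdot x y.
Proof. by rewrite /rdot dotpNl cReN. Qed.
Lemma rdotNr x y : rdot x (- y) = - rdot x y.
Proof. by rewrite /rdot dotpNr cReN. Qed.
Lemma rdotBl x y z : rdot (x - y) z = rdot x z - rdot y z.
Proof. by rewrite rdotDl rdotNl. Qed.
Lemma rdotBr x y z : rdot z (x - y) = rdot z x - rdot z y.
Proof. by rewrite rdotDr rdotNr. Qed.
Lemma rdotZl r x y : rdot (rc r *: x) y = r * rdot x y.
Proof. by rewrite /rdot dotpZl Re_rcM. Qed.
Lemma rdotZr r x y : rdot x (rc r *: y) = r * rdot x y.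
Proof. by rewrite rdotC rdotZl rdotC. Qed.
Lemma rdot0l x : rdot 0 x = 0. Proof. by rewrite /rdot dotp0l. Qed.
Lemma rdot0r x : rdot x 0 = 0. Proof. by rewrite /rdot dotp0r. Qed.
Lemma rdot_suml (I : Type) (s : seq I) (P : pred I) (F : I -> H) x :
  rdot (\sum_(i <- s | P i) F i) x = \sum_(i <- s | P i) rdot (F i) x.
Proof. by elim/big_rec2: _ => [|i a b _ <-]; rewrite ?rdot0l ?rdotDl. Qed.
Lemma rdot_sumr (I : Type) (s : seq I) (P : pred I) (F : I -> H) x :
  rdot x (\sum_(i <- s | P i) F i) = \sum_(i <- s | P i) rdot x (F i).
Proof. by elim/big_rec2: _ => [|i a b _ <-]; rewrite ?rdot0r ?rdotDr. Qed.

(** The imaginary part of the inner product is a real part too, so that the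
    real inner product determines the complex one. *)
Lemma Im_dotp x y : Im (dotp x y) = - rdot ('i%C *: x) y.
Proof. by rewrite /rdot dotpZl; rewrite cReM /=; ring. Qed.
Lemma dotp_ext x y x' y' : rdot x y = rdot x' y' ->
  rdot ('i%C *: x) y = rdot ('i%C *: x') y' -> dotp x y = dotp x' y'.
Proof. by move=> h1 h2; apply: complex_ext => //; rewrite !Im_dotp h2. Qed.

Lemma norm_hnorm x : `|x| = rc (hnorm x).
Proof.
have := normr_ge0 x; rewrite lecE /= => /andP[/eqP h _].
by apply: complex_ext.
Qed.
Lemma hnorm_ge0 x : 0 <= hnorm x.
Proof. by have := normr_ge0 x; rewrite norm_hnorm lecR. Qed.
Lemma sqr_hnorm x : hnorm x ^+ 2 = rdot x x.
Proof.
have h (K : hilbert R) (u : K) : `|u| ^+ 2 = hdot K u u by case: K u.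
by rewrite /rdot /dotp -h norm_hnorm [in RHS]expr2 -rcM expr2.
Qed.
Lemma dotp_hnorm x : dotp x x = rc (hnorm x ^+ 2).
Proof.
have h (K : hilbert R) (u : K) : `|u| ^+ 2 = hdot K u u by case: K u.
by rewrite /dotp -h norm_hnorm expr2 -rcM expr2.
Qed.
Lemma rdot_ge0 x : 0 <= rdot x x. Proof. by rewrite -sqr_hnorm sqr_ge0. Qed.
Lemma hnormD x y : hnorm (x + y) <= hnorm x + hnorm y.
Proof. by have := ler_normD x y; rewrite !norm_hnorm -rcD lecR. Qed.
Lemma hnormZ c x : hnorm (c *: x) = modulus c * hnorm x.
Proof. by rewrite /hnorm normrZ normE norm_hnorm -rcM. Qed.
Lemma hnormZr r x : hnorm (rc r *: x) = `|r| * hnorm x.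
Proof. by rewrite hnormZ modulus_rc. Qed.
Lemma hnormN x : hnorm (- x) = hnorm x.
Proof. by rewrite /hnorm normrN. Qed.
Lemma hnorm0 : hnorm (0 : H) = 0. Proof. by rewrite /hnorm normr0. Qed.
Lemma hnormB x y : hnorm (x - y) <= hnorm x + hnorm y.
Proof. by rewrite (le_trans (hnormD _ _)) ?hnormN. Qed.
Lemma hnorm_distC x y : hnorm (x - y) = hnorm (y - x).
Proof. by rewrite -hnormN opprB. Qed.
Lemma hnorm_le_dist x y : hnorm x <= hnorm y + hnorm (x - y).
Proof. by have := hnormD y (x - y); rewrite addrC subrK. Qed.
Lemma hnorm_tri z x y : hnorm (x - y) <= hnorm (x - z) + hnorm (z - y).
Proof. by have := hnormD (x - z) (z - y); rewrite addrA subrK. Qed.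
Lemma hnorm_eq0 x : hnorm x = 0 -> x = 0.
Proof. by move=> h; apply/normr0_eq0; rewrite norm_hnorm h. Qed.
Lemma hnorm_sum (I : Type) (s : seq I) (P : pred I) (F : I -> H) :
  hnorm (\sum_(i <- s | P i) F i) <= \sum_(i <- s | P i) hnorm (F i).
Proof.
elim/big_rec2: _ => [|i a b _ h]; rewrite ?hnorm0//.
by rewrite (le_trans (hnormD _ _))// lerD2l.
Qed.

Lemma sqr_hnormD x y :
  hnorm (x + y) ^+ 2 = hnorm x ^+ 2 + 2 * rdot x y + hnorm y ^+ 2.
Proof. by rewrite !sqr_hnorm rdotDl !rdotDr (rdotC y x); ring. Qed.
Lemma sqr_hnormB x y :
  hnorm (x - y) ^+ 2 = hnorm x ^+ 2 - 2 * rdot x y + hnorm y ^+ 2.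
Proof. by rewrite sqr_hnormD hnormN rdotNr; ring. Qed.
Lemma parallelogram x y :
  hnorm (x - y) ^+ 2 = 2 * hnorm x ^+ 2 + 2 * hnorm y ^+ 2 - hnorm (x + y) ^+ 2.
Proof. by rewrite sqr_hnormB sqr_hnormD; ring. Qed.

Lemma cauchy_schwarz_rdot x y : rdot x y <= hnorm x * hnorm y.
Proof.
have [y0|y0] := eqVneq (hnorm y) 0.
  by rewrite y0 (hnorm_eq0 y0) rdot0r mulr0.
have yp : 0 < hnorm y by rewrite lt_neqAle eq_sym y0 hnorm_ge0.
have [x0|x0] := eqVneq (hnorm x) 0.
  by rewrite x0 (hnorm_eq0 x0) rdot0l mul0r.
have xp : 0 < hnorm x by rewrite lt_neqAle eq_sym x0 hnorm_ge0.
have := sqr_ge0 (hnorm (rc (hnorm y) *: x - rc (hnorm x) *: y)).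
rewrite sqr_hnormB !hnormZr rdotZl rdotZr !ger0_norm ?hnorm_ge0//.
have -> : (hnorm y * hnorm x) ^+ 2 - 2 * (hnorm y * (hnorm x * rdot x y)) +
   (hnorm x * hnorm y) ^+ 2 = 2 * (hnorm x * hnorm y) *
   (hnorm x * hnorm y - rdot x y) by ring.
by rewrite pmulr_rge0 ?subr_ge0// mulr_gt0 ?mulr_gt0.
Qed.

Lemma cauchy_schwarz x y : modulus (dotp x y) <= hnorm x * hnorm y.
Proof.
have [c c1 hc] := phase_exists (dotp x y).
have -> : modulus (dotp x y) = rdot (c *: x) y by rewrite /rdot dotpZl hc.
rewrite (le_trans (cauchy_schwarz_rdot _ _))// hnormZ.
by rewrite ler_wpM2r ?hnorm_ge0// ler_piMl ?hnorm_ge0.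
Qed.

Lemma abs_rdot x y : `|rdot x y| <= hnorm x * hnorm y.
Proof. exact: le_trans (Re_le_modulus _) (cauchy_schwarz _ _). Qed.

Lemma hnorm_le_rdot x r : 0 <= r -> (forall y, rdot x y <= r * hnorm y) -> hnorm x <= r.
Proof.
move=> r0 h; have := h x; rewrite -sqr_hnorm expr2.
have [->|x0] := eqVneq (hnorm x) 0; first by [].
by rewrite ler_pM2r// lt_neqAle eq_sym x0 hnorm_ge0.
Qed.

Lemma rdot_eq0 x : (forall y, rdot x y = 0) -> x = 0.
Proof.
by move=> h; apply: hnorm_eq0; apply/eqP; rewrite -sqrf_eq0 sqr_hnorm h.
Qed.
Lemma rdot_inj x x' : (forall y, rdot x y = rdot x' y) -> x = x'.
Proof.
by move=> h; apply/eqP; rewrite -subr_eq0; apply/eqP; apply: rdot_eq0 => y;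
  rewrite rdotBl h subrr.
Qed.

(** The norm of H takes its values in R[i], so convergence is stated with hnorm,
    for which the limit theorems of real sequences are available. *)
Definition hcvg (u : nat -> H) (l : H) := (fun n => hnorm (u n - l)) @ \oo --> (0 : R).

Lemma hcvgP u l : hcvg u l <->
  forall e : R, 0 < e -> exists N, forall n, (N <= n)%N -> hnorm (u n - l) < e.
Proof.
split=> [/cvgrPdist_lt h e e0|h].
  have [N _ hN] := h _ e0; exists N => n /hN /=.
  by rewrite sub0r normrN ger0_norm ?hnorm_ge0.
apply/cvgrPdist_lt => e e0; have [N hN] := h _ e0; exists N => // n /hN /=.
by rewrite sub0r normrN ger0_norm ?hnorm_ge0.
Qed.

Lemma hcvg_le u l (a : nat -> R) : (forall n, hnorm (u n - l) <= a n) ->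
  a @ \oo --> (0 : R) -> hcvg u l.
Proof.
move=> h ha; apply: (@squeeze_cvgr _ _ _ _ (cst 0) a) => //; last exact: cvg_cst.
by near=> n; rewrite h hnorm_ge0.
Unshelve. all: by end_near. Qed.

Lemma hcvg_ext u u' l : u =1 u' -> hcvg u l -> hcvg u' l.
Proof. by move=> /funext ->. Qed.

Lemma hcvg_cst l : hcvg (fun=> l) l.
Proof. by rewrite /hcvg; under eq_fun do rewrite subrr hnorm0; exact: cvg_cst. Qed.

Lemma hcvg_rdot u l y : hcvg u l -> (fun n => rdot (u n) y) @ \oo --> rdot l y.
Proof.
move=> h; apply/subr_cvg0.
apply: norm_cvg0; apply: (@squeeze_cvgr _ _ _ _ (cst 0) (fun n => hnorm (u n - l) * hnorm y)).
- near=> n; rewrite /= normr_ge0 /=.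
  by have := abs_rdot (u n - l) y; rewrite rdotBl.
- exact: cvg_cst.
- by rewrite -(mul0r (hnorm y)); apply: cvgM => //; exact: cvg_cst.
Unshelve. all: by end_near. Qed.

Lemma hcvg_hnorm u l : hcvg u l -> (fun n => hnorm (u n)) @ \oo --> hnorm l.
Proof.
move=> h; apply/subr_cvg0.
apply: norm_cvg0; apply: (@squeeze_cvgr _ _ _ _ (cst 0) (fun n => hnorm (u n - l))) => //; last exact: cvg_cst.
near=> n; rewrite /= normr_ge0 /= ler_norml.
have := hnorm_le_dist (u n) l; have := hnorm_le_dist l (u n).
rewrite (hnorm_distC l); lra.
Unshelve. all: by end_near. Qed.

Lemma hcvg_unique u l l' : hcvg u l -> hcvg u l' -> l = l'.
Proof.
move=> h h'; apply: rdot_inj => y.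
exact: (cvg_unique _ (hcvg_rdot (y := y) h) (hcvg_rdot h')).
Qed.

Lemma hcvgD u l u' l' : hcvg u l -> hcvg u' l' -> hcvg (fun n => u n + u' n) (l + l').
Proof.
move=> h h'; apply: (@hcvg_le _ _ (fun n => hnorm (u n - l) + hnorm (u' n - l'))).
  by move=> n; rewrite opprD addrACA hnormD.
by rewrite -(addr0 (0 : R)); apply: cvgD.
Qed.

Lemma hcvgZ c u l : hcvg u l -> hcvg (fun n => c *: u n) (c *: l).
Proof.
move=> h; apply: (@hcvg_le _ _ (fun n => modulus c * hnorm (u n - l))).
  by move=> n; rewrite -scalerBr hnormZ.
by rewrite -(mulr0 (modulus c)); apply: cvgM => //; exact: cvg_cst.
Qed.

Definition hcauchy (u : nat -> H) := forall e : R, 0 < e ->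
  exists N, forall m n, (N <= m)%N -> (N <= n)%N -> hnorm (u m - u n) < e.

Lemma hcauchy_cvg u : hcauchy u -> exists l, hcvg u l.
Proof.
move=> hu.
have cu : cauchy (u @ \oo).
  apply: cauchy_exP => e; rewrite ltcE /= => /andP[/eqP Ime Ree].
  have [N hN] := hu _ Ree; exists (u N); exists N => // n /= /(hN N n (leqnn _)).
  by rewrite -ball_normE /= norm_hnorm ltcE /= Ime eqxx.
have fF : ProperFilter (u @ \oo) by exact: fmap_proper_filter.
have hl := (@cauchy_cvgP _ _ fF).1 cu; set l := lim _ in hl.
exists l; apply/hcvgP => e e0.
have := hl (ball l (rc e)); case.
  by apply: nbhsx_ballx; rewrite ltcR.
move=> N _ hN; exists N => n /hN /=.
by rewrite -ball_normE /= norm_hnorm ltcR hnorm_distC.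
Qed.

End HilbertSpace.
 

(** * Bounded operators, minimisation and adjoints *)

Section LinearMaps.
Context (R : realType) (H K : hilbert R) (T : H -> K) (lT : linear T).

Lemma lin0 : T 0 = 0.
Proof. by have := lT (-1) 0 0; rewrite scaler0 addr0 scaleN1r addNr. Qed.
Lemma linD x y : T (x + y) = T x + T y.
Proof. by have := lT 1 x y; rewrite !scale1r. Qed.
Lemma linZ c x : T (c *: x) = c *: T x.
Proof. by have := lT c x 0; rewrite !addr0 lin0 addr0. Qed.
Lemma linN x : T (- x) = - T x. Proof. by rewrite -scaleN1r linZ scaleN1r. Qed.
Lemma linB x y : T (x - y) = T x - T y. Proof. by rewrite linD linN. Qed.
Lemma lin_sum (I : Type) (s : seq I) (P : pred I) (F : I -> H) :
  T (\sum_(i <- s | P i) F i) = \sum_(i <- s | P i) T (F i).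
Proof. by elim/big_rec2: _ => [|i a b _ <-]; rewrite ?lin0 ?linD. Qed.
End LinearMaps.

Definition opbd (R : realType) (H K : hilbert R) (T : H -> K) (c : R) :=
  forall v, hnorm (T v) <= c * hnorm v.

Section BoundedOperators.
Context (R : realType).
Implicit Types (H K L : hilbert R).

Lemma bounded_opP H K (T : H -> K) :
  bounded_op T <-> linear T /\ exists2 c : R, 0 < c & opbd T c.
Proof.
split=> [[lT cT]|[lT [c c0 hc]]]; split=> //.
  have := cT 0; rewrite /continuous_at (lin0 lT) => /cvgrPdist_lt h.
  have /nbhs_ballP[e /=] := h 1 ltr01; rewrite ltcE /= => /andP[/eqP Ime Ree] he.
  exists (2 / complex.Re e); first by rewrite divr_gt0.
  move=> v; have [v0|v0] := eqVneq (hnorm v) 0.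
    by rewrite v0 mulr0 (hnorm_eq0 v0) (lin0 lT) hnorm0.
  have vp : 0 < hnorm v by rewrite lt_neqAle eq_sym v0 hnorm_ge0.
  pose s := complex.Re e / 2 / hnorm v.
  have sp : 0 < s by rewrite !divr_gt0.
  have := he (rc s *: v); rewrite -ball_normE /= !sub0r !normrN !norm_hnorm.
  rewrite hnormZr ger0_norm ?(ltW sp)// /s mulfVK// ltcE /= Ime eqxx /=.
  have -> : complex.Re e / 2 < complex.Re e by lra.
  move=> /(_ isT); rewrite (linZ lT) hnormZr ltcR ger0_norm ?(ltW sp)// /s.
  rewrite -ltr_pdivlMl ?divr_gt0// mulr1 => /ltW /le_trans; apply.
  by rewrite le_eqVlt; apply/orP; left; apply/eqP; field; rewrite v0 gt_eqF.
move=> x; apply/cvgrPdist_lt => e; rewrite ltcE /= => /andP[/eqP Ime Ree].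
apply/nbhs_ballP; exists (rc (complex.Re e / c)); first by rewrite /= ltcR divr_gt0.
move=> y; rewrite -ball_normE /= !norm_hnorm -(linB lT) ltcR ltcE /= Ime eqxx /=.
by move=> h; rewrite (le_lt_trans (hc _))// -ltr_pdivlMl// mulrC.
Qed.

Lemma bounded_linear H K (T : H -> K) : bounded_op T -> linear T.
Proof. by case. Qed.
Lemma bounded_bd H K (T : H -> K) : bounded_op T -> exists2 c : R, 0 < c & opbd T c.
Proof. by case/bounded_opP. Qed.
Lemma bounded_op_bd H K (T : H -> K) c : linear T -> opbd T c -> bounded_op T.
Proof.
move=> lT hc; apply/bounded_opP; split=> //; exists (`|c| + 1).
  by rewrite ltr_wpDl.
move=> v; rewrite (le_trans (hc v))// ler_wpM2r ?hnorm_ge0//.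
by rewrite (le_trans (ler_norm _))// lerDl.
Qed.

Lemma bounded_id H : bounded_op (id : H -> H).
Proof. by apply: (@bounded_op_bd _ _ _ 1) => // v; rewrite mul1r. Qed.
Lemma bounded_comp H K L (S : K -> L) (T : H -> K) :
  bounded_op S -> bounded_op T -> bounded_op (S \o T).
Proof.
move=> /bounded_opP[lS [c c0 hc]] /bounded_opP[lT [d d0 hd]].
apply: (@bounded_op_bd _ _ _ (c * d)) => [a x y|v] /=; first by rewrite lT lS.
by rewrite (le_trans (hc _))// -mulrA ler_wpM2l// ltW.
Qed.
Lemma bounded_lin H K (S T : H -> K) c :
  bounded_op S -> bounded_op T -> bounded_op (fun v => c *: S v + T v).
Proof.
move=> /bounded_opP[lS [a a0 ha]] /bounded_opP[lT [d d0 hd]].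
apply: (@bounded_op_bd _ _ _ (modulus c * a + d)) => [b x y|v] /=.
  rewrite lS lT !scalerDr !scalerA (mulrC c) -!addrA; congr (_ + _).
  by rewrite addrCA.
rewrite (le_trans (hnormD _ _))// mulrDl lerD// hnormZ -mulrA.
by rewrite ler_wpM2l ?modulus_ge0.
Qed.
Lemma bounded_0 H K : bounded_op (fun=> 0 : K) (H := H).
Proof.
by apply: (@bounded_op_bd _ _ _ 0) => [a x y|v]; rewrite ?scaler0 ?addr0// mul0r hnorm0.
Qed.

Lemma hcvg_op H K (T : H -> K) u l : bounded_op T -> hcvg u l -> hcvg (fun n => T (u n)) (T l).
Proof.
move=> /bounded_opP[lT [c c0 hc]] h.
apply: (@hcvg_le _ _ _ _ (fun n => c * hnorm (u n - l))).
  by move=> n; rewrite -(linB lT).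
by rewrite -(mulr0 c); apply: cvgM => //; exact: cvg_cst.
Qed.

Lemma opbd_lim H K (T : nat -> H -> K) S c :
  (forall n, opbd (T n) c) -> (forall v, hcvg (T ^~ v) (S v)) -> opbd S c.
Proof.
by move=> hT hS v; apply: lim_le_cst (hcvg_hnorm (hS v)) => n; exact: hT.
Qed.

Lemma linear_lim H K (T : nat -> H -> K) S :
  (forall n, linear (T n)) -> (forall v, hcvg (T ^~ v) (S v)) -> linear S.
Proof.
move=> lT hS a x y; apply: hcvg_unique (hS _) _.
have := hcvgD (hcvgZ a (hS x)) (hS y).
by rewrite /hcvg; under eq_fun do rewrite -lT.
Qed.

End BoundedOperators.

Section Minimisation.
Context (R : realType) (H : hilbert R).
Variables (C : set H) (f : H -> R).
Let J x := hnorm x ^+ 2 - 2 * f x.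
Hypothesis Cmid : forall x y, C x -> C y -> C (rc 2^-1 *: (x + y)).
Hypothesis fmid : forall x y, f (rc 2^-1 *: (x + y)) = 2^-1 * (f x + f y).

(** The parallelogram law makes J uniformly convex, so minimising sequences are
    Cauchy sequences. *)
Lemma near_minimum_close (m : R) x y : (forall z, C z -> m <= J z) -> C x -> C y ->
  hnorm (x - y) ^+ 2 <= 2 * (J x - m) + 2 * (J y - m).
Proof.
move=> hm Cx Cy; have := hm _ (Cmid Cx Cy).
rewrite /J fmid hnormZr ger0_norm ?invr_ge0// parallelogram exprMn.
lra.
Qed.

Lemma minimizing_sequence (m : R) : C !=set0 -> (forall z, C z -> m <= J z) ->
  exists (m' : R) (u : nat -> H) (l : H), [/\ forall n, C (u n),
    forall z, C z -> m' <= J z, forall n, J (u n) <= m' + n.+1%:R^-1 & hcvg u l].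
Proof.
move=> [x0 Cx0] hm; pose A := J @` C.
have hA : has_inf A.
  by split; [exists (J x0), x0 | exists m => _ [z Cz <-]; exact: hm].
have hlow z : C z -> inf A <= J z by move=> Cz; apply: ge_inf; [case: hA | exists z].
have ex n : exists x, C x /\ J x <= inf A + n.+1%:R^-1.
  have e0 : 0 < n.+1%:R^-1 :> R by rewrite invr_gt0.
  have [_ [x Cx <-] h] := inf_adherent e0 hA.
  by exists x; split=> //; exact: ltW.
have [u hu] := choice ex.
have : hcauchy u.
  move=> e e0.
  have e2 : 0 < e ^+ 2 / 5 by rewrite divr_gt0// exprn_gt0.
  have [N hN] : exists N, forall n, (N <= n)%N -> n.+1%:R^-1 <= e ^+ 2 / 5.
    have [N _ hN] := near_infty_natSinv_lt (PosNum e2).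
    by exists N => n /hN /ltW.
  exists N => p q /hN hp /hN hq.
  rewrite -(@ltr_pXn2r _ 2) ?nnegrE ?hnorm_ge0 ?(ltW e0)//.
  have := near_minimum_close hlow (hu p).1 (hu q).1.
  have := (hu p).2; have := (hu q).2; move: e2 hp hq.
  move: (J (u p)) (J (u q)) (inf A) (p.+1%:R^-1) (q.+1%:R^-1) (hnorm _ ^+ 2) (e ^+ 2).
  move=> *; lra.
move=> /hcauchy_cvg[l hl]; exists (inf A), u, l; split=> // n.
  by case: (hu n).
by case: (hu n).
Qed.

End Minimisation.

Section Riesz.
Context (R : realType).

Lemma linear_quadratic_eq0 (d q : R) : 0 <= q ->
  (forall s, 0 <= 2 * s * d + s ^+ 2 * q) -> d = 0.
Proof.
move=> q0 h; have q1 : 0 < q + 1 by rewrite ltr_wpDl.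
have := h (- d / (q + 1)).
have -> : 2 * (- d / (q + 1)) * d + (- d / (q + 1)) ^+ 2 * q =
   - (d ^+ 2 * (q + 2)) / (q + 1) ^+ 2 by field; rewrite gt_eqF.
rewrite mulNr oppr_ge0 pmulr_lle0 ?invr_gt0 ?exprn_gt0// pmulr_lle0; last first.
  by rewrite ltr_wpDl.
move=> h'; have : d ^+ 2 == 0 by rewrite eq_le h' sqr_ge0.
by rewrite sqrf_eq0 => /eqP.
Qed.

(** The Riesz representation of a real functional minimises
    |x|^2 - 2 f(x); its first variation vanishes there. *)
Lemma riesz_real (H : hilbert R) (f : H -> R) c :
  (forall x y, f (x + y) = f x + f y) -> (forall r x, f (rc r *: x) = r * f x) ->
  (forall x, `|f x| <= c * hnorm x) -> exists l, forall x, f x = rdot x l.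
Proof.
move=> fD fZ fc; pose J x := hnorm x ^+ 2 - 2 * f x.
have [||||m [u [l [_ hm hu hl]]]] :=
    @minimizing_sequence _ H setT f _ _ (- c ^+ 2).
- by [].
- by move=> x y; rewrite fZ fD.
- by exists 0.
- move=> z _; have h1 := fc z; have h2 := ler_norm (f z).
  have := sqr_ge0 (hnorm z - c); rewrite sqrrB -mulr_natl (mulrC (hnorm z)) => h3.
  by rewrite -subr_ge0 opprK; move: (le_trans h2 h1) h3; lra.
exists l => y; apply/eqP; rewrite eq_sym -subr_eq0; apply/eqP.
apply: (@linear_quadratic_eq0 _ (hnorm y ^+ 2)); first exact: sqr_ge0.
move=> s.
have lim : (fun n => n.+1%:R^-1 + 2 * s * (rdot (u n) y - f y) + s ^+ 2 * hnorm y ^+ 2) @ \oo -->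
    0 + 2 * s * (rdot y l - f y) + s ^+ 2 * hnorm y ^+ 2.
  rewrite (rdotC y l).
  apply: cvgD; last exact: cvg_cst.
  apply: cvgD; first exact: cvg_harmonic.
  apply: cvgM; first exact: cvg_cst.
  by apply: cvgB; [exact: hcvg_rdot | exact: cvg_cst].
rewrite -(add0r (2 * s * _)); apply: lim_ge_cst lim => n.
have := hm (u n + rc s *: y) I; have := hu n; rewrite fD fZ sqr_hnormD hnormZr rdotZr.
rewrite exprMn real_normK ?num_real//.
rewrite (_ : 2 * s * _ = 2 * (s * rdot (u n) y) - 2 * (s * f y)); last by ring.
move: (n.+1%:R^-1) (s * rdot _ _) (s * f y) (s ^+ 2 * _) (hnorm _ ^+ 2) (f (u n)) => *; lra.
Qed.

Lemma adj_exists (H : hilbert R) (T : op H) : bounded_op T ->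
  exists S : op H, forall x y, dotp (T x) y = dotp x (S y).
Proof.
move=> /bounded_opP[lT [c c0 hc]].
have ex y : exists l, forall x, rdot (T x) y = rdot x l.
  apply: (@riesz_real _ _ (c * hnorm y)) => [x z|r x|x].
  - by rewrite (linD lT) rdotDl.
  - by rewrite (linZ lT) rdotZl.
  - rewrite (le_trans (abs_rdot _ _))// mulrAC ler_wpM2r ?hnorm_ge0//.
have [S hS] := choice ex.
by exists S => x y; apply: dotp_ext; rewrite ?hS// -(linZ lT) hS.
Qed.

Lemma adjP (H : hilbert R) (T : op H) : bounded_op T ->
  forall x y, dotp (T x) y = dotp x (adj T y).
Proof.
move=> /adj_exists[S hS]; rewrite /adj.
by apply: (@xgetPex _ _ [set S' : op H | forall x y : H, dotp (T x) y = dotp x (S' y)]); exists S.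
Qed.
Lemma adjPl (H : hilbert R) (T : op H) : bounded_op T ->
  forall x y, dotp (adj T x) y = dotp x (T y).
Proof. by move=> bT x y; rewrite dotpC -adjP// -dotpC. Qed.
Lemma rdot_adj (H : hilbert R) (T : op H) : bounded_op T ->
  forall x y, rdot (T x) y = rdot x (adj T y).
Proof. by move=> bT x y; rewrite /rdot adjP. Qed.
Lemma rdot_adjl (H : hilbert R) (T : op H) : bounded_op T ->
  forall x y, rdot (adj T x) y = rdot x (T y).
Proof. by move=> bT x y; rewrite /rdot adjPl. Qed.

Lemma adj_unique (H : hilbert R) (T S : op H) : bounded_op T ->
  (forall x y, rdot (T x) y = rdot x (S y)) -> adj T = S.
Proof.
move=> bT h; apply/funext => y; apply: rdot_inj => x.
by rewrite rdotC -rdot_adj// h rdotC.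
Qed.

Lemma linear_of_adj (H : hilbert R) (T S : op H) :
  (forall x y, dotp (T x) y = dotp x (S y)) -> linear S.
Proof.
move=> h a x y; apply: rdot_inj => z; rewrite rdotC [RHS]rdotC /rdot.
by rewrite dotpDr dotpZr -!h dotpDr dotpZr.
Qed.

Lemma opbd_of_adj (H : hilbert R) (T S : op H) c : 0 <= c ->
  (forall x y, rdot (T x) y = rdot x (S y)) -> opbd T c -> opbd S c.
Proof.
move=> c0 h hc v; apply: hnorm_le_rdot; first by rewrite mulr_ge0 ?hnorm_ge0.
move=> y; rewrite rdotC -h (le_trans (cauchy_schwarz_rdot _ _))// mulrAC.
by rewrite ler_wpM2r ?hnorm_ge0.
Qed.

Lemma bounded_adj (H : hilbert R) (T : op H) : bounded_op T -> bounded_op (adj T).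
Proof.
move=> bT; have [c c0 hc] := bounded_bd bT.
apply: (@bounded_op_bd _ _ _ _ c); first exact: linear_of_adj (adjP bT).
by apply: opbd_of_adj (rdot_adj bT) hc; exact: ltW.
Qed.

Lemma opbd_adj (H : hilbert R) (T : op H) c : bounded_op T -> 0 <= c ->
  opbd T c -> opbd (adj T) c.
Proof. by move=> bT c0; apply: opbd_of_adj (rdot_adj bT). Qed.

Lemma adjK (H : hilbert R) (T : op H) : bounded_op T -> adj (adj T) = T.
Proof.
move=> bT; apply: adj_unique; first exact: bounded_adj.
exact: rdot_adjl.
Qed.
Lemma adj_comp (H : hilbert R) (S T : op H) : bounded_op S -> bounded_op T ->
  adj (S \o T) = adj T \o adj S.
Proof.
move=> bS bT; apply: adj_unique; first exact: bounded_comp.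
by move=> x y /=; rewrite rdot_adj// rdot_adj.
Qed.
Lemma adj_id (H : hilbert R) : adj (id : op H) = id.
Proof. by apply: adj_unique => //; exact: bounded_id. Qed.

End Riesz.

(** * Positive operators in a von Neumann algebra *)

Section VonNeumannClosure.
Context (R : realType) (H : hilbert R) (M : set (op H)) (vM : von_neumann M).

Lemma vN_bounded x : M x -> bounded_op x. Proof. by case: vM => h _ _; exact: h. Qed.
Lemma vN_linear x : M x -> linear x. Proof. by move/vN_bounded/bounded_linear. Qed.
Lemma vN_adj x : M x -> M (adj x). Proof. by case: vM => _ h _; exact: h. Qed.
Lemma vN_commutant x : bounded_op x ->
  (forall y, commutant M y -> x \o y = y \o x) -> M x.
Proof. by case: vM => _ _ {2}<- bx h; split. Qed.
Lemma vN_commute x y : commutant M y -> M x -> x \o y = y \o x.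
Proof. by move=> [_ h] /h. Qed.
Lemma vN_id : M id.
Proof. by apply: vN_commutant => //; exact: bounded_id. Qed.
Lemma vN_comp x y : M x -> M y -> M (x \o y).
Proof.
move=> Mx My; apply: vN_commutant; first by apply: bounded_comp; exact: vN_bounded.
move=> z Mz; rewrite -compA (vN_commute Mz My) compA (vN_commute Mz Mx).
by rewrite compA.
Qed.
Lemma vN_lin c x y : M x -> M y -> M (fun v => c *: x v + y v).
Proof.
move=> Mx My; apply: vN_commutant; first by apply: bounded_lin; exact: vN_bounded.
move=> z Mz; apply/funext => v /=; have lz := bounded_linear Mz.1.
have := congr1 (@^~ v) (vN_commute Mz Mx); have := congr1 (@^~ v) (vN_commute Mz My).
by rewrite /= lz => -> ->.
Qed.
Lemma vN_0 : M (fun=> 0).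
Proof.
apply: vN_commutant; first exact: bounded_0.
by move=> z Mz; apply/funext => v /=; rewrite (lin0 (bounded_linear Mz.1)).
Qed.
Lemma vN_scale c x : M x -> M (fun v => c *: x v).
Proof. by move=> Mx; have := vN_lin c Mx vN_0; under eq_fun do rewrite addr0. Qed.
Lemma vN_add x y : M x -> M y -> M (fun v => x v + y v).
Proof. by move=> Mx My; have := vN_lin 1 Mx My; under eq_fun do rewrite scale1r. Qed.
Lemma vN_sub x y : M x -> M y -> M (fun v => x v - y v).
Proof.
move=> Mx My; have := vN_lin (-1) My Mx.
by under eq_fun do rewrite scaleN1r addrC.
Qed.
Lemma vN_sum (I : Type) (s : seq I) (F : I -> op H) :
  (forall i, M (F i)) -> M (fun v => \sum_(i <- s) F i v).
Proof.
move=> MF; elim: s => [|i s IH].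
  by under eq_fun do rewrite big_nil; exact: vN_0.
by under eq_fun do rewrite big_cons; exact: vN_add.
Qed.
Lemma vN_lim (T : nat -> op H) S : (forall n, M (T n)) ->
  (forall v, hcvg (T ^~ v) (S v)) -> bounded_op S -> M S.
Proof.
move=> MT hS bS; apply: vN_commutant => // z Mz; apply/funext => v /=.
apply: hcvg_unique (hS (z v)) _.
apply: hcvg_ext (hcvg_op Mz.1 (hS v)) => n.
by have := congr1 (@^~ v) (vN_commute Mz (MT n)) => /= ->.
Qed.
End VonNeumannClosure.

Section Positivity.
Context (R : realType) (H : hilbert R).
Implicit Types (p q T S : op H).

Definition selfadj p := forall x y, rdot (p x) y = rdot x (p y).
Definition psd p := selfadj p /\ forall v, 0 <= rdot (p v) v.

Lemma quadratic_discriminant (a b c : R) :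
  (forall s, 0 <= a + 2 * s * b + s ^+ 2 * c) -> 0 <= c -> b ^+ 2 <= a * c.
Proof.
move=> h c0; have [c_eq|cn] := eqVneq c 0.
  suff -> : b = 0 by rewrite c_eq mulr0 expr0n.
  apply/eqP/negPn/negP => b0; have := h (- (a + 1) / (2 * b)).
  rewrite c_eq mulr0 addr0 (_ : 2 * _ * b = - (a + 1)); last by field.
  lra.
have cp : 0 < c by rewrite lt_neqAle eq_sym cn.
have := h (- b / c).
rewrite (_ : _ + _ + _ = (a * c - b ^+ 2) / c); last by field.
by rewrite pmulr_lge0 ?invr_gt0// subr_ge0.
Qed.

(** The discriminant argument needs positivity only along the line x + s y. *)
Lemma psd_cauchy_schwarz p x y : linear p -> psd p ->
  rdot (p x) y ^+ 2 <= rdot (p x) x * rdot (p y) y.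
Proof.
move=> lp [sp pp]; apply: quadratic_discriminant; last exact: pp.
move=> s; have := pp (x + rc s *: y).
rewrite (linD lp) (linZ lp) !(rdotDl, rdotDr) !(rdotZl, rdotZr) (sp y x) (rdotC y).
by rewrite (_ : _ + _ + _ = rdot (p x) x + 2 * s * rdot (p x) y + s ^+ 2 * rdot (p y) y)//; ring.
Qed.

Lemma psd_norm_bound p r v : linear p -> psd p ->
  (forall v, rdot (p v) v <= r * hnorm v ^+ 2) ->
  hnorm (p v) ^+ 2 <= r * rdot (p v) v.
Proof.
move=> lp pp hr; have := psd_cauchy_schwarz v (p v) lp pp.
rewrite -sqr_hnorm => h.
have [->|n0] := eqVneq (hnorm (p v)) 0.
  rewrite expr0n /=; have := hr v; have := pp.2 v; have := sqr_ge0 (hnorm v).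
  have [r0|r0] := leP 0 r; first by move=> *; rewrite mulr_ge0.
  move=> h1 h2 h3; rewrite (_ : rdot (p v) v = 0) ?mulr0//; apply/eqP; rewrite eq_le h2 andbT.
  by rewrite (le_trans h3)// mulr_le0_ge0// ltW.
have np : 0 < hnorm (p v) ^+ 2 by rewrite exprn_gt0// lt_neqAle eq_sym n0 hnorm_ge0.
rewrite -(ler_pM2r np) -expr2 (le_trans h)//.
by rewrite (mulrC r) -mulrA ler_wpM2l// pp.2.
Qed.

Lemma psd_opbd p r : linear p -> psd p -> 0 <= r ->
  (forall v, rdot (p v) v <= r * hnorm v ^+ 2) -> opbd p r.
Proof.
move=> lp pp r0 hr v.
rewrite -(@ler_pXn2r _ 2) ?nnegrE ?mulr_ge0 ?hnorm_ge0//.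
rewrite exprMn (le_trans (psd_norm_bound v lp pp hr))//.
by rewrite expr2 -mulrA ler_wpM2l.
Qed.

Lemma rdot_opbd p r v : opbd p r -> rdot (p v) v <= r * hnorm v ^+ 2.
Proof.
move=> h; rewrite (le_trans (cauchy_schwarz_rdot _ _))// expr2 mulrA.
by rewrite ler_wpM2r ?hnorm_ge0.
Qed.

Lemma psd_id : psd (id : op H).
Proof. by split=> // v; exact: rdot_ge0. Qed.
Lemma psd_0 : psd (fun=> 0).
Proof. by split=> [x y|v]; rewrite ?rdot0l ?rdot0r. Qed.
Lemma psd_add p q : psd p -> psd q -> psd (fun v => p v + q v).
Proof.
move=> [sp hp] [sq hq]; split=> [x y|v]; first by rewrite rdotDl rdotDr sp sq.
by rewrite rdotDl addr_ge0.
Qed.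
Lemma psd_scale r p : 0 <= r -> psd p -> psd (fun v => rc r *: p v).
Proof.
move=> r0 [sp hp]; split=> [x y|v]; first by rewrite rdotZl rdotZr sp.
by rewrite rdotZl mulr_ge0.
Qed.
Lemma psd_adjM T : bounded_op T -> psd (adj T \o T).
Proof.
move=> bT; split=> [x y|v] /=; first by rewrite rdot_adjl// rdot_adj.
by rewrite rdot_adjl// rdot_ge0.
Qed.
Lemma selfadj_adj p : bounded_op p -> selfadj p -> adj p = p.
Proof. by move=> bp sp; exact: adj_unique. Qed.
Lemma psd_adj p : bounded_op p -> psd p -> adj p = p.
Proof. by move=> bp [sp _]; exact: selfadj_adj. Qed.

Lemma selfadj_lim (T : nat -> op H) S :
  (forall n, selfadj (T n)) -> (forall v, hcvg (T ^~ v) (S v)) -> selfadj S.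
Proof.
move=> sT hS x y.
have h1 := hcvg_rdot (y := y) (hS x); have h2 := hcvg_rdot (y := x) (hS y).
rewrite (rdotC x); apply: (cvg_unique _ h1); first exact: norm_hausdorff.
rewrite /=; under eq_fun do rewrite sT rdotC.
exact: h2.
Qed.

(** A bounded increasing sequence of positive operators converges strongly:
    the quadratic forms converge, and Cauchy-Schwarz for the positive
    differences turns this into norm convergence at each vector. *)
Lemma monotone_limit (p : nat -> op H) r : 
  (forall n, linear (p n)) -> (forall n, psd (p n)) ->
  (forall m n, (m <= n)%N -> psd (fun v => p n v - p m v)) ->
  (forall n v, rdot (p n v) v <= r * hnorm v ^+ 2) ->
  exists S : op H, [/\ bounded_op S, psd S, forall v, hcvg (p ^~ v) (S v) &
    forall n, psd (fun v => S v - p n v)].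
Proof.
move=> lp pp incr bd.
have r0 : forall v : H, 0 <= r * hnorm v ^+ 2.
  by move=> v; exact: le_trans ((pp 0%N).2 v) (bd 0%N v).
have lim v : exists l, hcvg (p ^~ v) l.
  apply: hcauchy_cvg => e e0.
  pose a n := rdot (p n v) v.
  have nda : {homo a : m n / (m <= n)%N >-> m <= n}.
    by move=> m n /incr[_ /(_ v)]; rewrite rdotBl subr_ge0.
  have ca : cvgn a.
    apply: nondecreasing_is_cvgn => //.
    by exists (r * hnorm v ^+ 2) => _ [n _ <-]; exact: bd.
  have le_lim n : a n <= limn a by apply: nondecreasing_cvgn_le.
  have r1 : 0 < r ^+ 2 + 1 by rewrite ltr_wpDl ?sqr_ge0.
  have rr : r <= r ^+ 2 + 1 by have := sqr_ge0 (r - 1); rewrite sqrrB1; have := sqr_ge0 r; lra.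
  have e1 : 0 < e ^+ 2 / (r ^+ 2 + 1) by rewrite divr_gt0 ?exprn_gt0.
  have /cvgrPdist_lt/(_ _ e1)[N _ hN] := ca.
  have key m n : (N <= m)%N -> (m <= n)%N -> hnorm (p m v - p n v) < e.
    move=> Nm mn; rewrite -(@ltr_pXn2r _ 2) ?nnegrE ?hnorm_ge0 ?(ltW e0)//.
    rewrite hnorm_distC.
    have lpq : linear (fun v => p n v - p m v).
      by move=> c x y; rewrite !lp scalerBr opprD addrACA.
    have h := psd_norm_bound (r := r) v lpq (incr _ _ mn).
    have {}h : hnorm (p n v - p m v) ^+ 2 <= r * (a n - a m).
      rewrite /a -rdotBl; apply: h => w; rewrite rdotBl (le_trans _ (bd n w))//.
      by rewrite lerBlDr lerDl (pp m).2.
    have := hN _ Nm; rewrite /= => /(le_lt_trans (ler_norm _)).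
    rewrite ltr_pdivlMr// mulrC => hm.
    apply: le_lt_trans h _; apply: le_lt_trans hm.
    have d0 : 0 <= a n - a m by rewrite subr_ge0; exact: nda.
    apply: (@le_trans _ _ ((r ^+ 2 + 1) * (a n - a m))).
      by rewrite ler_wpM2r.
    by rewrite ler_wpM2l ?(ltW r1)// lerD2r.
  exists N => m n Nm Nn; have [mn|/ltnW nm] := leqP m n; first exact: key.
  by rewrite hnorm_distC; exact: key.
have [S hS] := choice lim.
have lS : linear S := linear_lim lp hS.
have Sle n v : rdot (p n v) v <= rdot (S v) v.
  have h : (fun k => rdot (p (k + n)%N v) v) @ \oo --> rdot (S v) v.
    by rewrite (cvg_shiftn n (fun k => rdot (p k v) v)); exact: hcvg_rdot.
  apply: lim_ge_cst h => k.
  by have [_ /(_ v)] := incr n (k + n)%N (leq_addl _ _); rewrite rdotBl subr_ge0.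
have sS := selfadj_lim (fun n => (pp n).1) hS.
have pS : psd S by split=> // v; exact: le_trans ((pp 0%N).2 v) (Sle 0%N v).
exists S; split=> //.
  apply: (@bounded_op_bd _ _ _ _ `|r|) => //.
  apply: psd_opbd => // v; apply: lim_le_cst (hcvg_rdot (hS v)) => n.
  by rewrite (le_trans (bd n v))// ler_wpM2r ?sqr_ge0// ler_norm.
move=> n; split=> [x y|v]; last by rewrite rdotBl subr_ge0.
by rewrite rdotBl rdotBr sS (pp n).1.
Qed.

End Positivity.

Section Factorisation.
Context (R : realType) (H : hilbert R).

Lemma geometric_cauchy (u : nat -> H) (C s : R) : 0 <= s -> s < 1 ->
  (forall n, hnorm (u n.+1 - u n) <= C * s ^+ n) -> hcauchy u.
Proof.
move=> s0 s1 hu; have d0 : 0 < 1 - s by rewrite subr_gt0.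
have C0 : 0 <= C by have := le_trans (hnorm_ge0 _) (hu 0%N); rewrite expr0 mulr1.
have far n k : hnorm (u (n + k)%N - u n) <= C * s ^+ n * ((1 - s ^+ k) / (1 - s)).
  elim: k => [|k IH]; first by rewrite addn0 subrr hnorm0 expr0 subrr mul0r mulr0.
  rewrite addnS (le_trans (hnorm_tri (u (n + k)%N) _ _))//.
  rewrite (le_trans (lerD (hu _) IH))// exprD exprS le_eqVlt; apply/orP; left.
  by apply/eqP; field; rewrite gt_eqF.
have bd n k : hnorm (u (n + k)%N - u n) <= C / (1 - s) * s ^+ n.
  rewrite (le_trans (far n k))// mulrAC -!mulrA ler_wpM2l//.
  rewrite ler_piMl ?mulr_ge0 ?invr_ge0 ?exprn_ge0 ?(ltW d0)//.
  by rewrite gerBl exprn_ge0.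
have lim : (fun n => C / (1 - s) * s ^+ n) @ \oo --> (0 : R).
  rewrite -(mulr0 (C / (1 - s))); apply: cvgM; first exact: cvg_cst.
  by apply: cvg_expr; rewrite ger0_norm.
move=> e e0; have /cvgrPdist_lt/(_ _ e0)[N _ hN] := lim.
have key m n : (N <= m)%N -> (m <= n)%N -> hnorm (u n - u m) < e.
  move=> Nm mn; rewrite -(subnKC mn) (le_lt_trans (bd _ _))//.
  by have := hN _ Nm; rewrite /= sub0r normrN => /(le_lt_trans (ler_norm _)).
exists N => m n Nm Nn; have [mn|/ltnW nm] := leqP m n; last exact: key.
by rewrite hnorm_distC; exact: key.
Qed.

(** A strictly contractive positive b is of the form 2 y - y^2: iterate
    y := (b + y^2)/2 from 0, which contracts because everything commutes with b.
    Then 1 - b = (1 - y)^2. *)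
Lemma one_minus_square (M : set (op H)) b (s : R) : von_neumann M -> M b -> psd b ->
  0 <= s -> s < 1 -> opbd b s ->
  exists y, [/\ M y, selfadj y & forall v, y v = rc 2^-1 *: (b v + y (y v))].
Proof.
move=> vM Mb pb s0 s1 bs; have lb := vN_linear vM Mb.
pose F (y : op H) : op H := fun v => rc 2^-1 *: (b v + y (y v)).
pose y n := iter n F (fun=> 0).
have MF z : M z -> M (F z).
  by move=> Mz; apply: vN_scale => //; apply: vN_add => //; exact: (vN_comp vM Mz Mz).
have My n : M (y n) by elim: n => [|n IH]; [exact: vN_0 | exact: MF].
have ly n : linear (y n) := vN_linear vM (My n).
have com n (T : op H) : linear T -> (forall v, T (b v) = b (T v)) ->
    forall v, T (y n v) = y n (T v).
  move=> lT hT; elim: n => [|n IH] v /=; first exact: lin0.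
  by rewrite /F (linZ lT) (linD lT) hT !IH.
have comb n v : y n (b v) = b (y n v).
  by rewrite [RHS](com n b lb).
have comm m n v : y m (y n v) = y n (y m v).
  by apply: com => // w; exact: comb.
have half : `|2^-1 : R| = 2^-1 by rewrite ger0_norm ?invr_ge0.
have bdy n : opbd (y n) s.
  elim: n => [|n IH] v /=; first by rewrite hnorm0 mulr_ge0 ?hnorm_ge0.
  rewrite /F hnormZr half ler_pdivrMl// (le_trans (hnormD _ _))//.
  rewrite (@le_trans _ _ (s * hnorm v + s * (s * hnorm v)))//.
    by rewrite lerD// (le_trans (IH _))// ler_wpM2l.
  have h : s * (s * hnorm v) <= 1 * (s * hnorm v).
    by rewrite ler_wpM2r ?mulr_ge0 ?hnorm_ge0// ltW.
  by move: h; rewrite mul1r; lra.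
have step n v : hnorm (y n.+1 v - y n v) <= hnorm v * s ^+ n.
  elim: n v => [|n IH] v.
    rewrite /= /F addr0 subr0 hnormZr half expr0 mulr1 ler_pdivrMl//.
    rewrite (le_trans (bs v))// ler_wpM2r ?hnorm_ge0//; move: s1; lra.
  have -> : y n.+2 v - y n.+1 v =
     rc 2^-1 *: (y n.+1 (y n.+1 v - y n v) + y n (y n.+1 v - y n v)).
    have yS k w : y k.+1 w = rc 2^-1 *: (b w + y k (y k w)) by [].
    rewrite yS [X in _ - X = _]yS -scalerBr; congr (_ *: _).
    rewrite (linB (ly _)) (linB (ly n)) (comm n n.+1) addrA subrK.
    by rewrite opprD addrACA subrr add0r.
  rewrite hnormZr half ler_pdivrMl// (le_trans (hnormD _ _))//.
  have h := IH v; set d := y n.+1 v - y n v in h *.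
  have h1 := bdy n.+1 d; have h2 := bdy n d.
  have h3 : s * hnorm d <= s * (hnorm v * s ^+ n) by rewrite ler_wpM2l.
  rewrite exprS (mulrCA _ s); move: h1 h2 h3.
  by move: (s * (hnorm v * s ^+ n)) (s * hnorm d) => *; lra.
have lim v : exists l, hcvg (y ^~ v) l.
  by apply: hcauchy_cvg; apply: geometric_cauchy s0 s1 (step ^~ v).
have [Y hY] := choice lim.
have lY := linear_lim ly hY.
have bY : opbd Y s := opbd_lim bdy hY.
have MY : M Y by apply: (vN_lim vM My hY); exact: bounded_op_bd bY.
have sy n : selfadj (y n).
  elim: n => [|n IH] v w /=; first by rewrite rdot0l rdot0r.
  by rewrite /F rdotZl rdotZr rdotDl rdotDr pb.1 !IH.
exists Y; split=> //; first exact: selfadj_lim hY.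
move=> v; apply: (@hcvg_unique _ _ (fun n => y n.+1 v)).
  have := hY v; rewrite /hcvg => h.
  by rewrite -(cvg_shiftS (fun n => hnorm (y n v - Y v))) in h.
apply: (@hcvgZ _ _ _ (fun n => b v + y n (y n v))).
apply: hcvgD; first exact: hcvg_cst.
apply: (@hcvg_le _ _ _ _ (fun n => s * hnorm (y n v - Y v) + hnorm (y n (Y v) - Y (Y v)))).
  move=> n; rewrite (le_trans (hnorm_tri (y n (Y v)) _ _))// lerD2r -(linB (ly n)).
  exact: bdy.
rewrite -(addr0 0) -{1}(mulr0 s); apply: cvgD; last exact: hY.
by apply: cvgM; [exact: cvg_cst | exact: hY].
Qed.

(** After scaling, p + e is 1 - b with b positive and strictly contractive, and
    such an operator is a square in M.  Square roots of p itself are avoided: the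
    summand e disappears in a limit wherever the lemma is applied. *)
Lemma psd_factor (M : set (op H)) p (e : R) : von_neumann M -> M p -> psd p -> 0 < e ->
  exists2 y, M y & forall v, p v + rc e *: v = adj y (y v).
Proof.
move=> vM Mp pp e0; have [c c0 hc] := bounded_bd (vN_bounded vM Mp).
have ce : 0 < c + e by rewrite addr_gt0.
(* b = 1 - (p + e) / (c + e), with norm at most c / (c + e). *)
pose b : op H := fun v => v - rc (c + e)^-1 *: (p v + rc e *: v).
have Mb : M b.
  apply: (vN_sub vM (vN_id vM)); apply: vN_scale => //; apply: vN_add => //.
  exact: (vN_scale vM (rc e) (vN_id vM)).
have lb := vN_linear vM Mb; pose s := c / (c + e).
have bform v : rdot (b v) v = hnorm v ^+ 2 - (c + e)^-1 * (rdot (p v) v + e * hnorm v ^+ 2).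
  by rewrite rdotBl rdotZl rdotDl rdotZl sqr_hnorm.
have pb : psd b.
  split=> [x y|v].
    by rewrite rdotBl rdotBr rdotZl rdotZr rdotDl rdotDr pp.1 rdotZl rdotZr.
  rewrite bform subr_ge0 ler_pdivrMl// mulrDl lerD2r.
  exact: rdot_opbd.
have s1 : s < 1 by rewrite ltr_pdivrMr// mul1r ltrDl.
have s0 : 0 <= s by rewrite divr_ge0// ltW.
have bs : opbd b s.
  apply: psd_opbd => // v; rewrite bform -subr_ge0.
  rewrite (_ : _ - _ = (c + e)^-1 * rdot (p v) v); last by rewrite /s; field; rewrite gt_eqF.
  by rewrite mulr_ge0 ?invr_ge0 ?(ltW ce)// pp.2.
have [y [My sy hy]] := one_minus_square vM Mb pb s0 s1 bs.
have ly := vN_linear vM My.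
pose z : op H := fun v => rc (Num.sqrt (c + e)) *: (v - y v).
have Mz : M z by apply: vN_scale => //; apply: (vN_sub vM (vN_id vM)).
exists z => // v; rewrite (selfadj_adj (vN_bounded vM Mz)); last first.
  by move=> x w; rewrite rdotZl rdotZr rdotBl rdotBr sy.
rewrite /z (linZ ly) -scalerBr scalerA -rcM -expr2 sqr_sqrtr ?(ltW ce)//.
have h2 : y v + y v = b v + y (y v).
  rewrite [in LHS](hy v) -scalerDl -rcD (_ : 2^-1 + 2^-1 = 1 :> R) ?rc1 ?scale1r//.
  by rewrite -div1r -splitr.
have {}h2 : y (y v) = y v + y v - b v by rewrite h2 addrAC subrr add0r.
have h3 : y v - (y v + y v - b v) = b v - y v.
  by rewrite opprB addrCA opprD addNKr.
rewrite (linB ly) h2 h3 opprB addrA subrK.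
rewrite /b opprB addrC subrK scalerA -rcM mulfV ?gt_eqF// rc1 scale1r//.
Qed.

End Factorisation.

(** * Homomorphisms, operator norms and traces *)

Section LinearOn.
Context (R : realType) (H : hilbert R) (M : set (op H)) (vM : von_neumann M).
Context (V : lmodType R[i]) (f : op H -> V) (lf : linear_on M f).

Lemma linear_on0 : f (fun=> 0) = 0.
Proof.
have := lf (-1) (vN_0 vM) (vN_0 vM).
under eq_fun do rewrite scaler0 addr0.
by rewrite scaleN1r addNr.
Qed.
Lemma linear_onZ c x : M x -> f (fun v => c *: x v) = c *: f x.
Proof.
move=> Mx; have := lf c Mx (vN_0 vM); rewrite linear_on0 addr0.
by under eq_fun do rewrite addr0.
Qed.
Lemma linear_onD x y : M x -> M y -> f (fun v => x v + y v) = f x + f y.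
Proof.
move=> Mx My; have := lf 1 Mx My; rewrite scale1r.
by under eq_fun do rewrite scale1r.
Qed.
Lemma linear_onB x y : M x -> M y -> f (fun v => x v - y v) = f x - f y.
Proof.
move=> Mx My; have := lf (-1) My Mx; rewrite scaleN1r addrC => <-.
by congr f; apply/funext => v; rewrite scaleN1r addrC.
Qed.
Lemma linear_on_sum (I : Type) (s : seq I) (F : I -> op H) :
  (forall i, M (F i)) -> f (fun v => \sum_(i <- s) F i v) = \sum_(i <- s) f (F i).
Proof.
move=> MF; elim: s => [|i s IH].
  by under eq_fun do rewrite big_nil; rewrite big_nil linear_on0.
under eq_fun do rewrite big_cons.
by rewrite linear_onD ?IH ?big_cons//; exact: vN_sum.
Qed.
End LinearOn.

Section StarMaps.
Context (R : realType) (H K : hilbert R) (M : set (op H)) (vM : von_neumann M).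

(** Homomorphisms and antihomomorphisms are positive for the same reason,
    which is why they are treated together. *)
Definition star_map (pi : op H -> op K) := star_hom M pi \/ star_antihom M pi.

Context (pi : op H -> op K) (hpi : star_map pi).

Lemma star_map_linear : star_linear M pi.
Proof. by case: hpi => [[]|[]]. Qed.
Lemma star_map_bounded x : M x -> bounded_op (pi x).
Proof. by case: star_map_linear => h _ _ _; exact: h. Qed.
Lemma star_map_lin x : M x -> linear (pi x).
Proof. by move/star_map_bounded/bounded_linear. Qed.
Lemma star_map_adj x : M x -> pi (adj x) = adj (pi x).
Proof. by case: star_map_linear => _ _ _; apply. Qed.
Lemma star_map_id : pi id = id. Proof. by case: star_map_linear. Qed.
Lemma star_mapD x y v : M x -> M y -> pi (fun w => x w + y w) v = pi x v + pi y v.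
Proof. by case: star_map_linear => _ h _ _ *; exact: (linear_onD (h v)). Qed.
Lemma star_mapB x y v : M x -> M y -> pi (fun w => x w - y w) v = pi x v - pi y v.
Proof. by case: star_map_linear => _ h _ _ *; exact: (linear_onB (h v)). Qed.
Lemma star_mapZ c x v : M x -> pi (fun w => c *: x w) v = c *: pi x v.
Proof. by case: star_map_linear => _ h _ _ *; exact: (linear_onZ vM (h v)). Qed.
Lemma star_map_sum (I : Type) (s : seq I) (F : I -> op H) v :
  (forall i, M (F i)) -> pi (fun w => \sum_(i <- s) F i w) v = \sum_(i <- s) pi (F i) v.
Proof. by case: star_map_linear => _ h _ _ *; exact: (linear_on_sum vM (h v)). Qed.
Lemma star_map_scalar c v : pi (fun w => c *: w) v = c *: v.
Proof. by rewrite (star_mapZ c v (vN_id vM)) star_map_id. Qed.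

Lemma star_map_square_ge0 y v : M y -> 0 <= rdot (pi (adj y \o y) v) v.
Proof.
move=> My; have Ma := vN_adj vM My; have by_ := star_map_bounded My.
case: hpi => [[_ hm]|[_ hm]].
  by rewrite hm//= star_map_adj// rdot_adjl// rdot_ge0.
by rewrite hm//= star_map_adj// rdot_adj ?rdot_ge0//; exact: bounded_adj.
Qed.

(** The image of y^* y is visibly positive, and psd_factor reaches every positive
    p up to an arbitrarily small scalar. *)
Lemma star_map_psd p : M p -> psd p -> psd (pi p).
Proof.
move=> Mp pp; split=> [x y|v].
  rewrite rdot_adj; last exact: star_map_bounded.
  by rewrite -star_map_adj// (psd_adj (vN_bounded vM Mp) pp).
apply/ler_addgt0Pr => e e0.
have e1 : 0 < e / (hnorm v ^+ 2 + 1) by rewrite divr_gt0// ltr_wpDl ?sqr_ge0.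
have [y My hy] := psd_factor vM Mp pp e1.
have := star_map_square_ge0 v My.
rewrite (_ : adj y \o y = fun w => p w + rc (e / (hnorm v ^+ 2 + 1)) *: w); last first.
  by apply/funext => w; rewrite hy.
rewrite star_mapD//; last exact: (vN_scale vM _ (vN_id vM)).
rewrite star_map_scalar rdotDl rdotZl -sqr_hnorm => /le_trans; apply.
rewrite lerD2l mulrAC ler_pdivrMr ?ltr_wpDl ?sqr_ge0//.
by rewrite ler_wpM2l ?(ltW e0)// lerDl.
Qed.

(** A positive map is contractive: compare x^* x, or x x^* for an
    antihomomorphism, with the scalar c^2. *)
Lemma star_map_opbd x c : M x -> 0 <= c -> opbd x c -> opbd (pi x) c.
Proof.
move=> Mx c0 hc v; have bx := vN_bounded vM Mx.
have Ma := vN_adj vM Mx; have ba := bounded_adj bx.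
have hca := opbd_adj bx c0 hc.
(* z is x^* x or x x^*, whichever pi maps to pi(x)^* pi(x). *)
have [z [Mz sz hz key]] : exists z : op H, [/\ M z, selfadj z,
    forall w, rdot (z w) w <= c ^+ 2 * hnorm w ^+ 2 &
    rdot (pi z v) v = hnorm (pi x v) ^+ 2].
  case: hpi => [[_ hm]|[_ hm]].
    exists (adj x \o x); split; first exact: vN_comp.
    - exact: (psd_adjM bx).1.
    - move=> w; rewrite /= rdot_adjl// -sqr_hnorm -exprMn.
      by rewrite ler_pXn2r ?nnegrE ?mulr_ge0 ?hnorm_ge0.
    - rewrite hm//= star_map_adj// rdot_adjl ?sqr_hnorm//; exact: star_map_bounded.
  exists (x \o adj x); split; first exact: vN_comp.
  - by have := (psd_adjM ba).1; rewrite adjK.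
  - move=> w; rewrite /= rdot_adj// -sqr_hnorm -exprMn.
    by rewrite ler_pXn2r ?nnegrE ?mulr_ge0 ?hnorm_ge0.
  - rewrite hm//= star_map_adj// rdot_adjl ?sqr_hnorm//; exact: star_map_bounded.
have Mp : M (fun w => rc (c ^+ 2) *: w - z w).
  by apply: vN_sub => //; exact: (vN_scale vM _ (vN_id vM)).
have pp : psd (fun w => rc (c ^+ 2) *: w - z w).
  split=> [a b|w]; first by rewrite rdotBl rdotBr rdotZl rdotZr sz.
  by rewrite rdotBl rdotZl -sqr_hnorm subr_ge0.
have := (star_map_psd Mp pp).2 v.
rewrite star_mapB//; last exact: (vN_scale vM _ (vN_id vM)).
rewrite star_map_scalar rdotBl rdotZl key -sqr_hnorm subr_ge0 -exprMn.
by rewrite ler_pXn2r ?nnegrE ?mulr_ge0 ?hnorm_ge0.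
Qed.

End StarMaps.

Lemma opnorm_le (R : realType) (H : hilbert R) (x : op H) (c : R) : linear x -> 0 <= c ->
  (opnorm x <= c%:E)%E <-> opbd x c.
Proof.
move=> lx c0; split=> [h v|h].
  have [v0|v0] := eqVneq (hnorm v) 0.
    by rewrite (hnorm_eq0 v0) (lin0 lx) hnorm0 mulr0.
  have vp : 0 < hnorm v by rewrite lt_neqAle eq_sym v0 hnorm_ge0.
  have : ((hnorm (x (rc (hnorm v)^-1 *: v)))%:E <= c%:E)%E.
    apply: le_trans h; apply: ereal_sup_ubound; exists (rc (hnorm v)^-1 *: v) => //=.
    by rewrite hnormZr ger0_norm ?invr_ge0 ?hnorm_ge0// mulVf.
  rewrite lee_fin (linZ lx) hnormZr ger0_norm ?invr_ge0 ?hnorm_ge0//.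
  by rewrite ler_pdivrMl// mulrC.
apply: ge_ereal_sup => _ [v /= v1 <-]; rewrite lee_fin (le_trans (h v))//.
by rewrite ler_piMr.
Qed.

Section TraceForm.
Context (R : realType) (H : hilbert R) (M : set (op H)) (vM : von_neumann M).
Context (tau : op H -> R[i]) (ft : faithful_normal_trace M tau).
Let lt := ft.1.

Lemma trD x y : M x -> M y -> tau (fun v => x v + y v) = tau x + tau y.
Proof. by move=> *; exact: (linear_onD lt). Qed.
Lemma trB x y : M x -> M y -> tau (fun v => x v - y v) = tau x - tau y.
Proof. by move=> *; exact: (linear_onB lt). Qed.
Lemma trZ c x : M x -> tau (fun v => c *: x v) = c * tau x.
Proof. by move=> *; exact: (linear_onZ vM lt). Qed.
Lemma trC x y : M x -> M y -> tau (x \o y) = tau (y \o x).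
Proof. by case: ft => _ [_ _ _ h _]; exact: h. Qed.
Lemma tr1 : tau id = 1. Proof. by case: ft => _ []. Qed.

Lemma tr_psd p : M p -> psd p -> 0 <= complex.Re (tau p).
Proof.
move=> Mp pp; apply/ler_addgt0Pr => e e0.
have [y My hy] := psd_factor vM Mp pp e0.
have : 0 <= tau (adj y \o y) by case: ft => _ [h _ _ _ _]; exact: h.
rewrite lecE => /andP[_].
rewrite (_ : adj y \o y = fun w => p w + rc e *: w); last first.
  by apply/funext => w; rewrite hy.
have Mi := vN_id vM; rewrite trD//; last exact: (vN_scale vM _ Mi).
by rewrite (trZ _ Mi) tr1 mulr1 cReD.
Qed.

Lemma tr_le p q : M p -> M q -> psd (fun v => q v - p v) ->
  complex.Re (tau p) <= complex.Re (tau q).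
Proof.
move=> Mp Mq pq; rewrite -subr_ge0 -cReB -trB//.
by apply: tr_psd => //; exact: vN_sub.
Qed.

End TraceForm.

(** * The group von Neumann algebra *)

Section Density.
Context (R : realType) (H : hilbert R).

Lemma dense_approx (S : set H) z (e : R) : dense S -> 0 < e ->
  exists2 w, S w & hnorm (z - w) < e.
Proof.
move=> dS e0; have e1 : 0 < rc e by rewrite ltcE /= eqxx e0.
have [||w [hw Sw]] := dS (ball z (rc e)).
- by exists z; exact: ballxx.
- exact: ball_open.
exists w => //; move: hw; rewrite -ball_normE /= norm_hnorm ltcE /=.
by move=> /andP[].
Qed.

Lemma dense_rdot_le (S : set H) x (r : R) : dense S -> 0 <= r ->
  (forall w, S w -> rdot x w <= r * hnorm w) -> hnorm x <= r.
Proof.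
move=> dS r0 h; apply: hnorm_le_rdot => // y; apply/ler_addgt0Pr => e e0.
have d0 : 0 < hnorm x + r + 1 by rewrite ltr_wpDl// addr_ge0 ?hnorm_ge0.
have [w Sw hw] := dense_approx y dS (divr_gt0 e0 d0).
rewrite -(subrK w y) rdotDr subrK.
have h1 := cauchy_schwarz_rdot x (y - w).
have h2 := h w Sw.
have h3 : hnorm w <= hnorm y + hnorm (y - w).
  by have := hnorm_le_dist w y; rewrite hnorm_distC.
have h4 : (hnorm x + r) * hnorm (y - w) <= e.
  rewrite (@le_trans _ _ ((hnorm x + r + 1) * (e / (hnorm x + r + 1))))//.
    by rewrite ler_pM ?hnorm_ge0 ?addr_ge0 ?hnorm_ge0 ?(ltW hw)// lerDl.
  by rewrite mulrC divfK// gt_eqF.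
have h5 : r * hnorm w <= r * hnorm y + r * hnorm (y - w).
  by rewrite -mulrDr ler_wpM2l.
move: h1 h2 h4 h5; rewrite mulrDl.
by move: (hnorm x * _) (r * hnorm (y - w)) (r * hnorm w) => *; lra.
Qed.

Lemma dense_rdot_eq0 (S : set H) x : dense S -> (forall w, S w -> rdot x w = 0) -> x = 0.
Proof.
move=> dS h; apply: hnorm_eq0; apply/eqP; rewrite eq_le hnorm_ge0 andbT.
by apply: (dense_rdot_le dS) => // w /h ->; rewrite mul0r.
Qed.
End Density.

Section Combinations.
Context (R : realType) (G : choiceType) (H : hilbert R).

Definition comb (phi : G -> H) (s : seq (R[i] * G)) : H :=
  \sum_(p <- s) p.1 *: phi p.2.

Lemma comb_cat phi s t : comb phi (s ++ t) = comb phi s + comb phi t.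
Proof. by rewrite /comb big_cat. Qed.
Lemma comb_scale phi c s :
  comb phi [seq (c * p.1, p.2) | p <- s] = c *: comb phi s.
Proof.
by rewrite /comb big_map scaler_sumr; apply: eq_bigr => p _; rewrite scalerA.
Qed.
Lemma dotp_comb phi psi s t : dotp (comb phi s) (comb psi t) =
  \sum_(p <- s) \sum_(q <- t) p.1 * Num.conj q.1 * dotp (phi p.2) (psi q.2).
Proof.
rewrite dotp_suml; apply: eq_bigr => p _; rewrite dotp_sumr; apply: eq_bigr => q _.
by rewrite dotpZl dotpZr mulrA.
Qed.
End Combinations.

Lemma lin_comb (R : realType) (G : choiceType) (H K : hilbert R) (T : H -> K)
  (phi : G -> H) s : linear T -> T (comb phi s) = comb (T \o phi) s.
Proof.
by move=> lT; rewrite (lin_sum lT); apply: eq_bigr => p _; rewrite (linZ lT).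
Qed.

Section OrthonormalBasis.
Context (R : realType) (G : choiceType) (K : hilbert R) (delta : G -> K).
Hypothesis orth : forall g h, dotp (delta g) (delta h) = (g == h)%:R.
Hypothesis spans : dense [set z | exists s, z = comb delta s].

Lemma basis_inj x y : (forall g, dotp x (delta g) = dotp y (delta g)) -> x = y.
Proof.
move=> h; apply/eqP; rewrite -subr_eq0; apply/eqP.
apply: (dense_rdot_eq0 spans) => _ [s ->].
rewrite /rdot dotp_sumr big1// => p _.
by rewrite dotpZr dotpBl h subrr mulr0.
Qed.

(** T z is pinned down by approximating z and T z simultaneously, by combinations
    of the basis and the same combinations of the phi g. *)
Lemma basis_ext (L : hilbert R) (phi : G -> L) (C : R) : 0 <= C ->
  (forall s, hnorm (comb phi s) <= C * hnorm (comb delta s)) ->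
  exists T : K -> L, [/\ bounded_op T, opbd T C & forall g, T (delta g) = phi g].
Proof.
move=> C0 hphi.
have comb_dist (K' : hilbert R) (f : G -> K') s t : comb f s - comb f t =
    comb f (s ++ [seq (-1 * p.1, p.2) | p <- t]).
  by rewrite comb_cat comb_scale scaleN1r.
have ex z : exists w, forall e : R, 0 < e -> exists s,
    hnorm (z - comb delta s) < e /\ hnorm (w - comb phi s) < e.
  have ap n : exists s, hnorm (z - comb delta s) < n.+1%:R^-1.
    have e0 : 0 < n.+1%:R^-1 :> R by rewrite invr_gt0.
    by have [_ [s ->] hs] := dense_approx z spans e0; exists s.
  have [s hs] := choice ap.
  have small (e : R) : 0 < e -> exists N, forall n, (N <= n)%N -> n.+1%:R^-1 < e.
    by move=> e0; have [N _ hN] := near_infty_natSinv_lt (PosNum e0); exists N => n /hN.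
  have : hcauchy (fun n => comb phi (s n)).
    move=> e e0; have e1 : 0 < e / (2 * (C + 1)).
      by rewrite divr_gt0// mulr_gt0// ltr_wpDl.
    have [N hN] := small _ e1; exists N => m n /hN hm /hN hn.
    rewrite comb_dist (le_lt_trans (hphi _))// -comb_dist.
    have h1 : hnorm (comb delta (s m) - comb delta (s n)) < e / (C + 1).
      rewrite (le_lt_trans (hnorm_tri z _ _))// (hnorm_distC _ z).
      rewrite (_ : e / (C + 1) = e / (2 * (C + 1)) + e / (2 * (C + 1))).
        by rewrite ltrD// (lt_trans (hs _)).
      by field; rewrite gt_eqF// ltr_wpDl.
    rewrite (@le_lt_trans _ _ ((C + 1) * hnorm (comb delta (s m) - comb delta (s n))))//.
      by rewrite ler_wpM2r ?hnorm_ge0// lerDl.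
    by rewrite mulrC -ltr_pdivlMr// ltr_wpDl.
  move=> /hcauchy_cvg[w /hcvgP hw]; exists w => e e0.
  have [N hN] := small _ e0; have [N' hN'] := hw _ e0.
  exists (s (maxn N N')); split; first by rewrite (lt_trans (hs _))// hN// leq_maxl.
  by rewrite hnorm_distC hN'// leq_maxr.
have [T hT] := choice ex.
have key z s : hnorm (T z - comb phi s) <= C * hnorm (z - comb delta s).
  apply/ler_addgt0Pr => e e0.
  have e1 : 0 < e / (1 + C) by rewrite divr_gt0// ltr_wpDr.
  have [t [h1 h2]] := hT z _ e1.
  rewrite (le_trans (hnorm_tri (comb phi t) _ _))//.
  have h3 : hnorm (comb phi t - comb phi s) <=
      C * hnorm (z - comb delta t) + C * hnorm (z - comb delta s).
    rewrite comb_dist (le_trans (hphi _))// -comb_dist -mulrDr ler_wpM2l//.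
    by rewrite (le_trans (hnorm_tri z _ _))// hnorm_distC.
  have h4 : e / (1 + C) + C * (e / (1 + C)) = e.
    by field; rewrite gt_eqF// ltr_wpDr.
  have h5 : C * hnorm (z - comb delta t) <= C * (e / (1 + C)).
    by rewrite ler_wpM2l// ltW.
  move: h2 h3 h4 h5.
  by move: (C * hnorm (z - comb delta t)) (C * hnorm _) (hnorm _) (hnorm _) (e / _) (C * _) => *; lra.
have Tbd : opbd T C by move=> v; have := key v [::]; rewrite /comb !big_nil !subr0.
exists T; split=> //; last first.
  move=> g; apply/eqP; rewrite -subr_eq0; apply/eqP; apply: hnorm_eq0.
  apply/eqP; rewrite eq_le hnorm_ge0 andbT.
  have := key (delta g) [:: (1, g)].
  by rewrite /comb !big_seq1 /= !scale1r subrr hnorm0 mulr0.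
apply: (bounded_op_bd _ Tbd) => a x y.
apply/eqP; rewrite -subr_eq0; apply/eqP; apply: hnorm_eq0.
apply/eqP; rewrite eq_le hnorm_ge0 andbT; apply/ler_addgt0Pr => e e0; rewrite add0r.
pose D := 2 * C * (modulus a + 1) + (modulus a + 1).
have a1 : 0 < modulus a + 1 by rewrite ltr_wpDl ?modulus_ge0.
have D0 : 0 < D by rewrite ltr_wpDl// !mulr_ge0 ?(ltW a1).
have [s [h1 h2]] := hT x _ (divr_gt0 e0 D0).
have [t [h3 h4]] := hT y _ (divr_gt0 e0 D0).
pose u := [seq (a * p.1, p.2) | p <- s] ++ t.
have k1 : hnorm (T (a *: x + y) - comb phi u) <= C * (modulus a + 1) * (e / D).
  rewrite (le_trans (key _ _))// -mulrA ler_wpM2l// comb_cat comb_scale.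
  rewrite opprD addrACA -scalerBr (le_trans (hnormD _ _))// hnormZ mulrDl mul1r.
  by rewrite lerD ?(ltW h3)// ler_wpM2l ?modulus_ge0// ltW.
have k2 : hnorm (a *: T x + T y - comb phi u) <= (modulus a + 1) * (e / D).
  rewrite comb_cat comb_scale.
  rewrite opprD addrACA -scalerBr (le_trans (hnormD _ _))// hnormZ mulrDl mul1r.
  by rewrite lerD ?(ltW h4)// ler_wpM2l ?modulus_ge0// ltW.
rewrite (le_trans (hnorm_tri (comb phi u) _ _))// (hnorm_distC (comb phi u)).
rewrite (le_trans (lerD k1 k2))// -mulrDl mulrCA ler_piMr ?(ltW e0)//.
rewrite ler_pdivrMr// mul1r /D lerD2r ler_wpM2r ?(ltW a1)//.
by rewrite ler_peMl// ler1n.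
Qed.

Lemma basis_eq (L : hilbert R) (S T : K -> L) : bounded_op S -> bounded_op T ->
  (forall g, S (delta g) = T (delta g)) -> S = T.
Proof.
move=> bS bT h; apply/funext => v; apply/eqP; rewrite -subr_eq0; apply/eqP.
have bD := bounded_lin (-1) bT bS; have [c c0 hc] := bounded_bd bD.
have eD w : -1 *: T w + S w = S w - T w by rewrite scaleN1r addrC.
apply: hnorm_eq0; apply/eqP; rewrite eq_le hnorm_ge0 andbT.
apply/ler_addgt0Pr => e e0; rewrite add0r.
have [_ [s ->] hs] := dense_approx v spans (divr_gt0 e0 c0).
rewrite -eD -(subrK (comb delta s) v) (linD (bounded_linear bD)) [X in _ + X]eD.
rewrite (lin_comb delta s (bounded_linear bS)) (lin_comb delta s (bounded_linear bT)).
rewrite (_ : S \o delta = T \o delta); last by apply/funext => g /=.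
by rewrite subrr addr0 (le_trans (hc _))// -ler_pdivlMl// mulrC ltW.
Qed.

Lemma hnorm_comb_reindex (L : hilbert R) (phi : G -> L) s :
  (forall g h, dotp (phi g) (phi h) = (g == h)%:R) ->
  hnorm (comb phi s) = hnorm (comb delta s).
Proof.
move=> h; apply/eqP; rewrite -(@eqrXn2 _ 2) ?hnorm_ge0//; apply/eqP.
rewrite !sqr_hnorm /rdot !dotp_comb; congr (complex.Re _).
by apply: eq_bigr => p _; apply: eq_bigr => q _; rewrite h orth.
Qed.

Lemma coordinate_projection (E : set G) : exists P : op K,
  [/\ bounded_op P, opbd P 1 & forall g, P (delta g) = if g \in E then delta g else 0].
Proof.
apply: basis_ext => // s; rewrite mul1r.
pose phi g := if g \in E then delta g else 0.
pose psi g := if g \in E then 0 else delta g.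
have -> : comb delta s = comb phi s + comb psi s.
  rewrite /comb -big_split; apply: eq_bigr => p _ /=; rewrite /phi /psi.
  by case: ifP; rewrite scaler0 ?addr0 ?add0r.
have o : rdot (comb phi s) (comb psi s) = 0.
  rewrite /rdot dotp_comb big1// => p _; rewrite big1// => q _.
  rewrite /phi /psi; case: ifP => hp; case: ifP => hq; rewrite ?dotp0l ?dotp0r ?mulr0//.
  rewrite orth; have [pq|] := eqVneq p.2 q.2; last by rewrite mulr0.
  by rewrite pq hq in hp.
rewrite -(@ler_pXn2r _ 2) ?nnegrE ?hnorm_ge0// sqr_hnormD o mulr0 addr0.
by rewrite lerDl sqr_ge0.
Qed.
End OrthonormalBasis.

Section Commutants.
Context (R : realType) (H : hilbert R).
Implicit Types S : set (op H).

Lemma commutant_adj S x : (forall y, S y -> bounded_op y) -> (forall y, S y -> S (adj y)) ->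
  commutant S x -> commutant S (adj x).
Proof.
move=> bS aS [bx hx]; split; first exact: bounded_adj.
move=> y Sy; have by_ := bS y Sy; have ba := bounded_adj by_.
have := congr1 (@adj R H) (hx _ (aS _ Sy)).
by rewrite (adj_comp bx ba) (adj_comp ba bx) (adjK by_).
Qed.

Lemma bicommutant_von_neumann S : (forall y, S y -> bounded_op y) ->
  (forall y, S y -> S (adj y)) -> von_neumann (commutant (commutant S)).
Proof.
move=> bS aS; split=> [x []|x Mx|]//.
  apply: commutant_adj => // y Sy; first by case: Sy.
  exact: commutant_adj.
apply/seteqP; split=> x [bx hx]; split=> // y hy; apply: hx.
  by split=> [|z [bz hz]]; [case: hy | rewrite hz].
by case: hy => by_ hy; split=> // z Sz; apply: hy; split=> [|w [_ ->]]//; exact: bS.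
Qed.
End Commutants.

Section RegularRepresentation.
Context (R : realType) (G : groupType) (K : hilbert R) (delta : G -> K).
Context (lambda : G -> op K) (reg : is_left_regular delta lambda).

Lemma reg_orth g h : dotp (delta g) (delta h) = (g == h)%:R.
Proof. by case: reg. Qed.
Lemma reg_spans : dense [set z | exists s, z = comb delta s].
Proof.
case: reg => _ d _ _; move: d; congr dense; apply/seteqP; split=> z [].
  move=> n [c [g ->]]; exists [seq (c i, g i) | i <- enum 'I_n].
  by rewrite /comb big_map /= big_enum.
move=> s ->; exists (size s), (fun i => (nth (0, 1%g) s i).1), (fun i => (nth (0, 1%g) s i).2).
by rewrite /comb (big_nth (0, 1%g)) big_mkord.
Qed.
Lemma lambda_bounded g : bounded_op (lambda g). Proof. by case: reg. Qed.
Lemma lambda_delta g h : lambda g (delta h) = delta (g * h)%g.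
Proof. by case: reg. Qed.

Let eqb := basis_eq reg_spans.

Lemma lambda1 : lambda 1%g = id.
Proof.
apply: eqb; [exact: lambda_bounded | exact: bounded_id |].
by move=> g; rewrite lambda_delta mul1g.
Qed.
Lemma lambdaM g h : lambda (g * h)%g = lambda g \o lambda h.
Proof.
apply: eqb; first exact: lambda_bounded.
  by apply: bounded_comp; exact: lambda_bounded.
by move=> k /=; rewrite !lambda_delta mulgA.
Qed.
Lemma lambda_adj g : adj (lambda g) = lambda g^-1%g.
Proof.
apply: eqb; [exact/bounded_adj/lambda_bounded | exact: lambda_bounded |].
move=> h; apply: (basis_inj reg_spans) => k.
rewrite adjPl; last exact: lambda_bounded.
rewrite !lambda_delta !reg_orth; congr (_%:R); congr nat_of_bool.
by apply/eqP/eqP => [->|<-]; rewrite ?mulKg ?mulVKg.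
Qed.
Lemma rdot_lambda g x y : rdot (lambda g x) y = rdot x (lambda g^-1%g y).
Proof. by rewrite rdot_adj ?lambda_adj//; exact: lambda_bounded. Qed.
Lemma lambdaVK g x : lambda g^-1%g (lambda g x) = x.
Proof. by have := congr1 (@^~ x) (lambdaM g^-1 g); rewrite mulVg lambda1 /= => <-. Qed.
Lemma hnorm_lambda g x : hnorm (lambda g x) = hnorm x.
Proof.
apply/eqP; rewrite -(@eqrXn2 _ 2) ?hnorm_ge0// !sqr_hnorm rdot_lambda.
by rewrite lambdaVK.
Qed.

(** This is L(G), in its standard representation on l^2(G). *)
Definition groupvN : set (op K) := commutant (commutant (range lambda)).
Local Notation A := groupvN.

Lemma groupvN_von_neumann : von_neumann A.
Proof.
apply: bicommutant_von_neumann => _ [g _ <-]; first exact: lambda_bounded.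
by exists g^-1%g => //; rewrite lambda_adj.
Qed.
Lemma groupvN_lambda g : A (lambda g).
Proof.
split=> [|z [_ hz]]; first exact: lambda_bounded.
by rewrite hz//; exists g.
Qed.

(** Right translations commute with the left regular representation, which
    makes delta_1 a separating trace vector. *)
Lemma right_translation g : exists r : op K, commutant (range lambda) r /\
  (forall h, r (delta h) = delta (h * g)%g).
Proof.
have [|r [br _ hr]] := @basis_ext _ _ _ _ reg_spans K (fun h => delta (h * g)%g) 1 ler01.
  move=> s; rewrite mul1r (@hnorm_comb_reindex _ _ _ _ reg_orth)// => h k.
  by rewrite reg_orth (inj_eq (mulIg g)).
exists r; split=> //; split=> // _ [h _ <-].
apply: eqb => [||k /=]; first by apply: bounded_comp => //; exact: lambda_bounded.
  by apply: bounded_comp => //; exact: lambda_bounded.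
by rewrite hr !lambda_delta hr mulgA.
Qed.

Lemma groupvN_translate x g (r : op K) : A x -> commutant (range lambda) r ->
  (forall h, r (delta h) = delta (h * g)%g) -> x (delta g) = r (x (delta 1%g)).
Proof.
move=> [_ hx] cr hr; have := congr1 (@^~ (delta 1%g)) (hx r cr) => /= <-.
by rewrite hr mul1g.
Qed.

Lemma groupvN_separating x : A x -> x (delta 1%g) = 0 -> x = (fun=> 0).
Proof.
move=> Ax h; have bx := vN_bounded groupvN_von_neumann Ax.
apply: eqb => // [|g]; first exact: bounded_0.
have [r [cr hr]] := right_translation g.
by rewrite (groupvN_translate Ax cr hr) h (lin0 (bounded_linear cr.1)).
Qed.

(** Right translations express the coefficients of z delta_1 as traces, so that
    z^* delta_1 is the image of z delta_1 under the conjugate linear isometry that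
    sends delta_g to delta_(g^-1).  In other words the canonical trace is a trace. *)
Lemma groupvN_trace_vector z : A z -> hnorm (adj z (delta 1%g)) = hnorm (z (delta 1%g)).
Proof.
suff le y : A y -> hnorm (adj y (delta 1%g)) <= hnorm (y (delta 1%g)).
  move=> Az; have bz := vN_bounded groupvN_von_neumann Az.
  apply/eqP; rewrite eq_le le//=.
  by have := le _ (vN_adj groupvN_von_neumann Az); rewrite adjK.
move=> Ay; have by_ := vN_bounded groupvN_von_neumann Ay.
apply: (dense_rdot_le reg_spans); first exact: hnorm_ge0.
move=> _ [s ->].
pose t := [seq (Num.conj p.1, p.2) | p <- s].
have coef g : dotp (adj y (delta 1%g)) (delta g) = dotp (delta g^-1%g) (y (delta 1%g)).
  have [r [cr hr]] := right_translation g.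
  rewrite adjPl// (groupvN_translate Ay cr hr) -adjPl; last exact: cr.1.
  congr dotp; apply: (basis_inj reg_spans) => k; rewrite adjPl; last exact: cr.1.
  rewrite hr !reg_orth; congr (_%:R); congr nat_of_bool.
  by apply/eqP/eqP => [e|<-]; rewrite ?mulVg// -[k](mulgK g) -e mul1g.
have -> : rdot (adj y (delta 1%g)) (comb delta s) =
    rdot (comb (fun g => delta g^-1%g) t) (y (delta 1%g)).
  rewrite /rdot dotp_sumr dotp_suml big_map; congr (complex.Re _).
  by apply: eq_bigr => p _ /=; rewrite dotpZr dotpZl coef.
rewrite (le_trans (cauchy_schwarz_rdot _ _))// mulrC ler_wpM2l ?hnorm_ge0//.
rewrite (@hnorm_comb_reindex _ _ _ _ reg_orth); last first.
  by move=> g h; rewrite reg_orth (inj_eq invg_inj).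
rewrite le_eqVlt; apply/orP; left; rewrite -(@eqrXn2 _ 2) ?hnorm_ge0// !sqr_hnorm.
rewrite /rdot !dotp_comb big_map -cRe_conj rmorph_sum /=; apply/eqP; congr (complex.Re _).
apply: eq_bigr => p _; rewrite big_map rmorph_sum; apply: eq_bigr => q _ /=.
by rewrite !rmorphM /= !conjCK !reg_orth conjC_nat.
Qed.

End RegularRepresentation.

(** * Domination of one positive functional by another *)

Section PsdOrder.
Context (R : realType) (H : hilbert R).
Implicit Types p q r : op H.

Definition psd_le p q := psd (fun v => q v - p v).

Lemma psd_le_refl p : psd_le p p.
Proof. by rewrite /psd_le; under eq_fun do rewrite subrr; exact: psd_0. Qed.
Lemma psd_le_trans p q r : psd_le p q -> psd_le q r -> psd_le p r.
Proof.
move=> pq qr; have := psd_add qr pq; rewrite /psd_le.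
by under eq_fun do rewrite addrA subrK.
Qed.
Lemma psd_le_rdot p q v : psd_le p q -> rdot (p v) v <= rdot (q v) v.
Proof. by move=> [_ /(_ v)]; rewrite rdotBl subr_ge0. Qed.
Lemma selfadj_sub p q : selfadj p -> selfadj q -> selfadj (fun v => p v - q v).
Proof. by move=> sp sq x y; rewrite rdotBl rdotBr sp sq. Qed.
Lemma psd_le_of_rdot p q : selfadj p -> selfadj q ->
  (forall v, rdot (p v) v <= rdot (q v) v) -> psd_le p q.
Proof.
move=> sp sq h; split=> [|v]; first exact: selfadj_sub.
by rewrite rdotBl subr_ge0.
Qed.
Lemma psd_le_anti p q : linear p -> linear q -> psd_le p q -> psd_le q p -> p = q.
Proof.
move=> lp lq pq qp; apply/funext => v; apply/eqP; rewrite eq_sym -subr_eq0; apply/eqP.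
apply: hnorm_eq0; apply/eqP; rewrite -sqrf_eq0 eq_le sqr_ge0 andbT.
have l : linear (fun v => q v - p v) by move=> a x y; rewrite lq lp scalerBr opprD addrACA.
rewrite (le_trans (psd_norm_bound (r := 0) v l pq _)) ?mul0r// => w.
by rewrite mul0r rdotBl subr_le0 psd_le_rdot.
Qed.
Lemma psd_le_subr p q : psd p -> psd q -> psd_le (fun v => q v - p v) q.
Proof.
move=> pp pq; apply: psd_le_of_rdot; [|exact: pq.1|].
  by apply: selfadj_sub; [exact: pq.1 | exact: pp.1].
by move=> v; rewrite rdotBl gerBl pp.2.
Qed.
Lemma homo_psd_le (p : nat -> op H) : (forall n, psd_le (p n) (p n.+1)) ->
  forall m n, (m <= n)%N -> psd_le (p m) (p n).
Proof.
move=> h m n /subnKC <-; elim: (n - m)%N => [|k IH]; first by rewrite addn0; exact: psd_le_refl.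
by rewrite addnS; exact: psd_le_trans IH (h _).
Qed.

Lemma selfadj_Im p v : linear p -> selfadj p -> complex.Im (dotp (p v) v) = 0.
Proof.
move=> lp sp; rewrite Im_dotp.
have ri x y : rdot ('i%C *: x) y = - rdot x ('i%C *: y).
  rewrite /rdot dotpZl dotpZr cReM cReM cRe_conj cIm_conj /=; ring.
have := sp ('i%C *: v) v; rewrite (linZ lp) (ri _ _ v) (rdotC v); lra.
Qed.

Lemma psd_dotp_ge0 p v : linear p -> psd p -> 0 <= dotp (p v) v.
Proof. by move=> lp [sp pp]; rewrite lecE /= (selfadj_Im _ lp sp) eqxx pp. Qed.

Lemma psd_le_op_le p q : linear p -> linear q -> psd_le p q -> op_le p q.
Proof.
move=> lp lq pq v; rewrite -subr_ge0 -dotpBl.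
have l : linear (fun v => q v - p v) by move=> a x y; rewrite lq lp scalerBr opprD addrACA.
exact: psd_dotp_ge0 l pq.
Qed.
End PsdOrder.

Section Domination.
Context (R : realType) (K : hilbert R) (A : set (op K)) (vA : von_neumann A).
Context (phi : op K -> R) (xi : K).
Hypothesis phiB : forall x y, A x -> A y -> phi (fun v => x v - y v) = phi x - phi y.
Hypothesis phi_ge0 : forall x, A x -> psd x -> 0 <= phi x.
Hypothesis phi_sup : forall (x_ : nat -> op K) x, (forall n, A (x_ n)) -> A x ->
  (forall n, psd (x_ n)) -> (forall n, psd_le (x_ n) (x_ n.+1)) ->
  (forall v, hcvg (x_ ^~ v) (x v)) -> (fun n => phi (x_ n)) @ \oo --> phi x.
Let psi (x : op K) := rdot (x xi) xi.

Let phi_le x y : A x -> A y -> psd_le x y -> phi x <= phi y.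
Proof.
move=> Ax Ay xy; rewrite -subr_ge0 -phiB//; apply: phi_ge0 => //.
exact: vN_sub.
Qed.
Let phi0 : phi (fun=> 0) = 0.
Proof.
by have := phiB (vN_0 vA) (vN_0 vA); rewrite !subrr.
Qed.
Let phiD x y : A x -> A y -> phi (fun v => x v + y v) = phi x + phi y.
Proof.
move=> Ax Ay; have := phiB (vN_add vA Ax Ay) Ay.
by under eq_fun do rewrite addrK; move=> ->; rewrite subrK.
Qed.

(** Among the x below z with c psi(x) <= phi(x) there is a maximal one, found
    greedily along a sequence; below its complement phi is dominated. *)
Lemma dominated_complement z (c : R) : A z -> psd z -> 0 <= c ->
  exists x, [/\ A x, psd x, psd_le x z, c * psi x <= phi x &
    forall y, A y -> psd y -> psd_le y (fun v => z v - x v) -> phi y <= c * psi y].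
Proof.
move=> Az pz c0.
pose V x := [/\ A x, psd x, psd_le x z & c * psi x <= phi x].
have V0 : V (fun=> 0).
  split; [exact: vN_0 | exact: psd_0 | | by rewrite /psi rdot0l mulr0 phi0].
  by rewrite /psd_le; under eq_fun do rewrite subr0.
have next (nx : nat * op K) : exists x', V nx.2 -> [/\ V x', psd_le nx.2 x' &
    forall x'', V x'' -> psd_le nx.2 x'' -> phi x'' <= phi x' + nx.1.+1%:R^-1].
  case: nx => n x /=; have [Vx|] := pselect (V x); last by exists x.
  pose E := phi @` [set x' | V x' /\ psd_le x x'].
  have hE : has_sup E.
    split; first by exists (phi x), x => //; split=> //; exact: psd_le_refl.
    by exists (phi z) => _ [x' [[Ax' _ xz _] _] <-]; exact: phi_le.
  have e0 : 0 < n.+1%:R^-1 :> R by rewrite invr_gt0.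
  have [_ [x' [Vx' xx'] <-] hx'] := sup_adherent e0 hE.
  exists x' => _; split=> // x'' Vx'' xx''; rewrite -lerBlDr (le_trans _ (ltW hx'))//.
  by rewrite lerD2r; apply: ub_le_sup; [case: hE | exists x''].
have [f hf] := choice next.
pose X := fix X n := if n is n'.+1 then f (n', X n') else (fun=> 0) : op K.
have VX n : V (X n) by elim: n => [//|n IH]; have [] := hf (n, X n) IH.
have XS n : psd_le (X n) (X n.+1) by have [] := hf (n, X n) (VX n).
have Xsup n x'' : V x'' -> psd_le (X n) x'' -> phi x'' <= phi (X n.+1) + n.+1%:R^-1.
  by have [_ _ h] := hf (n, X n) (VX n); exact: h.
have [r r0 hr] := bounded_bd (vN_bounded vA Az).
have AX n : A (X n) by case: (VX n).
have pX n : psd (X n) by case: (VX n).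
have [||||S [bS pS hS SX]] := @monotone_limit _ _ X r.
- by move=> n; exact (vN_linear vA (AX n)).
- by [].
- exact: homo_psd_le.
- move=> n v; rewrite (le_trans _ (rdot_opbd v hr))//.
  by apply: psd_le_rdot; case: (VX n).
have AS : A S := vN_lim vA AX hS bS.
have SXle n : psd_le (X n) S := SX n.
have VS : V S.
  split=> //.
    apply: psd_le_of_rdot; [exact: pS.1 | exact: pz.1 |] => v.
    apply: lim_le_cst (hcvg_rdot (hS v)) => n.
    by apply: psd_le_rdot; case: (VX n).
  rewrite mulrC; have := hcvg_rdot (y := xi) (hS xi) => h.
  have [->|cn] := eqVneq c 0; first by rewrite mulr0 phi_ge0.
  rewrite -ler_pdivlMr ?lt_neqAle 1?eq_sym ?cn//.
  apply: lim_le_cst h => n; rewrite ler_pdivlMr ?lt_neqAle 1?eq_sym ?cn// mulrC.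
  by case: (VX n) => _ _ _ /le_trans; apply; exact: phi_le.
exists S; split=> //; [by case: VS..|] => y Ay py yz.
rewrite leNgt; apply/negP => slt; have lt := ltW slt.
have VSy : V (fun v => S v + y v).
  split; [exact: vN_add | exact: psd_add | |].
    by move: yz; rewrite /psd_le; under eq_fun do rewrite -addrA -opprD.
  rewrite phiD// /psi rdotDl mulrDr lerD//; by case: VS.
suff h : phi y <= 0 by move: (lt_le_trans slt h); rewrite ltNge mulr_ge0// py.2.
apply/ler_addgt0Pr => e e0; rewrite add0r.
have [N _ hN] := near_infty_natSinv_lt (PosNum e0).
rewrite (le_trans _ (ltW (hN N (leqnn N))))//= -(lerD2l (phi S)) -phiD//.
rewrite (le_trans (Xsup N _ VSy _)) ?lerD2r ?phi_le//.
apply: psd_le_trans (SXle N) _; rewrite /psd_le.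
by under eq_fun do rewrite addrC addKr.
Qed.

Hypothesis psi_faithful : forall x, A x -> psd x -> psi x = 0 -> x = (fun=> 0).

(** A countable chain of such complements, with constants 2^k, exhausts the
    identity: the remainders decrease to an operator on which psi vanishes. *)
Lemma dominated_exhaustion (e : R) : 0 < e ->
  exists (n : nat) (f : nat -> op K), [/\
    forall k, [/\ A (f k), psd (f k) & psd_le (f k) id],
    forall k y, A y -> psd y -> psd_le y (f k) -> phi y <= 2 ^+ k * psi y,
    psd_le (fun v => \sum_(k < n) f k v) id &
    phi (fun v => v - \sum_(k < n) f k v) <= e].
Proof.
move=> e0.
have next (kz : nat * op K) : exists x, A kz.2 -> psd kz.2 ->
    [/\ A x, psd x, psd_le x kz.2, 2 ^+ kz.1 * psi x <= phi x &
    forall y, A y -> psd y -> psd_le y (fun v => kz.2 v - x v) -> phi y <= 2 ^+ kz.1 * psi y].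
  case: kz => k z /=; have [[Az pz]|h] := pselect (A z /\ psd z).
    have c0 : 0 <= 2 ^+ k :> R by rewrite exprn_ge0.
    by have [x hx] := dominated_complement Az pz c0; exists x.
  by exists z => Az pz; case: h.
have [g hg] := choice next.
pose X := fix X n := if n is n'.+1 then g (n', X n') else id : op K.
have AX n : A (X n) /\ psd (X n).
  elim: n => [|n [AX pX]]; first by split; [exact: vN_id | exact: psd_id].
  by have [] := hg (n, X n) AX pX.
have XS n : psd_le (X n.+1) (X n) by have [] := hg (n, X n) (AX n).1 (AX n).2.
have psiX n : 2 ^+ n * psi (X n.+1) <= phi (X n.+1).
  by have [] := hg (n, X n) (AX n).1 (AX n).2.
have domX n y : A y -> psd y -> psd_le y (fun v => X n v - X n.+1 v) -> phi y <= 2 ^+ n * psi y.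
  by have [_ _ _ _ h] := hg (n, X n) (AX n).1 (AX n).2; exact: h.
have Xid n : psd_le (X n) id.
  by elim: n => [|n IH]; [exact: psd_le_refl | exact: psd_le_trans (XS n) IH].
have Aid : A id := vN_id vA.
pose W n : op K := fun v => v - X n v.
have AW n : A (W n) by apply: vN_sub => //; case: (AX n).
have pW n : psd (W n) := Xid n.
have WS n : psd_le (W n) (W n.+1).
  have := XS n; rewrite /psd_le; congr psd; apply/funext => v.
  by rewrite /W opprB [RHS]addrC addrA subrK.
have [||||S [bS pS hS SW]] := @monotone_limit _ _ W 1.
- by move=> n; exact (vN_linear vA (AW n)).
- by [].
- exact: homo_psd_le.
- by move=> n v; rewrite mul1r /W rdotBl -sqr_hnorm gerBl (AX n).2.2.
have AS : A S := vN_lim vA AW hS bS.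
have S1 : psd_le S id.
  apply: psd_le_of_rdot; [exact: pS.1 | exact: (psd_id K).1 |] => v.
  apply: lim_le_cst (hcvg_rdot (hS v)) => n.
  by rewrite /W rdotBl gerBl (AX n).2.2.
have S_id : S = id.
  apply/funext => v; apply/eqP; rewrite eq_sym -subr_eq0; apply/eqP.
  suff /(congr1 (@^~ v)) : (fun v => v - S v) = (fun=> 0) by [].
  apply: psi_faithful => //; first exact: (vN_sub vA Aid AS).
  have le n : psi (fun v => v - S v) <= phi id * 2^-1 ^+ n.
    have h1 : psi (fun v => v - S v) <= psi (X n.+1).
      rewrite /psi rdotBl; have := psd_le_rdot xi (SW n.+1); rewrite /W rdotBl; lra.
    rewrite (le_trans h1)// exprVn ler_pdivlMr ?exprn_gt0// mulrC.
    by rewrite (le_trans (psiX n))// phi_le//; case: (AX n.+1).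
  apply/eqP; rewrite eq_le S1.2 andbT.
  have lim : (fun n => phi id * 2^-1 ^+ n) @ \oo --> phi id * 0.
    apply: cvgM; first exact: cvg_cst.
    by apply: cvg_expr; rewrite ger0_norm ?invr_ge0// invf_lt1// ltr1n.
  by rewrite mulr0 in lim; exact: lim_ge_cst le lim.
rewrite S_id in hS.
have lim := phi_sup AW Aid pW WS hS.
have /cvgrPdist_lt/(_ _ e0)[n _ /(_ n (leqnn n)) hn] := lim.
pose f k : op K := fun v => X k v - X k.+1 v.
have sumf v : \sum_(k < n) f k v = W n v.
  rewrite -(big_mkord xpredT (fun k => f k v)) /W.
  elim: n {hn} => [|n IH]; first by rewrite big_nil subrr.
  by rewrite big_nat_recr//= IH /f /W addrA subrK.
exists n, f; split.
- move=> k; split; first by apply: vN_sub => //; [case: (AX k) | case: (AX k.+1)].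
    exact: XS.
  apply: psd_le_trans (Xid k); apply: psd_le_subr; [by case: (AX k.+1) | by case: (AX k)].
- by move=> k y; exact: domX.
- rewrite (_ : (fun v => _) = W n); last by apply/funext => v; rewrite sumf.
  by apply: (psd_le_subr (AX n).2 (psd_id K)).
- rewrite (_ : (fun v => _) = (fun v => v - W n v)); last by apply/funext => v; rewrite sumf.
  by rewrite phiB//; exact: le_trans (ler_norm _) (ltW hn).
Qed.
End Domination.

(** * Standard forms and isomorphisms *)

Section Bimodules.
Context (R : realType) (H : hilbert R) (M : set (op H)) (L : bimodule M).
Lemma lact_hom : star_hom M (lact L). Proof. by case: L. Qed.
Lemma ract_antihom : star_antihom M (ract L). Proof. by case: L. Qed.
Lemma lact_map : star_map M (lact L). Proof. by left; exact: lact_hom. Qed.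
Lemma ract_map : star_map M (ract L). Proof. by right; exact: ract_antihom. Qed.
Lemma lactM x y v : M x -> M y -> lact L (x \o y) v = lact L x (lact L y v).
Proof. by move=> Mx My; case: lact_hom => _ ->. Qed.
Lemma ractM x y v : M x -> M y -> ract L (x \o y) v = ract L y (ract L x v).
Proof. by move=> Mx My; case: ract_antihom => _ ->. Qed.
Lemma lract x y v : M x -> M y -> lact L x (ract L y v) = ract L y (lact L x v).
Proof.
move=> Mx My; suff /(congr1 (@^~ v)) : lact L x \o ract L y = ract L y \o lact L x by [].
by case: L x y Mx My.
Qed.
End Bimodules.

Section StandardForm.
Context (R : realType) (H : hilbert R) (M : set (op H)) (vM : von_neumann M).
Context (tau : op H -> R[i]) (ft : faithful_normal_trace M tau).
Context (L : bimodule M) (hat : op H -> L) (hL : is_L2 tau hat).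

Lemma hat_linear : linear_on M hat. Proof. by case: hL. Qed.
Lemma dotp_hat x y : M x -> M y -> dotp (hat x) (hat y) = tau (adj y \o x).
Proof. by case: hL => _ h _ _ _; exact: h. Qed.
Lemma hat_dense : dense (hat @` M). Proof. by case: hL. Qed.
Lemma lact_hat x y : M x -> M y -> lact L x (hat y) = hat (x \o y).
Proof. by case: hL => _ _ _ h _; exact: h. Qed.
Lemma ract_hat x y : M x -> M y -> ract L x (hat y) = hat (y \o x).
Proof. by case: hL => _ _ _ _ h; exact: h. Qed.
Lemma hatB x y : M x -> M y -> hat (fun v => x v - y v) = hat x - hat y.
Proof. by move=> Mx My; exact: (linear_onB hat_linear). Qed.
Lemma hatD x y : M x -> M y -> hat (fun v => x v + y v) = hat x + hat y.
Proof. by move=> Mx My; exact: (linear_onD hat_linear). Qed.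
Lemma hatZ c x : M x -> hat (fun v => c *: x v) = c *: hat x.
Proof. by move=> Mx; exact: (linear_onZ vM hat_linear). Qed.
Lemma hat_sum (I : Type) (s : seq I) (F : I -> op H) :
  (forall i, M (F i)) -> hat (fun v => \sum_(i <- s) F i v) = \sum_(i <- s) hat (F i).
Proof. by move=> MF; exact: (linear_on_sum vM hat_linear). Qed.
Lemma sqr_hat x : M x -> hnorm (hat x) ^+ 2 = complex.Re (tau (adj x \o x)).
Proof. by move=> Mx; rewrite sqr_hnorm /rdot dotp_hat. Qed.
Lemma norm2_hat x : M x -> norm2 tau x = hnorm (hat x).
Proof. by move=> Mx; rewrite /norm2 -sqr_hat// sqrtr_sqr ger0_norm ?hnorm_ge0. Qed.
Lemma hat_adj x : M x -> hnorm (hat (adj x)) = hnorm (hat x).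
Proof.
move=> Mx; have Ma := vN_adj vM Mx; have bx := vN_bounded vM Mx.
apply/eqP; rewrite -(@eqrXn2 _ 2) ?hnorm_ge0// !sqr_hat// adjK//.
by rewrite (trC ft).
Qed.
Lemma hat_mull x y c : M x -> M y -> 0 <= c -> opbd x c ->
  hnorm (hat (x \o y)) <= c * hnorm (hat y).
Proof.
move=> Mx My c0 hc; rewrite -lact_hat//.
exact: (star_map_opbd vM (lact_map L) Mx c0 hc).
Qed.
Lemma hat_mulr x y c : M x -> M y -> 0 <= c -> opbd y c ->
  hnorm (hat (x \o y)) <= c * hnorm (hat x).
Proof.
move=> Mx My c0 hc; rewrite -ract_hat//.
exact: (star_map_opbd vM (ract_map L) My c0 hc).
Qed.
Lemma hat_id : hnorm (hat id) = 1.
Proof.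
have Mi := vN_id vM; apply/eqP; rewrite -(@eqrXn2 _ 2) ?hnorm_ge0// expr1n.
by rewrite sqr_hat// adj_id (tr1 ft).
Qed.
(** For 0 <= x <= 1 one has x^2 <= x, so that the 2-norm is controlled by the trace. *)
Lemma sqr_hat_le_tr x : M x -> psd x -> psd_le x id ->
  hnorm (hat x) ^+ 2 <= complex.Re (tau x).
Proof.
move=> Mx px x1; have lx := vN_linear vM Mx; have bx := vN_bounded vM Mx.
rewrite sqr_hat// psd_adj//; apply: (tr_le vM ft) => //; first exact: vN_comp.
apply: psd_le_of_rdot; [by move=> a b /=; rewrite !px.1|exact: px.1|] => v /=.
rewrite px.1 -sqr_hnorm -[leRHS]mul1r; apply: psd_norm_bound => // w.
by rewrite mul1r sqr_hnorm; exact: psd_le_rdot.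
Qed.
End StandardForm.

Section StarIso.
Context (R : realType) (H K : hilbert R) (A : set (op K)) (N : set (op H)).
Context (vA : von_neumann A) (vN : von_neumann N).
Context (theta : op K -> op H) (iso : star_iso A N theta).

Lemma iso_map : star_map A theta. Proof. by left; case: iso. Qed.
Lemma iso_mem x : A x -> N (theta x).
Proof. by case: iso => _ [h _ _]; exact: h. Qed.
Lemma iso_inj x y : A x -> A y -> theta x = theta y -> x = y.
Proof. by case: iso => _ [_ h _] Ax Ay; apply: h; rewrite inE. Qed.
Lemma iso_surj y : N y -> exists2 x, A x & theta x = y.
Proof. by case: iso => _ [_ _ h] /h[x Ax <-]; exists x. Qed.
Lemma isoM x y : A x -> A y -> theta (x \o y) = theta x \o theta y.
Proof. by case: iso => -[_ h] _; exact: h. Qed.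
Lemma isoD x y : A x -> A y -> theta (fun v => x v + y v) = fun v => theta x v + theta y v.
Proof. by move=> Ax Ay; apply/funext => v; exact: (star_mapD iso_map). Qed.
Lemma isoB x y : A x -> A y -> theta (fun v => x v - y v) = fun v => theta x v - theta y v.
Proof. by move=> Ax Ay; apply/funext => v; exact: (star_mapB iso_map). Qed.
Lemma isoZ c x : A x -> theta (fun v => c *: x v) = fun v => c *: theta x v.
Proof. by move=> Ax; apply/funext => v; exact: (star_mapZ vA iso_map). Qed.
Lemma iso_sum (I : Type) (s : seq I) (F : I -> op K) : (forall i, A (F i)) ->
  theta (fun v => \sum_(i <- s) F i v) = fun v => \sum_(i <- s) theta (F i) v.
Proof. by move=> AF; apply/funext => v; exact: (star_map_sum vA iso_map). Qed.
Lemma iso_adj x : A x -> theta (adj x) = adj (theta x).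
Proof. by move=> Ax; exact: (star_map_adj iso_map). Qed.
Lemma iso_id : theta id = id. Proof. exact: (star_map_id iso_map). Qed.
Lemma iso_psd x : A x -> psd x -> psd (theta x).
Proof. exact: (star_map_psd vA iso_map). Qed.

Lemma iso_psd_inv x : A x -> psd (theta x) -> psd x.
Proof.
move=> Ax px; have bx := vN_bounded vA Ax.
have ax : adj x = x.
  apply: iso_inj => //; first exact: vN_adj.
  rewrite iso_adj//; apply: psd_adj px; exact: (vN_bounded vN (iso_mem Ax)).
split=> [v w|v]; first by rewrite rdot_adj// ax.
apply/ler_addgt0Pr => e e0.
have e1 : 0 < e / (hnorm v ^+ 2 + 1) by rewrite divr_gt0// ltr_wpDl ?sqr_ge0.
have [_ /iso_surj[y Ay <-] hy] := psd_factor vN (iso_mem Ax) px e1.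
have As : A (fun w => rc (e / (hnorm v ^+ 2 + 1)) *: w) by exact: (vN_scale vA _ (vN_id vA)).
have Aay := vN_adj vA Ay.
have E : (fun w => x w + rc (e / (hnorm v ^+ 2 + 1)) *: w) = adj y \o y.
  apply: iso_inj; [exact: vN_add | exact: vN_comp |].
  rewrite isoD// isoM// iso_adj//; apply/funext => w /=.
  by rewrite -hy (star_map_scalar vA iso_map).
have := (psd_adjM (vN_bounded vA Ay)).2 v; rewrite -E rdotDl rdotZl -sqr_hnorm.
move=> /le_trans; apply; rewrite lerD2l mulrAC ler_pdivrMr ?ltr_wpDl ?sqr_ge0//.
by rewrite ler_wpM2l ?(ltW e0)// lerDl.
Qed.

(** A *-isomorphism of von Neumann algebras is an order isomorphism, hence
    preserves the suprema that strong limits of increasing sequences are. *)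
Lemma iso_monotone_limit (x_ : nat -> op K) x : (forall n, A (x_ n)) -> A x ->
  (forall n, psd (x_ n)) -> (forall n, psd_le (x_ n) (x_ n.+1)) ->
  (forall v, hcvg (x_ ^~ v) (x v)) ->
  forall v, hcvg (fun n => theta (x_ n) v) (theta x v).
Proof.
move=> Ax_ Ax px incr lim.
have [r r0 hr] := bounded_bd (vN_bounded vA Ax).
have sx : selfadj x by apply: selfadj_lim lim => n; exact: (px n).1.
have le n : psd_le (x_ n) x.
  apply: psd_le_of_rdot => // [|v]; first exact: (px n).1.
  have h : (fun k => rdot (x_ (k + n)%N v) v) @ \oo --> rdot (x v) v.
    by rewrite (cvg_shiftn n (fun k => rdot (x_ k v) v)); exact: hcvg_rdot.
  apply: lim_ge_cst h => k; apply: psd_le_rdot.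
  by apply: homo_psd_le => //; exact: leq_addl.
have le_theta y z : A y -> A z -> psd_le y z -> psd_le (theta y) (theta z).
  move=> Ay Az yz; rewrite /psd_le -isoB//; apply: iso_psd => //; exact: vN_sub.
have le_theta_inv y z : A y -> A z -> psd_le (theta y) (theta z) -> psd_le y z.
  move=> Ay Az; rewrite /psd_le -isoB//; apply: iso_psd_inv; exact: vN_sub.
have bt := star_map_opbd vA iso_map Ax (ltW r0) hr.
have [||||S [bS pS hS Sle]] := @monotone_limit _ _ (fun n => theta (x_ n)) r.
- by move=> n; exact (vN_linear vN (iso_mem (Ax_ n))).
- by move=> n; exact: iso_psd.
- by apply: homo_psd_le => n; exact: le_theta.
- move=> n v; rewrite (le_trans _ (rdot_opbd v bt))//.
  by apply: psd_le_rdot; exact: le_theta.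
have NS : N S by apply: (vN_lim vN _ hS bS) => n; exact: iso_mem.
have [b Ab hb] := iso_surj NS.
suff -> : theta x = S by [].
have pb : psd b by apply: iso_psd_inv; rewrite ?hb.
apply: psd_le_anti; [exact (vN_linear vN (iso_mem Ax)) | exact: bounded_linear bS | |].
  rewrite -hb; apply: le_theta => //; apply: psd_le_of_rdot => //; first exact: pb.1.
  move=> v; apply: lim_le_cst (hcvg_rdot (lim v)) => n; apply: psd_le_rdot.
  by apply: le_theta_inv => //; rewrite hb; exact: Sle.
apply: psd_le_of_rdot; [exact: pS.1 | |].
  have := le_theta _ _ (Ax_ 0%N) Ax (le 0%N); have := iso_psd (Ax_ 0%N) (px 0%N).
  by move=> h1 h2; have := psd_add h2 h1; under eq_fun do rewrite subrK; case.
move=> v; apply: lim_le_cst (hcvg_rdot (hS v)) => n; apply: psd_le_rdot.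
exact: le_theta.
Qed.
End StarIso.

Section NormalTrace.
Context (R : realType) (H : hilbert R) (M : set (op H)) (vM : von_neumann M).
Context (tau : op H -> R[i]) (ft : faithful_normal_trace M tau).

Lemma tr_psd_ge0 p : M p -> psd p -> 0 <= tau p.
Proof.
move=> Mp pp; have [y My hy] := psd_factor vM Mp pp ltr01.
have : 0 <= tau (adj y \o y) by case: ft => _ [h _ _ _ _]; exact: h.
rewrite (_ : adj y \o y = fun w => p w + rc 1 *: w); last first.
  by apply/funext => w; rewrite hy.
have Mi := vN_id vM; rewrite (trD ft)//; last exact: (vN_scale vM _ Mi).
have ImD (z w : R[i]) : complex.Im (z + w) = complex.Im z + complex.Im w.
  by case: z; case: w.
rewrite (trZ vM ft _ Mi) (tr1 ft) mulr1 !lecE ImD /= addr0 => /andP[h _].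
by rewrite h (tr_psd vM ft).
Qed.

(** Normality is stated for directed sets; the terms of an increasing sequence
    form one, and its strong limit is its least upper bound in M. *)
Lemma tr_monotone_limit (x_ : nat -> op H) x : (forall n, M (x_ n)) -> M x ->
  (forall n, psd (x_ n)) -> (forall n, psd_le (x_ n) (x_ n.+1)) ->
  (forall v, hcvg (x_ ^~ v) (x v)) ->
  (fun n => complex.Re (tau (x_ n))) @ \oo --> complex.Re (tau x).
Proof.
move=> Mx_ Mx px incr lim.
have sx : selfadj x by apply: selfadj_lim lim => n; exact: (px n).1.
have lx_ n : linear (x_ n) := vN_linear vM (Mx_ n).
have lx : linear x := vN_linear vM Mx.
have mono := homo_psd_le incr.
have le n : psd_le (x_ n) x.
  apply: psd_le_of_rdot => // [|v]; first exact: (px n).1.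
  have h : (fun k => rdot (x_ (k + n)%N v) v) @ \oo --> rdot (x v) v.
    by rewrite (cvg_shiftn n (fun k => rdot (x_ k v) v)); exact: hcvg_rdot.
  apply: lim_ge_cst h => k; apply: psd_le_rdot.
  by apply: mono; exact: leq_addl.
pose a n := complex.Re (tau (x_ n)).
have nda : {homo a : m n / (m <= n)%N >-> m <= n}.
  by move=> m n mn; apply: (tr_le vM ft) => //; exact: mono.
have bda n : a n <= complex.Re (tau x) by apply: (tr_le vM ft) => //; exact: le.
have ca : cvgn a by apply: nondecreasing_is_cvgn => //; exists (complex.Re (tau x)) => _ [n _ <-].
suff -> : complex.Re (tau x) = limn a by [].
apply/eqP; rewrite eq_le; apply/andP; split; last exact: lim_le_cst bda ca.
have nrm : normal_on M tau by case: ft => _ [].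
have [|||||||ub lb] := nrm (range x_) x.
- by move=> _ [n _ <-].
- by exists (x_ 0%N), 0%N.
- move=> _ [n _ <-] v; rewrite dotp0l; exact: psd_dotp_ge0.
- move=> _ _ [m _ <-] [n _ <-]; exists (x_ (maxn m n)); split.
  + by exists (maxn m n).
  + by apply: psd_le_op_le => //; apply: mono; exact: leq_maxl.
  + by apply: psd_le_op_le => //; apply: mono; exact: leq_maxr.
- by [].
- by move=> _ [n _ <-]; apply: psd_le_op_le.
- move=> s' Ms' hs' v; have h0 := hs' _ (ex_intro2 _ _ 0%N I erefl) v.
  have i0 := psd_dotp_ge0 v (lx_ 0%N) (px 0%N).
  have s0 := le_trans i0 h0.
  rewrite lecE (selfadj_Im v lx sx) (ger0_Im s0) eqxx /=.
  apply: lim_le_cst (hcvg_rdot (lim v)) => n.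
  by have := hs' _ (ex_intro2 _ _ n I erefl) v; rewrite lecE => /andP[].
have : tau x <= rc (limn a).
  apply: lb => _ [_ [n _ <-] <-].
  have := tr_psd_ge0 (Mx_ n) (px n); rewrite !lecE /= eq_sym => /andP[-> _] /=.
  exact: nondecreasing_cvgn_le.
by rewrite lecE => /andP[].
Qed.
End NormalTrace.

(** * A copy of the group von Neumann algebra in a tracial algebra *)

Section Composition.
Context (R : realType) (H K L : hilbert R) (A : set (op K)) (M : set (op H)).
Context (theta : op K -> op H) (ht : star_hom A theta) (hm : forall x, A x -> M (theta x)).
Context (vA : von_neumann A).

Lemma star_linear_comp (pi : op H -> op L) : star_linear M pi ->
  star_linear A (fun x => pi (theta x)).
Proof.
case: ht => -[bt lt it at_] mt [bp lp ip ap]; split.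
- by move=> x Ax; apply: bp; exact: hm.
- move=> v c x y Ax Ay; rewrite -lp; [|exact: hm..]; congr (pi _ v).
  by apply/funext => w; exact: lt.
- by rewrite it.
- by move=> x Ax; rewrite at_// ap//; exact: hm.
Qed.
Lemma star_hom_comp (pi : op H -> op L) : star_hom M pi -> star_hom A (fun x => pi (theta x)).
Proof.
move=> [lp mp]; split; first exact: star_linear_comp.
by move=> x y Ax Ay; case: ht => _ ->//; apply: mp; exact: hm.
Qed.
Lemma star_antihom_comp (pi : op H -> op L) :
  star_antihom M pi -> star_antihom A (fun x => pi (theta x)).
Proof.
move=> [lp mp]; split; first exact: star_linear_comp.
by move=> x y Ax Ay; case: ht => _ ->//; apply: mp; exact: hm.
Qed.
End Composition.

Section GroupSubalgebra.
Context (R : realType) (H : hilbert R) (M : set (op H)) (vM : von_neumann M).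
Context (tau : op H -> R[i]) (ft : faithful_normal_trace M tau).
Context (L : bimodule M) (hat : op H -> L) (hL : is_L2 tau hat).
Context (G : groupType) (K : hilbert R) (delta : G -> K) (lambda : G -> op K).
Context (reg : is_left_regular delta lambda).
Local Notation A := (groupvN lambda).
Context (N : set (op H)) (vN : von_neumann N) (NM : N `<=` M).
Context (theta : op K -> op H) (iso : star_iso A N theta).
Local Notation d1 := (delta 1%g).

Let vA : von_neumann A := groupvN_von_neumann reg.
Let thM x : A x -> M (theta x). Proof. by move/(iso_mem iso)/NM. Qed.

Definition gunit g := theta (lambda g).
Local Notation u := gunit.

Lemma gunitN g : N (u g). Proof. exact: (iso_mem iso (groupvN_lambda reg g)). Qed.
Lemma gunitM g : M (u g). Proof. exact: NM (gunitN g). Qed.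
Lemma gunit_mul g h : u (g * h)%g = u g \o u h.
Proof. by rewrite /gunit (lambdaM reg) (isoM iso)//; exact: (groupvN_lambda reg). Qed.
Lemma gunit_adj g : adj (u g) = u g^-1%g.
Proof. by rewrite /gunit -(iso_adj iso) ?(lambda_adj reg)//; exact: (groupvN_lambda reg). Qed.
Lemma gunit1 : u 1%g = id.
Proof. by rewrite /gunit (lambda1 reg) (iso_id iso). Qed.
Lemma gunit_opbd g : opbd (u g) 1.
Proof.
apply: (star_map_opbd vA (iso_map iso)) => //; first exact: (groupvN_lambda reg).
by move=> v; rewrite (hnorm_lambda reg) mul1r.
Qed.
Lemma gunitV g : u g \o u g^-1%g = id. Proof. by rewrite -gunit_mul mulgV gunit1. Qed.

Local Notation phi := (fun x => complex.Re (tau (theta x))).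

(** Absolute continuity of tau with respect to the canonical trace, whose 2-norm
    is x |-> |x delta_1|.  On each piece f_k of the exhaustion, tau is dominated
    by 2^k times the canonical trace; the cut-off e is the sum of finitely many
    pieces. *)
Lemma trace_absolute_continuity (eps : R) : 0 < eps -> exists (e : op K) (C : R),
  [/\ A e, psd e, psd_le e id, 0 <= C &
  (forall x, A x -> hnorm (hat (theta x \o theta e)) <= C * hnorm (x d1)) /\
  hnorm (hat id - hat (theta e)) <= eps].
Proof.
move=> eps0.
have e2 : 0 < eps ^+ 2 by rewrite exprn_gt0.
have Aid := vN_id vA; have Mid := vN_id vM.
have phiB x y : A x -> A y -> phi (fun v => x v - y v) = phi x - phi y.
  by move=> Ax Ay /=; rewrite (isoB iso)// (trB ft) ?cReB//; exact: thM.
have phi_ge0 x : A x -> psd x -> 0 <= phi x.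
  move=> Ax px; apply: (tr_psd vM ft); first exact: thM.
  exact: (iso_psd vA iso).
have phi_sup (x_ : nat -> op K) x : (forall n, A (x_ n)) -> A x ->
    (forall n, psd (x_ n)) -> (forall n, psd_le (x_ n) (x_ n.+1)) ->
    (forall v, hcvg (x_ ^~ v) (x v)) -> (fun n => phi (x_ n)) @ \oo --> phi x.
  move=> Ax_ Ax px incr lim; apply: (tr_monotone_limit vM ft) => [n||n|n|].
  - exact: thM.
  - exact: thM.
  - exact: (iso_psd vA iso).
  - rewrite /psd_le -(isoB iso)//; apply: (iso_psd vA iso); last exact: incr.
    exact: (vN_sub vA).
  - exact: (iso_monotone_limit vA vN iso).
have psi0 x : A x -> psd x -> rdot (x d1) d1 = 0 -> x = (fun=> 0).
  move=> Ax px h; apply: (groupvN_separating reg) => //.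
  have [r r0 hr] := bounded_bd (vN_bounded vA Ax).
  have := psd_norm_bound d1 (vN_linear vA Ax) px (fun v => rdot_opbd v hr).
  rewrite h mulr0 => h'; apply: hnorm_eq0; apply/eqP.
  by rewrite -sqrf_eq0 eq_le h' sqr_ge0.
have [n [f [hf dom le1 small]]] := dominated_exhaustion vA phiB phi_ge0 phi_sup psi0 e2.
pose e : op K := fun v => \sum_(k < n) f k v.
have Af k : A (f k) by case: (hf k).
have Ae : A e by apply: (vN_sum vA (index_enum 'I_n) (F := fun k : 'I_n => f k)).
have pe : psd e.
  split=> [v w|v]; first by rewrite rdot_suml rdot_sumr; apply: eq_bigr => k _; case: (hf k) => _ [h _].
  by rewrite rdot_suml sumr_ge0// => k _; case: (hf k) => _ [_ h].
pose C k : R := Num.sqrt (2 ^+ k).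
have fbd k x : A x -> hnorm (hat (theta x \o theta (f k))) <= C k * hnorm (x d1).
  move=> Ax; have [Ak pk k1] := hf k; have bx := vN_bounded vA Ax.
  have bk := vN_bounded vA Ak; have lk := vN_linear vA Ak.
  have Aax := vN_adj vA Ax; have Axf := vN_comp vA Ax Ak.
  have kbd : opbd (f k) 1.
    by apply: psd_opbd => // v; rewrite mul1r sqr_hnorm; exact: psd_le_rdot.
  have [b b0 hb] := bounded_bd bx.
  pose z := adj (x \o f k) \o (x \o f k).
  have Az : A z by apply: (vN_comp vA) => //; exact: (vN_adj vA).
  have zrdot v : rdot (z v) v = hnorm (x (f k v)) ^+ 2.
    by rewrite /z /= rdot_adjl ?sqr_hnorm//; exact: bounded_comp.
  have pz : psd z by apply: psd_adjM; exact: bounded_comp.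
  (* y = f x^* x f / b^2 lies below f^2, hence below f. *)
  pose y : op K := fun v => rc (b ^- 2) *: z v.
  have b2 : 0 < b ^+ 2 by rewrite exprn_gt0.
  have Ay : A y by exact: (vN_scale vA _ Az).
  have py : psd y by apply: psd_scale pz; rewrite invr_ge0 ltW.
  have yf : psd_le y (f k).
    apply: psd_le_of_rdot; [exact: py.1 | exact: pk.1 |] => v.
    rewrite rdotZl zrdot ler_pdivrMl//.
    rewrite (@le_trans _ _ ((b * hnorm (f k v)) ^+ 2))//.
      by rewrite ler_pXn2r ?nnegrE ?mulr_ge0 ?hnorm_ge0 ?(ltW b0).
    rewrite exprMn ler_wpM2l ?(ltW b2)// -[leRHS]mul1r; apply: psd_norm_bound => // w.
    by rewrite mul1r sqr_hnorm; exact: psd_le_rdot.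
  have := dom k y Ay py yf.
  rewrite (isoZ vA iso)// (trZ vM ft) ?Re_rcM; last exact: thM.
  rewrite rdotZl mulrCA ler_pM2l ?invr_gt0// zrdot => hz.
  have e1 : hnorm (hat (theta x \o theta (f k))) ^+ 2 = phi z.
    rewrite -(isoM iso)// (sqr_hat hL); last exact: thM.
    by rewrite -(iso_adj iso)// -(isoM iso)//; exact: (vN_adj vA).
  rewrite -(@ler_pXn2r _ 2) ?nnegrE ?hnorm_ge0 ?mulr_ge0 ?hnorm_ge0 ?sqrtr_ge0//.
  rewrite e1 exprMn sqr_sqrtr ?exprn_ge0// (le_trans hz)// ler_wpM2l ?exprn_ge0//.
  rewrite ler_pXn2r ?nnegrE ?hnorm_ge0//.
  have := groupvN_trace_vector reg Axf; rewrite /= => <-.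
  rewrite adj_comp//= (psd_adj bk pk) (le_trans (kbd _))// mul1r.
  by rewrite (groupvN_trace_vector reg).
exists e, (\sum_(k < n) C k); split=> //; first by rewrite sumr_ge0// => k _; exact: sqrtr_ge0.
split=> [x Ax|].
  rewrite /e (iso_sum vA iso _ (F := fun k : 'I_n => f k))//.
  have -> : theta x \o (fun v => \sum_(i < n) theta (f i) v) =
      fun v => \sum_(i < n) (theta x \o theta (f i)) v.
    by apply/funext => v /=; rewrite (lin_sum (vN_linear vM (thM Ax))).
  rewrite (hat_sum vM hL _ (F := fun i : 'I_n => theta x \o theta (f i))); last first.
    by move=> i; apply: (vN_comp vM); exact: thM.
  rewrite (le_trans (hnorm_sum _ _ _))// mulr_suml; apply: ler_sum => i _.
  exact: fbd.
rewrite -(hatB hL) //; last exact: thM.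
have E : theta (fun v => v - e v) = fun v => v - theta e v.
  by rewrite (isoB iso Aid Ae) (iso_id iso).
rewrite -E.
have A1e : A (fun v => v - e v) by exact: (vN_sub vA).
have p1e : psd (fun v => v - e v) := le1.
have := sqr_hat_le_tr vM ft hL (thM A1e) (iso_psd vA iso A1e p1e).
move=> h; rewrite -(@ler_pXn2r _ 2) ?nnegrE ?hnorm_ge0 ?(ltW eps0)//.
apply: le_trans small; apply: h.
have E' : (fun v => v - theta (fun w => w - e w) v) = theta e.
  by rewrite E; apply/funext => v; rewrite opprB addrC subrK.
by rewrite /psd_le E'; exact: (iso_psd vA iso).
Qed.

Lemma tr_comp_hat x c : M x -> M c ->
  complex.Re (tau (x \o c)) = rdot (hat x) (hat (adj c)).
Proof.
move=> Mx Mc; rewrite /rdot (dotp_hat hL Mx (vN_adj vM Mc)).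
by rewrite (adjK (vN_bounded vM Mc)) (trC ft Mc Mx).
Qed.

(** Bessel's inequality: the values at distinct group elements are the
    coefficients of a bounded functional on an orthonormal family, hence square
    summable. *)
Lemma bessel_decay (p : op K -> R) (C : R) (h_ : nat -> G) : injective h_ -> 0 <= C ->
  (forall x y, A x -> A y -> p (fun v => x v + y v) = p x + p y) ->
  (forall r x, A x -> p (fun v => rc r *: x v) = r * p x) ->
  (forall x, A x -> p x <= C * hnorm (x d1)) ->
  (fun n => p (lambda (h_ n))) @ \oo --> (0 : R).
Proof.
move=> hinj C0 pD pZ pC; pose a n := p (lambda (h_ n)).
have p0 : p (fun=> 0) = 0.
  have := pZ 0 _ (vN_0 vA); rewrite mul0r => <-.
  by congr p; apply/funext => v; rewrite scaler0.
have bd n : \sum_(k < n) a k ^+ 2 <= C ^+ 2.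
  pose x : op K := fun v => \sum_(k < n) rc (a k) *: lambda (h_ k) v.
  have Al k : A (fun v => rc (a k) *: lambda (h_ k) v).
    by apply: (vN_scale vA); exact: (groupvN_lambda reg).
  have Ax : A x by exact: (vN_sum vA (index_enum 'I_n) (F := fun k : 'I_n => fun v => rc (a k) *: lambda (h_ k) v)).
  have px : p x = \sum_(k < n) a k ^+ 2.
    have psum (s : seq 'I_n) : p (fun v => \sum_(k <- s) rc (a k) *: lambda (h_ k) v) =
        \sum_(k <- s) a k ^+ 2.
      elim: s => [|k s IH]; first by under eq_fun do rewrite big_nil; rewrite p0 big_nil.
      under eq_fun do rewrite big_cons; rewrite big_cons pD ?IH//; last first.
        exact: (vN_sum vA s (F := fun k : 'I_n => fun v => rc (a k) *: lambda (h_ k) v)).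
      by rewrite pZ ?expr2//; exact: (groupvN_lambda reg).
    exact: psum.
  have nx : hnorm (x d1) ^+ 2 = \sum_(k < n) a k ^+ 2.
    rewrite sqr_hnorm /x rdot_suml; apply: eq_bigr => k _.
    rewrite rdotZl rdot_sumr (bigD1 k)//= big1 ?addr0.
      by rewrite rdotZr !(lambda_delta reg) mulg1 /rdot (reg_orth reg) eqxx mulr1 expr2.
    move=> j jk; rewrite rdotZr !(lambda_delta reg) !mulg1 /rdot (reg_orth reg).
    by rewrite (inj_eq hinj) eq_sym (inj_eq val_inj) (negPf jk) mulr0.
  have := pC x Ax; rewrite px -nx.
  have [->|n0] := eqVneq (hnorm (x d1)) 0; first by rewrite expr0n /= sqr_ge0.
  have np : 0 < hnorm (x d1) by rewrite lt_neqAle eq_sym n0 hnorm_ge0.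
  rewrite {1}expr2 (ler_pM2r np) => h.
  by rewrite ler_pXn2r ?nnegrE ?hnorm_ge0.
have cs : cvgn (series (fun k => a k ^+ 2)).
  apply: nondecreasing_is_cvgn.
    by apply: nondecreasing_series => k _ _; exact: sqr_ge0.
  by exists (C ^+ 2) => _ [n _ <-]; rewrite /series /= big_mkord.
have a2 := cvg_series_cvg_0 cs.
apply/cvgrPdist_lt => e e0; have e2 : 0 < e ^+ 2 by rewrite exprn_gt0.
have /cvgrPdist_lt/(_ _ e2) := a2; apply: filterS => n.
rewrite !sub0r !normrN ger0_norm ?sqr_ge0// -(real_normK (num_real (a n))).
by rewrite ltr_pXn2r ?nnegrE ?normr_ge0 ?(ltW e0).
Qed.

(** The u_h need not be orthogonal for tau.  Inserting the cut-off e changes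
    tau (u_h c) little and makes it a functional of u_h that is bounded for the
    canonical 2-norm. *)
Lemma gunit_decay_Re (h_ : nat -> G) c : injective h_ -> M c ->
  (fun n => complex.Re (tau (u (h_ n) \o c))) @ \oo --> (0 : R).
Proof.
move=> hinj Mc; apply/cvgrPdist_lt => eps eps0.
have Mac := vN_adj vM Mc.
have d0 : 0 < eps / 2 / (hnorm (hat (adj c)) + 1).
  by rewrite !divr_gt0// ltr_wpDl ?hnorm_ge0.
have [e [C [Ae pe e1 C0 [dom small]]]] := trace_absolute_continuity d0.
have ME := thM Ae.
pose p x := rdot (hat (theta x \o theta e)) (hat (adj c)).
have lim : (fun n => p (lambda (h_ n))) @ \oo --> (0 : R).
  apply: (@bessel_decay p (C * hnorm (hat (adj c)))) => //.
  - by rewrite mulr_ge0 ?hnorm_ge0.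
  - move=> x y Ax Ay; rewrite /p (isoD iso)// -rdotDl -(hatD hL)//; exact: (vN_comp vM (thM _) ME).
  - move=> r x Ax; rewrite /p (isoZ vA iso)// -rdotZl -(hatZ vM hL)//; exact: (vN_comp vM (thM _) ME).
  - move=> x Ax; rewrite (le_trans (cauchy_schwarz_rdot _ _))// mulrAC.
    by rewrite ler_wpM2r ?hnorm_ge0// dom.
have e20 : 0 < eps / 2 by rewrite divr_gt0.
have /cvgrPdist_lt/(_ _ e20) := lim; apply: filterS => n; rewrite /= !sub0r !normrN => pn.
have Mu := gunitM (h_ n).
rewrite tr_comp_hat//.
have -> : hat (u (h_ n)) = hat (u (h_ n) \o theta e) + lact L (u (h_ n)) (hat id - hat (theta e)).
  have lu := star_map_lin (lact_map L) Mu.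
  have e2 : lact L (u (h_ n)) (hat id) = hat (u (h_ n)) := lact_hat hL Mu (vN_id vM).
  rewrite (linB lu) e2 (lact_hat hL Mu ME).
  by rewrite addrC subrK.
rewrite rdotDl (le_lt_trans (ler_normD _ _))// (splitr eps) ltr_leD//.
rewrite (le_trans (abs_rdot _ _))//.
have := star_map_opbd vM (lact_map L) Mu ler01 (gunit_opbd (h_ n)) (hat id - hat (theta e)).
rewrite mul1r => h1.
rewrite (@le_trans _ _ (eps / 2 / (hnorm (hat (adj c)) + 1) * hnorm (hat (adj c))))//.
  by rewrite ler_wpM2r ?hnorm_ge0// (le_trans h1).
rewrite mulrAC ler_pdivrMr ?ltr_wpDl ?hnorm_ge0//.
by rewrite ler_wpM2l ?(ltW e20)// lerDl.
Qed.

Lemma gunit_decay (h_ : nat -> G) c : injective h_ -> M c ->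
  (fun n => modulus (tau (u (h_ n) \o c))) @ \oo --> (0 : R).
Proof.
move=> hinj Mc; have Mic := vN_scale vM (- 'i%C) Mc.
have h1 := gunit_decay_Re hinj Mc; have h2 := gunit_decay_Re hinj Mic.
have e n : complex.Re (tau (u (h_ n) \o (fun v => - 'i%C *: c v))) = complex.Im (tau (u (h_ n) \o c)).
  have Mu := gunitM (h_ n).
  have -> : u (h_ n) \o (fun v => - 'i%C *: c v) = fun v => - 'i%C *: (u (h_ n) \o c) v.
    by apply/funext => v /=; rewrite (linZ (vN_linear vM Mu)).
  rewrite (trZ vM ft); last exact: (vN_comp vM).
  by case: (tau _) => a b /=; simpc.
apply: (@squeeze_cvgr _ _ _ _ (cst 0) (fun n => `|complex.Re (tau (u (h_ n) \o c))| +
   `|complex.Im (tau (u (h_ n) \o c))|)).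
- by near=> n; rewrite modulus_ge0 modulus_le_ReIm.
- exact: cvg_cst.
- have h2' : (fun n => complex.Im (tau (u (h_ n) \o c))) @ \oo --> (0 : R).
    by under eq_fun do rewrite -e.
  have n1 := cvg_norm h1; have n2 := cvg_norm h2'; rewrite !normr0 in n1 n2.
  by rewrite -(addr0 0); exact: cvgD (n1 _) (n2 _).
Unshelve. all: by end_near. Qed.

Section UniformlyCloseAutomorphism.
Context (f : op H -> op H) (af : trace_aut M tau f).

Let fM x : M x -> M (f x). Proof. by case: af => -[_ [h _ _]] _; exact: h. Qed.
Let f_hom : star_hom M f. Proof. by case: af => -[]. Qed.
Let f_map : star_map M f. Proof. by left; exact: f_hom. Qed.
Lemma hat_aut x : M x -> hnorm (hat (f x)) = hnorm (hat x).
Proof.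
move=> Mx; have Max := vN_adj vM Mx.
apply/eqP; rewrite -(@eqrXn2 _ 2) ?hnorm_ge0// !(sqr_hat hL)//; last exact: fM.
rewrite -(star_map_adj f_map Mx); case: f_hom => _ <-//.
by case: af => _ ->//; exact: vN_comp.
Qed.

Let Pl (x : op K) : op L := lact L (f (theta x)).
Let Pr (x : op K) : op L := ract L (theta x).
Let f_theta_hom : star_hom A (fun x => f (theta x)).
Proof. by apply: star_hom_comp f_hom => //; case: iso. Qed.
Let Pl_hom : star_hom A Pl.
Proof. by apply: (star_hom_comp f_theta_hom) (lact_hom L) => x /thM /fM. Qed.
Let Pr_anti : star_antihom A Pr.
Proof. by apply: star_antihom_comp (ract_antihom L) => //; case: iso. Qed.
Let Pl_map : star_map A Pl. Proof. by left. Qed.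
Let Pr_map : star_map A Pr. Proof. by right. Qed.
Let PlPr x y v : A x -> A y -> Pl x (Pr y v) = Pr y (Pl x v).
Proof. by move=> Ax Ay; rewrite /Pl /Pr lract//; [exact/fM/thM | exact: thM]. Qed.
Let PlM x y v : A x -> A y -> Pl (x \o y) v = Pl x (Pl y v).
Proof. by move=> Ax Ay; case: Pl_hom => _ ->. Qed.
Let PrM x y v : A x -> A y -> Pr (x \o y) v = Pr y (Pr x v).
Proof. by move=> Ax Ay; case: Pr_anti => _ ->. Qed.
Let fT (x : op K) : op H := f (theta x).
Let fTM x : A x -> M (fT x). Proof. by move/thM/fM. Qed.

(** An intertwining relation that holds for the group unitaries extends to
    the whole group algebra: between two cut-offs e, both sides are continuous
    for the canonical 2-norm, for which the group ring is dense. *)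
Lemma intertwiner_extends (l : L) :
  (forall g, Pl (lambda g) l = Pr (lambda g) l) -> forall x, A x -> Pl x l = Pr x l.
Proof.
move=> hl x Ax; apply/eqP; rewrite -subr_eq0; apply/eqP.
pose w := Pl x l - Pr x l; rewrite -/w.
apply: (dense_rdot_eq0 (hat_dense hL)) => _ [b Mb <-].
have [c c0 hc] := bounded_bd (vN_bounded vM Mb).
pose comb_op (s : seq (R[i] * G)) : op K := fun v => \sum_(p <- s) p.1 *: lambda p.2 v.
have Alp (p : R[i] * G) : A (fun v => p.1 *: lambda p.2 v).
  by apply: (vN_scale vA); exact: (groupvN_lambda reg).
have Acomb s : A (comb_op s).
  exact: (vN_sum vA s (F := fun p : R[i] * G => fun v => p.1 *: lambda p.2 v)).
have comb_eq s : Pl (comb_op s) l = Pr (comb_op s) l.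
  rewrite /comb_op (star_map_sum vA Pl_map s (F := fun p => fun v => p.1 *: lambda p.2 v))//.
  rewrite (star_map_sum vA Pr_map s (F := fun p => fun v => p.1 *: lambda p.2 v))//.
  apply: eq_bigr => p _; have Al := groupvN_lambda reg p.2.
  by rewrite (star_mapZ vA Pl_map)// (star_mapZ vA Pr_map)// hl.
(* With a cut-off e on both sides the defect vanishes exactly. *)
have cut e C : A e -> psd e -> psd_le e id -> 0 <= C ->
    (forall y, A y -> hnorm (hat (theta y \o theta e)) <= C * hnorm (y d1)) ->
    rdot w (hat (fT e \o b \o theta e)) = 0.
  move=> Ae pe e1 C0 dom.
  have be := vN_bounded vA Ae; have ae := psd_adj be pe.
  have ebd : opbd e 1.
    apply: psd_opbd => //; first exact: (vN_linear vA Ae).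
    by move=> v; rewrite mul1r sqr_hnorm; exact: psd_le_rdot.
  pose D y := rdot (Pl (e \o y) (Pr e l)) (hat b) - rdot (Pl e (Pr (y \o e) l)) (hat b).
  have D1 y : A y -> rdot (Pl (e \o y) (Pr e l)) (hat b) =
      rdot (Pl e (Pr e (Pl y l))) (hat b).
    by move=> Ay; rewrite PlM// PlPr.
  have D2 y : A y -> rdot (Pl e (Pr (y \o e) l)) (hat b) =
      rdot (Pl e (Pr e (Pr y l))) (hat b).
    by move=> Ay; rewrite PrM.
  have lPl := star_map_lin Pl_map Ae; have lPr := star_map_lin Pr_map Ae.
  have Dw y : A y -> D y = rdot (Pl y l - Pr y l) (hat (fT e \o b \o theta e)).
    move=> Ay; rewrite /D D1// D2// -rdotBl -(linB lPl) -(linB lPr).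
    rewrite (rdot_adj (star_map_bounded Pl_map Ae)) -(star_map_adj Pl_map Ae) ae.
    rewrite (rdot_adj (star_map_bounded Pr_map Ae)) -(star_map_adj Pr_map Ae) ae.
    congr (rdot _ _); rewrite /Pl (lact_hat hL (fTM Ae) Mb).
    by rewrite /Pr (ract_hat hL (thM Ae))//; exact: (vN_comp vM (fTM Ae) Mb).
  have bdD y : A y -> `|D y| <= (2 * hnorm l * c * C) * hnorm (y d1).
    move=> Ay; have Aay := vN_adj vA Ay.
    have Aey := vN_comp vA Ae Ay; have Aye := vN_comp vA Ay Ae.
    have by_ := vN_bounded vA Ay.
    have nae v : hnorm (Pl e v) <= hnorm v.
      by rewrite -[leRHS]mul1r; exact: (star_map_opbd vA Pl_map Ae ler01 ebd).
    have nar v : hnorm (Pr e v) <= hnorm v.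
      by rewrite -[leRHS]mul1r; exact: (star_map_opbd vA Pr_map Ae ler01 ebd).
    have k1 : `|rdot (Pl (e \o y) (Pr e l)) (hat b)| <= hnorm l * c * C * hnorm (y d1).
      rewrite (rdot_adj (star_map_bounded Pl_map Aey)) -(star_map_adj Pl_map Aey).
      rewrite (adj_comp be by_) ae (le_trans (abs_rdot _ _))// -!mulrA.
      rewrite ler_pM ?hnorm_ge0//.
      have Aye' := vN_comp vA Aay Ae.
      rewrite /Pl (lact_hat hL (fTM Aye') Mb) (le_trans (hat_mulr vM hL (fTM Aye') Mb (ltW c0) hc))//.
      rewrite ler_wpM2l ?(ltW c0)// (hat_aut (thM Aye')) (isoM iso Aay Ae).
      by rewrite -(groupvN_trace_vector reg Ay) dom.
    have k2 : `|rdot (Pl e (Pr (y \o e) l)) (hat b)| <= hnorm l * c * C * hnorm (y d1).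
      rewrite (PlPr _ Ae Aye).
      rewrite (rdot_adj (star_map_bounded Pr_map Aye)) -(star_map_adj Pr_map Aye).
      rewrite (le_trans (abs_rdot _ _))// -!mulrA ler_pM ?hnorm_ge0//.
      have Aa := vN_adj vA Aye.
      rewrite /Pr (ract_hat hL (thM Aa) Mb) (le_trans (hat_mull vM hL Mb (thM Aa) (ltW c0) hc))//.
      rewrite ler_wpM2l ?(ltW c0)// (iso_adj iso Aye) (hat_adj vM ft hL (thM Aye)).
      by rewrite (isoM iso Ay Ae) dom.
    rewrite (le_trans (ler_normB _ _))// (le_trans (lerD k1 k2))//.
    by rewrite le_eqVlt; apply/orP; left; apply/eqP; ring.
  rewrite -Dw//; apply/eqP; rewrite -normr_eq0 eq_le normr_ge0 andbT.
  apply/ler_addgt0Pr => eps eps0; rewrite add0r.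
  set Q := 2 * hnorm l * c * C in bdD.
  have Q0 : 0 <= Q by rewrite /Q !mulr_ge0 ?hnorm_ge0// ltW.
  have Q1 : 0 < Q + 1 by rewrite ltr_wpDl.
  have [_ [s ->] hs] := dense_approx (x d1) (reg_spans reg) (divr_gt0 eps0 Q1).
  have -> : D x = D (fun v => x v - comb_op s v).
    rewrite !Dw//; last exact: (vN_sub vA Ax (Acomb s)).
    rewrite (star_mapB Pl_map _ Ax (Acomb s)) (star_mapB Pr_map _ Ax (Acomb s)).
    by rewrite comb_eq opprB addrA subrK.
  rewrite (le_trans (bdD _ (vN_sub vA Ax (Acomb s))))//.
  have -> : comb_op s d1 = comb delta s.
    by apply: eq_bigr => p _; rewrite (lambda_delta reg) mulg1.
  rewrite (@le_trans _ _ ((Q + 1) * (eps / (Q + 1))))//.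
    by rewrite ler_pM ?hnorm_ge0 ?(ltW hs)// lerDl.
  by rewrite mulrC divfK// gt_eqF.
apply/eqP; rewrite -normr_eq0 eq_le normr_ge0 andbT.
apply/ler_addgt0Pr => eps eps0; rewrite add0r.
have d0 : 0 < eps / (2 * c * (hnorm w + 1)).
  by rewrite divr_gt0// !mulr_gt0// ltr_wpDl ?hnorm_ge0.
have [e [C [Ae pe e1 C0 [dom small]]]] := trace_absolute_continuity d0.
have h0 := cut e C Ae pe e1 C0 dom.
have Mid := vN_id vM; have Me := thM Ae; have Mfe := fTM Ae.
have tbd : opbd (theta e) 1.
  apply: (star_map_opbd vA (iso_map iso)) => //.
  apply: psd_opbd => //; first exact: (vN_linear vA Ae).
  by move=> v; rewrite mul1r sqr_hnorm; exact: psd_le_rdot.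
have Mbe := vN_comp vM Mb Me; have Mfbe := vN_comp vM (vN_comp vM Mfe Mb) Me.
have -> : rdot w (hat b) = rdot w (hat b - hat (fT e \o b \o theta e)).
  by rewrite rdotBr h0 subr0.
rewrite (le_trans (abs_rdot _ _))//.
have small' : hnorm (hat (fun v => v - theta e v)) <= eps / (2 * c * (hnorm w + 1)).
  by rewrite (hatB hL Mid Me).
have Mie := vN_sub vM Mid Me.
have s1 : hnorm (hat b - hat (b \o theta e)) <= c * (eps / (2 * c * (hnorm w + 1))).
  rewrite -(hatB hL Mb Mbe).
  have -> : (fun v => b v - (b \o theta e) v) = b \o (fun v => v - theta e v).
    by apply/funext => v /=; rewrite (linB (vN_linear vM Mb)).
  rewrite (le_trans (hat_mull vM hL Mb Mie (ltW c0) hc))//.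
  by rewrite ler_wpM2l ?(ltW c0).
have s2 : hnorm (hat (b \o theta e) - hat (fT e \o b \o theta e)) <=
    c * (eps / (2 * c * (hnorm w + 1))).
  rewrite -(hatB hL Mbe Mfbe).
  have fid : f id = id := star_map_id f_map.
  have e_f : f (fun v => v - theta e v) = fun v => v - fT e v.
    by apply/funext => v; rewrite (star_mapB f_map v Mid Me) fid.
  have -> : (fun v => (b \o theta e) v - (fT e \o b \o theta e) v) =
      f (fun v => v - theta e v) \o (b \o theta e) by rewrite e_f.
  have cbd : opbd (b \o theta e) c.
    by move=> v /=; rewrite (le_trans (hc _))// ler_wpM2l ?(ltW c0)// -[leRHS]mul1r.
  rewrite (le_trans (hat_mulr vM hL (fM Mie) Mbe (ltW c0) cbd))//.
  by rewrite ler_wpM2l ?(ltW c0)// hat_aut.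
have s3 : hnorm (hat b - hat (fT e \o b \o theta e)) <= eps / (hnorm w + 1).
  rewrite (le_trans (hnorm_tri (hat (b \o theta e)) _ _))// (le_trans (lerD s1 s2))//.
  rewrite le_eqVlt; apply/orP; left; apply/eqP; field.
  by rewrite !gt_eqF// ltr_wpDl ?hnorm_ge0.
rewrite (@le_trans _ _ ((hnorm w + 1) * (eps / (hnorm w + 1))))//.
  by rewrite ler_pM ?hnorm_ge0// lerDl.
by rewrite mulrC divfK// gt_eqF// ltr_wpDl ?hnorm_ge0.
Qed.

(** If f moves every group unitary by at most r in 2-norm, the vector of least
    norm in the closed convex hull of the f(u_g) u_g^* intertwines f and the
    identity, and it is r-close to 1; so f moves the unit ball by at most 2 r. *)
Lemma close_on_group_close_on_ball (r : R) :
  (forall g, hnorm (hat (f (u g)) - hat (u g)) <= r) ->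
  forall x, A x -> opbd (theta x) 1 -> hnorm (hat (f (theta x)) - hat (theta x)) <= 2 * r.
Proof.
move=> hr; have Mid := vN_id vM.
have Mfu g : M (f (u g)) by exact/fM/gunitM.
pose pt g : L := Pl (lambda g) (Pr (lambda g^-1%g) (hat id)).
have ptE g : pt g = Pr (lambda g^-1%g) (hat (f (u g))).
  rewrite /pt PlPr; [|exact: (groupvN_lambda reg)..].
  by congr (Pr _ _); exact: (lact_hat hL (Mfu g) Mid).
have nPr g v : hnorm (Pr (lambda g) v) <= hnorm v.
  rewrite -[leRHS]mul1r; apply: (star_map_opbd vA Pr_map) => //.
    exact: (groupvN_lambda reg).
  by move=> w; rewrite (hnorm_lambda reg) mul1r.
have nPl g v : hnorm (Pl (lambda g) v) <= hnorm v.
  rewrite -[leRHS]mul1r; apply: (star_map_opbd vA Pl_map) => //.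
    exact: (groupvN_lambda reg).
  by move=> w; rewrite (hnorm_lambda reg) mul1r.
have lPr g := star_map_lin Pr_map (groupvN_lambda reg g).
have lPl g := star_map_lin Pl_map (groupvN_lambda reg g).
have pt_close g : hnorm (pt g - hat id) <= r.
  have -> : hat id = Pr (lambda g^-1%g) (hat (u g)).
    by rewrite /Pr (ract_hat hL (gunitM _) (gunitM _)) -/(u g^-1%g) gunitV.
  by rewrite ptE -(linB (lPr _)) (le_trans (nPr _ _)).
(* The convex hull of the vectors f(u_g) u_g^*, invariant under act below. *)
pose C : set L := [set z | exists s : seq (R * G),
  [/\ all (fun p => 0 <= p.1) s, \sum_(p <- s) p.1 = 1 &
      z = \sum_(p <- s) rc p.1 *: pt p.2]].
have Cmid x y : C x -> C y -> C (rc 2^-1 *: (x + y)).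
  move=> [s [s0 s1 ->]] [t [t0 t1 ->]].
  exists [seq (2^-1 * p.1, p.2) | p <- s ++ t]; split.
  - rewrite all_map all_cat; apply/andP; split.
      by apply: sub_all s0 => p /= p0; rewrite mulr_ge0 ?invr_ge0.
    by apply: sub_all t0 => p /= p0; rewrite mulr_ge0 ?invr_ge0.
  - by rewrite big_map -mulr_sumr big_cat /= s1 t1; field.
  - rewrite big_map big_cat scalerDr !scaler_sumr /=.
    by congr (_ + _); apply: eq_bigr => p _; rewrite rcM scalerA.
have C0 : C !=set0.
  by exists (pt 1%g), [:: (1, 1%g)]; rewrite /= ler01 !big_seq1 rc1 scale1r.
have Cclose z : C z -> hnorm (z - hat id) <= r.
  move=> [s [s0 s1 ->]].
  have -> : \sum_(p <- s) rc p.1 *: pt p.2 - hat id =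
      \sum_(p <- s) rc p.1 *: (pt p.2 - hat id).
    under [RHS]eq_bigr do rewrite scalerBr.
    rewrite sumrB -scaler_suml; congr (_ - _).
    have -> : \sum_(p <- s) rc p.1 = rc (\sum_(p <- s) p.1).
      by elim/big_rec2: _ => // p a b _ ->; rewrite rcD.
    by rewrite s1 rc1 scale1r.
  rewrite (le_trans (hnorm_sum _ _ _))// -(mul1r r) -s1 mulr_suml.
  rewrite big_seq [leRHS]big_seq; apply: ler_sum => p ps.
  have p0 : 0 <= p.1 by move/allP: s0 => /(_ p ps).
  by rewrite hnormZr (ger0_norm p0) ler_wpM2l.
have [||||m [v [l [Cv hm hv hl]]]] := @minimizing_sequence _ L C (fun=> 0) _ _ 0.
- exact: Cmid.
- by move=> x y; rewrite addr0 mulr0.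
- exact: C0.
- by move=> z _; rewrite mulr0 subr0 sqr_ge0.
pose act g z := Pl (lambda g) (Pr (lambda g^-1%g) z).
have act_pt g h : act g (pt h) = pt (g * h)%g.
  have Ag := groupvN_lambda reg.
  rewrite /act /pt -PlPr// -PlM// -PrM// -(lambdaM reg) -(lambdaM reg).
  by rewrite invgM.
have lact_ g : linear (act g).
  by move=> a x y; rewrite /act (lPr g^-1%g) (lPl g).
have Cact g z : C z -> C (act g z).
  move=> [s [s0 s1 ->]]; exists [seq (p.1, (g * p.2)%g) | p <- s]; split.
  - by rewrite all_map.
  - by rewrite big_map.
  - rewrite big_map (lin_sum (lact_ g)); apply: eq_bigr => p _.
    by rewrite (linZ (lact_ g)) act_pt.
have nact g z : hnorm (act g z) <= hnorm z.
  by rewrite /act (le_trans (nPl _ _)).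
(* Both v n and act g (v n) nearly minimise the norm on C, so they are close. *)
have fix_l g : act g l = l.
  apply: (@hcvg_unique _ _ (fun n => act g (v n))).
    have bact : bounded_op (act g).
      by apply: (@bounded_op_bd _ _ _ _ 1) => // z; rewrite mul1r.
    exact: hcvg_op.
  apply: (@hcvg_le _ _ _ _ (fun n => Num.sqrt (4 * n.+1%:R^-1) + hnorm (v n - l))).
    move=> n; rewrite (le_trans (hnorm_tri (v n) _ _))// lerD2r.
    rewrite -(@ler_pXn2r _ 2) ?nnegrE ?hnorm_ge0 ?sqrtr_ge0//.
    rewrite sqr_sqrtr; last by rewrite mulr_ge0 ?invr_ge0.
    have := near_minimum_close Cmid (f := fun=> 0) _ hm (Cact g _ (Cv n)) (Cv n).
    rewrite addr0 mulr0 => /(_ (fun _ _ => erefl)).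
    have := hv n; have : hnorm (act g (v n)) ^+ 2 <= hnorm (v n) ^+ 2.
      by rewrite ler_pXn2r ?nnegrE ?hnorm_ge0.
    rewrite !mulr0 !subr0.
    by move: (n.+1%:R^-1) (hnorm (act g (v n)) ^+ 2) (hnorm (v n) ^+ 2) (hnorm (act g (v n) - v n) ^+ 2) => *; lra.
  rewrite -(addr0 0); apply: cvgD; last exact: hl.
  have : (fun n => 4 * n.+1%:R^-1) @ \oo --> (4 * 0 : R).
    by apply: cvgM; [exact: cvg_cst | exact: cvg_harmonic].
  rewrite mulr0 => lim; rewrite -(@sqrtr0 R).
  by apply: (cvg_comp _ _ lim); exact: sqrt_continuous.
have close_l : hnorm (l - hat id) <= r.
  apply: (@lim_le_cst _ (fun n => hnorm (v n - hat id))).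
    by move=> n; exact: Cclose.
  apply: hcvg_hnorm; apply: (@hcvg_le _ _ _ _ (fun n => hnorm (v n - l))) => // n.
  by rewrite opprB addrA subrK.
have inter g : Pl (lambda g) l = Pr (lambda g) l.
  have Ag := groupvN_lambda reg.
  rewrite -{2}(fix_l g) /act PlPr// -PrM// -(lambdaM reg) mulVg (lambda1 reg).
  by rewrite (star_map_id Pr_map).
move=> x Ax xbd; have E := intertwiner_extends inter Ax.
have e1 : hat (fT x) = Pl x (hat id) by rewrite /Pl (lact_hat hL (fTM Ax) Mid).
have e2 : hat (theta x) = Pr x (hat id) by rewrite /Pr (ract_hat hL (thM Ax) Mid).
have b1 v' : hnorm (Pl x v') <= 1 * hnorm v'.
  apply: (star_map_opbd vM (lact_map L) (fTM Ax) ler01) v'.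
  exact: (star_map_opbd vM f_map (thM Ax) ler01 xbd).
have b2 v' : hnorm (Pr x v') <= 1 * hnorm v'.
  exact: (star_map_opbd vM (ract_map L) (thM Ax) ler01 xbd).
rewrite -/(fT x) e1 e2 (le_trans (hnorm_tri (Pl x l) _ _))// mulr_natl mulr2n lerD//.
  rewrite -(linB (star_map_lin Pl_map Ax)) (le_trans (b1 _))// mul1r.
  by rewrite hnorm_distC.
by rewrite E -(linB (star_map_lin Pr_map Ax)) (le_trans (b2 _))// mul1r.
Qed.

End UniformlyCloseAutomorphism.
End GroupSubalgebra.

(** * Amenability and the spectral gap *)

Section UltraLimits.
Context (R : realType) (T : Type) (U : set_system T) (uU : UltraFilter U).

Lemma ultralimit_exists (f : T -> R) (c : R) : (forall v, `|f v| <= c) ->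
  exists l : R, forall e : R, 0 < e -> U [set v | `|f v - l| < e].
Proof.
have pU := @ultra_proper _ _ uU.
move=> hf; pose S := [set r : R | U [set v | r <= f v]].
have c0 v : - c <= f v <= c by rewrite -ler_norml.
have hS : has_sup S.
  split; first by exists (- c); apply: filterS filterT => v _ /=; case/andP: (c0 v).
  exists c => r /= Ur; have [v /= hv] := @filter_ex _ U pU _ Ur.
  by rewrite (le_trans hv)//; case/andP: (c0 v).
exists (sup S) => e e0.
have [r Sr hr] := sup_adherent e0 hS.
have e2 : 0 < e / 2 by rewrite divr_gt0.
have nS : ~ S (sup S + e / 2).
  move=> /(ub_le_sup hS.2); rewrite gerDl => h; by move: (lt_le_trans e2 h); rewrite ltxx.
have [//|U2] := @in_ultra_setVsetC _ _ [set v | sup S + e / 2 <= f v] uU.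
apply: filterS2 (Sr : U [set v | r <= f v]) U2 => v /= h1 /negP; rewrite -ltNge => h2.
by rewrite ltr_norml; apply/andP; split; move: h1 h2 hr e2; move: (sup S) (f v) => *; lra.
Qed.
End UltraLimits.

Section NonAmenable.
Context (R : realType) (G : groupType) (K : hilbert R) (delta : G -> K).
Context (lambda : G -> op K) (reg : is_left_regular delta lambda).

(** The squared mass that v puts on E is <P_E v, v>, for the coordinate
    projection P_E; an ultralimit over almost invariant v is an invariant mean. *)
Lemma almost_invariant_amenable :
  (forall (F : seq G) (e : R), 0 < e ->
    exists v : K, hnorm v = 1 /\ (forall g, g \in F -> hnorm (lambda g v - v) < e)) ->
  amenable_group R G.
Proof.
move=> hv.
have [P hP] := choice (coordinate_projection (reg_orth reg) (reg_spans reg)).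
have bP E : bounded_op (P E) by case: (hP E).
have dP E g : P E (delta g) = if g \in E then delta g else 0 by case: (hP E).
pose eqb := @basis_eq _ _ _ _ (reg_spans reg).
have adjPE E : adj (P E) = P E.
  apply: eqb => // [|g]; first exact: bounded_adj.
  apply: (basis_inj (reg_spans reg)) => k; rewrite adjPl// !dP.
  case: ifP => kE; case: ifP => gE; rewrite ?dotp0l ?dotp0r// (reg_orth reg).
    by case: eqVneq => // gk; rewrite gk kE in gE.
  by case: eqVneq => // gk; rewrite gk kE in gE.
have PP E v : P E (P E v) = P E v.
  suff /(congr1 (@^~ v)) : P E \o P E = P E by [].
  apply: eqb => // [|g /=]; first exact: bounded_comp.
  by rewrite dP; case: ifP => gE; rewrite ?dP ?gE// (lin0 (bounded_linear (bP E))).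
pose mu (E : set G) v := rdot (P E v) v.
have mu_sqr E v : mu E v = hnorm (P E v) ^+ 2.
  by rewrite sqr_hnorm (rdot_adj (bP E)) adjPE PP rdotC.
have mu_T v : mu setT v = hnorm v ^+ 2.
  rewrite /mu sqr_hnorm; congr rdot; suff -> : P setT = id by [].
  by apply: eqb => // [|g]; [exact: bounded_id | rewrite dP in_setT].
have mu_U E E' v : E `&` E' = set0 -> mu (E `|` E') v = mu E v + mu E' v.
  move=> dis; rewrite /mu -rdotDl; congr rdot.
  suff -> : P (E `|` E') = fun v => 1 *: P E v + P E' v by rewrite scale1r.
  apply: eqb => // [|g]; first exact: bounded_lin.
  rewrite !dP scale1r in_setU; case: (boolP (g \in E)) => gE /=.
    case: (boolP (g \in E')) => gE'; last by rewrite addr0.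
    have : (E `&` E') g by split; rewrite -inE.
    by rewrite dis.
  by rewrite add0r.
have mu_bd E v : 0 <= mu E v <= hnorm v ^+ 2.
  rewrite mu_sqr sqr_ge0 ler_pXn2r ?nnegrE ?hnorm_ge0//.
  by have [_ h _] := hP E; have := h v; rewrite mul1r.
have mu_translate E g v : mu [set (g * x)%g | x in E] v = mu E (lambda g^-1%g v).
  rewrite /mu -(rdot_lambda reg g); congr rdot.
  suff /(congr1 (@^~ v)) : P [set (g * x)%g | x in E] = lambda g \o P E \o lambda g^-1%g by [].
  have bl := lambda_bounded reg.
  apply: eqb => // [|h /=]; first by apply: bounded_comp => //; exact: bounded_comp.
  rewrite (lambda_delta reg) !dP.
  have -> : (h \in [set (g * x)%g | x in E]) = ((g^-1 * h)%g \in E).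
    apply/idP/idP; rewrite !inE; first by move=> [x Ex <-]; rewrite mulKg.
    by move=> Eh; exists (g^-1 * h)%g => //; rewrite mulVKg.
  case: ifP => _; first by rewrite (lambda_delta reg) mulVKg.
  by rewrite (lin0 (bounded_linear (bl g))).
pose B (Fe : seq G * R) : set K :=
  [set v | hnorm v = 1 /\ (forall g, g \in Fe.1 -> hnorm (lambda g v - v) < Fe.2)].
(* The unit vectors that are (F, e)-invariant form a filter base. *)
pose FF : set_system K := [set Q | exists Fe : seq G * R, 0 < Fe.2 /\ B Fe `<=` Q].
have pFF : ProperFilter FF.
  apply: Build_ProperFilter.
    by move=> [[F e] /= [e0 h]]; have [v Bv] := hv F e e0; exact: (h v Bv).
  split; first by exists ([::], 1); split=> //=.
    move=> Q Q' [[F e] /= [e0 h]] [[F' e'] /= [e0' h']].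
    exists (F ++ F', Num.min e e'); split; first by rewrite /= lt_min e0.
    move=> v [v1 vF]; split; [apply: h | apply: h']; split=> //= g gF.
      by have := vF g; rewrite /= mem_cat gF lt_min => /(_ isT)/andP[].
    by have := vF g; rewrite /= mem_cat gF orbT lt_min => /(_ isT)/andP[].
  by move=> Q Q' QQ' [Fe [e0 h]]; exists Fe; split=> //; exact: subset_trans QQ'.
have [U [uU FU]] := ultraFilterLemma pFF.
have pU := @ultra_proper _ _ uU.
have U1 : U [set v | hnorm v = 1].
  by apply: FU; exists ([::], 1); split=> // v [].
pose phi E v := Num.min (mu E v) 1.
have phib E v : `|phi E v| <= 1.
  have /andP[h0 _] := mu_bd E v.
  have p0 : 0 <= phi E v by rewrite /phi le_min h0 ler01.
  by rewrite (ger0_norm p0) /phi ge_min lexx orbT.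
have lim E : exists l : R, forall e : R, 0 < e -> U [set v | hnorm v = 1 /\ `|mu E v - l| < e].
  have [l hl] := ultralimit_exists uU (phib E); exists l => e e0.
  apply: filterS2 U1 (hl e e0) => v /= v1 h; split=> //.
  have /andP[_ h1] := mu_bd E v; rewrite v1 expr1n in h1.
  by move: h; rewrite /phi; move/min_idPl: h1 => ->.
have [m hm] := choice lim.
have close (a b : R) : (forall e : R, 0 < e -> `|a - b| <= e) -> a = b.
  move=> h; apply/eqP; rewrite -subr_eq0 -normr_eq0 eq_le normr_ge0 andbT.
  by apply/ler_addgt0Pr => e e0; rewrite add0r h.
exists m; split; [split|] => [E||E E' dis|g E].
- apply/ler_addgt0Pr => e e0; have [v [_ /= h]] := filter_ex (hm E e e0).
  have /andP[h0 _] := mu_bd E v; move: h; rewrite ltr_norml => /andP[_ h]; move: h h0; lra.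
- apply: close => e e0; have [v [v1 /= h]] := filter_ex (hm setT e e0).
  by rewrite distrC; move: h; rewrite mu_T v1 expr1n => /ltW.
- apply: close => e e0; have e3 : 0 < e / 3 by rewrite divr_gt0.
  have [v [[_ h1] [[_ h2] [_ h3]]]] := filter_ex (filterI (hm (E `|` E') _ e3)
    (filterI (hm E _ e3) (hm E' _ e3))).
  rewrite mu_U// in h1; move: h1 h2 h3; rewrite ler_norml !ltr_norml.
  move: (m _) (m E) (m E') (mu E v) (mu E' v) => a b c d f.
  by move=> /andP[? ?] /andP[? ?] /andP[? ?]; apply/andP; split; lra.
- apply: close => e e0; have e4 : 0 < e / 4 by rewrite divr_gt0.
  have UB : U (B ([:: g^-1%g], e / 4)) by apply: FU; exists ([:: g^-1%g], e / 4); split.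
  have [v [[v1 hg] [[_ h1] [_ h2]]]] := filter_ex (filterI UB
     (filterI (hm [set (g * x)%g | x in E] _ e4) (hm E _ e4))).
  have hd : `|mu [set (g * x)%g | x in E] v - mu E v| <= e / 2.
    rewrite mu_translate; set w := lambda g^-1%g v.
    have w1 : hnorm w = 1 by rewrite /w (hnorm_lambda reg).
    have -> : mu E w - mu E v = rdot (P E (w - v)) w + rdot (P E v) (w - v).
      rewrite (linB (bounded_linear (bP E))) rdotBl rdotBr /mu; ring.
    have wv : hnorm (w - v) <= e / 4 by apply/ltW/hg; rewrite inE.
    have nP x : hnorm (P E x) <= hnorm x.
      by have [_ h _] := hP E; have := h x; rewrite mul1r.
    rewrite (le_trans (ler_normD _ _))//.
    rewrite (_ : e / 2 = e / 4 + e / 4); last by field.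
    apply: lerD; rewrite (le_trans (abs_rdot _ _))//.
      by rewrite w1 mulr1 (le_trans (nP _)).
    rewrite (@le_trans _ _ (1 * (e / 4)))//; last by rewrite mul1r.
    by rewrite ler_pM ?hnorm_ge0// -v1.
  move: h1 h2 hd; rewrite !ler_norml !ltr_norml.
  move: (m _) (m E) (mu E v) (mu _ v) => a b c d.
  by move=> /andP[? ?] /andP[? ?] /andP[? ?]; apply/andP; split; lra.
Qed.

(** Kesten's criterion, in the direction needed here.  If the averages over all
    finite F have norm 1, a near-extremal unit vector is almost invariant because
    the variance of the vectors lambda_g v, g in F, about their mean is
    1 - |mean|^2. *)
Lemma nonamenable_gap : ~ amenable_group R G -> exists (F : seq G) (rho : R),
  [/\ (0 < size F)%N, 0 < rho, rho < 1 &
   forall v, hnorm (\sum_(g <- F) lambda g v) <= rho * (size F)%:R * hnorm v].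
Proof.
move=> na; apply: contrapT => ngap; apply: na; apply: almost_invariant_amenable.
move=> F0 e e0; pose F := 1%g :: F0; pose N : R := (size F)%:R.
have N1 : 1 <= N by rewrite ler1n.
have N0 : 0 < N by rewrite (lt_le_trans ltr01).
(* A vector within eta of extremal makes the variance at most 2 eta, and
   N * (2 eta) is a bound for each square of a distance to the mean. *)
pose eta := Num.min 2^-1 (e ^+ 2 / (16 * N)).
have eta0 : 0 < eta by rewrite lt_min invr_gt0 ltr0n /= divr_gt0 ?exprn_gt0 ?mulr_gt0.
have eta2 : eta <= 2^-1 by rewrite ge_min lexx.
have etae : eta <= e ^+ 2 / (16 * N) by rewrite ge_min lexx orbT.
have [v hv] : exists v, (1 - eta) * N * hnorm v < hnorm (\sum_(g <- F) lambda g v).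
  apply: contrapT => h; apply: ngap; exists F, (1 - eta); split=> //.
  - by move: eta2; lra.
  - by move: eta0; lra.
  - by move=> v; rewrite leNgt; apply/negP => h'; apply: h; exists v.
have v0 : 0 < hnorm v.
  rewrite lt_neqAle hnorm_ge0 andbT eq_sym; apply/eqP => v0; move: hv.
  rewrite v0 mulr0 (hnorm_eq0 v0) big1 ?hnorm0 ?ltxx// => g _.
  by rewrite (lin0 (bounded_linear (lambda_bounded reg g))).
pose w := rc (hnorm v)^-1 *: v.
have nv : `|(hnorm v)^-1| = (hnorm v)^-1 by rewrite ger0_norm ?invr_ge0 ?hnorm_ge0.
have w1 : hnorm w = 1 by rewrite hnormZr nv mulVf// gt_eqF.
have ll g := bounded_linear (lambda_bounded reg g).
pose a := rc N^-1 *: \sum_(g <- F) lambda g w.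
have Na : \sum_(g <- F) lambda g w = rc N *: a.
  by rewrite /a scalerA -rcM mulfV ?gt_eqF// rc1 scale1r.
have ha : 1 - eta < hnorm a.
  rewrite /a hnormZr ger0_norm ?invr_ge0 ?(ltW N0)// ltr_pdivlMl// mulrC.
  have -> : \sum_(g <- F) lambda g w = rc (hnorm v)^-1 *: \sum_(g <- F) lambda g v.
    by rewrite scaler_sumr; apply: eq_bigr => g _; rewrite (linZ (ll g)).
  by rewrite hnormZr nv ltr_pdivlMl// (mulrC (hnorm v)).
(* The variance of the lambda_g w about their mean a. *)
have var : \sum_(g <- F) hnorm (lambda g w - a) ^+ 2 = N * (1 - hnorm a ^+ 2).
  under eq_bigr do rewrite sqr_hnormB (hnorm_lambda reg) w1.
  have e2 : \sum_(g <- F) 2 * rdot (lambda g w) a = 2 * (N * hnorm a ^+ 2).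
    by rewrite -mulr_sumr -rdot_suml Na rdotZl sqr_hnorm.
  rewrite big_split sumrB /= e2.
  have bc (x : R) : \sum_(g <- F) x = N * x.
    by rewrite big_const_seq count_predT iter_addr_0 /N mulr_natl.
  have fin (y x : R) : y * 1 ^+ 2 - 2 * (y * x) + y * x = y * (1 - x) by ring.
  by rewrite !bc fin.
have a2 : 1 - hnorm a ^+ 2 <= 2 * eta.
  have h : (1 - eta) ^+ 2 <= hnorm a ^+ 2.
    by rewrite ler_pXn2r ?nnegrE ?hnorm_ge0 ?(ltW ha)//; move: eta2; lra.
  move: h (sqr_ge0 eta); rewrite sqrrB expr1n mul1r -mulr_natl.
  by move: (hnorm a ^+ 2) (eta ^+ 2) => *; lra.
have close g : g \in F -> hnorm (lambda g w - a) < e / 2.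
  move=> gF; rewrite -(@ltr_pXn2r _ 2) ?nnegrE ?hnorm_ge0 ?divr_ge0 ?(ltW e0)//.
  apply: (@le_lt_trans _ _ (N * (2 * eta))).
    rewrite (@le_trans _ _ (N * (1 - hnorm a ^+ 2)))//; last by rewrite ler_wpM2l ?(ltW N0).
    rewrite -var (big_rem g gF) /= lerDl; apply: sumr_ge0 => h _; exact: sqr_ge0.
  apply: (@le_lt_trans _ _ (N * (2 * (e ^+ 2 / (16 * N))))).
    by rewrite ler_wpM2l ?(ltW N0)// ler_wpM2l.
  have -> : N * (2 * (e ^+ 2 / (16 * N))) = e ^+ 2 / 8 by field; rewrite gt_eqF.
  have : 0 < e ^+ 2 by rewrite exprn_gt0.
  by rewrite exprMn exprVn; move: (e ^+ 2) => *; lra.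
exists w; split=> // g gF.
have h1 := close 1%g (mem_head _ _).
have h2 : hnorm (lambda g w - a) < e / 2 by apply: close; rewrite inE gF orbT.
rewrite (lambda1 reg) /= in h1.
rewrite (le_lt_trans (hnorm_tri a _ _))// (hnorm_distC a) (splitr e).
exact: ltrD.
Qed.
End NonAmenable.

(** * The power trick and weak containment *)

Section PowerTrick.
Context (R : realType).

(** The tensor-power trick: moments a_k = <Y^k z, z> of a self-adjoint Y are
    log-convex, so an exponential bound with any constant C improves to C = a_0. *)
Lemma power_trick (a : nat -> R) (C r : R) : 0 < r -> 0 <= a 0%N ->
  (forall k, a k ^+ 2 <= a 0%N * a (2 * k)%N) -> (forall k, a k <= C * r ^+ k) ->
  a 1%N <= r * a 0%N.
Proof.
move=> r0 a0 conv bd; have [a0z|a0n] := eqVneq (a 0%N) 0.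
  have := conv 1%N; rewrite a0z mul0r mulr0 => h.
  have : a 1%N ^+ 2 == 0 by rewrite eq_le h sqr_ge0.
  by rewrite sqrf_eq0 => /eqP ->.
have a0p : 0 < a 0%N by rewrite lt_neqAle eq_sym a0n.
rewrite leNgt; apply/negP => lt.
pose t := a 1%N / (r * a 0%N).
have ra : 0 < r * a 0%N by rewrite mulr_gt0.
have t1 : 1 < t by rewrite /t ltr_pdivlMr// mul1r.
have t0 : 0 < t by rewrite (lt_trans ltr01).
have grow j : a 0%N * (t * r) ^+ (2 ^ j) <= a (2 ^ j)%N.
  elim: j => [|j IH]; first by rewrite expn0 expr1 /t le_eqVlt; apply/orP; left;
    apply/eqP; field; rewrite gt_eqF//= gt_eqF.
  have h0 : 0 <= a 0%N * (t * r) ^+ (2 ^ j).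
    by rewrite mulr_ge0// exprn_ge0// mulr_ge0 ?(ltW t0)// ltW.
  rewrite expnS -(ler_pM2l a0p) (le_trans _ (conv _))//.
  rewrite mulnC exprM mulrA -expr2 -exprMn ler_pXn2r ?nnegrE//.
  exact: le_trans IH.
(* Were a_1 larger than r a_0, log-convexity would let a_(2^j) outgrow
   C r^(2^j); Bernoulli's inequality makes this explicit. *)
have bern n : 1 + n%:R * (t - 1) <= t ^+ n.
  elim: n => [|n IH]; first by rewrite mul0r addr0 expr0.
  rewrite exprS (le_trans _ (ler_wpM2l (ltW t0) IH))//.
  have : 0 <= n%:R * (t - 1) * (t - 1) :> R.
    by rewrite !mulr_ge0// subr_ge0 ltW.
  rewrite -natr1; move: (n%:R : R) => m; nra.
have le j : a 0%N * (1 + j%:R * (t - 1)) <= C.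
  have rj : 0 < r ^+ (2 ^ j) by rewrite exprn_gt0.
  have h : a 0%N * t ^+ (2 ^ j) <= C.
    by rewrite -(ler_pM2r rj) -mulrA -exprMn (le_trans (grow j)).
  rewrite (le_trans _ h)// ler_wpM2l// (le_trans _ (bern _))// lerD2l.
  rewrite ler_wpM2r ?subr_ge0 ?(ltW t1)// ler_nat.
  by rewrite ltnW// ltn_expl.
have d0 : 0 < a 0%N * (t - 1) by rewrite mulr_gt0// subr_gt0.
pose j := Num.bound (`|C| / (a 0%N * (t - 1))).
have hj : `|C| / (a 0%N * (t - 1)) < j%:R.
  by rewrite /j archi_boundP// divr_ge0// ltW.
move: hj; rewrite ltr_pdivrMr// => hj.
have := le j; have := ler_norm C; move: hj a0p.
rewrite (_ : a 0%N * (1 + _) = a 0%N + j%:R * (a 0%N * (t - 1))); last by ring.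
move: (j%:R * _) => x; lra.
Qed.

Lemma symmetric_power_trick (V : Type) (D : set V) (ip : V -> V -> R) (Y : V -> V) z (C r : R) :
  (forall x, D x -> D (Y x)) -> D z ->
  (forall x y, D x -> D y -> ip x y ^+ 2 <= ip x x * ip y y) ->
  (forall x, D x -> 0 <= ip x x) -> (forall x y, D x -> D y -> ip (Y x) y = ip x (Y y)) ->
  0 < r -> (forall k, ip (iter k Y z) z <= C * r ^+ k) ->
  ip (Y z) z <= r * ip z z.
Proof.
move=> DY Dz cs ip0 sY r0 hC.
have Dk k x : D x -> D (iter k Y x) by move=> Dx; elim: k => //= k; exact: DY.
have sYk k x y : D x -> D y -> ip (iter k Y x) y = ip x (iter k Y y).
  elim: k x y => //= k IH x y Dx Dy; rewrite (sY _ _ (Dk k x Dx) Dy).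
  by rewrite (IH x (Y y) Dx (DY y Dy)) -iterSr.
apply: (@power_trick (fun k => ip (iter k Y z) z) C r) => //=; first exact: ip0.
move=> k; have Dkz := Dk k z Dz.
by rewrite mul2n -addnn iterD [X in _ * X](sYk k _ _ Dkz Dz) mulrC; exact: cs.
Qed.
End PowerTrick.

Section DenseBounds.
Context (R : realType) (H K : hilbert R).

Lemma dense_sequence (S : set H) z : dense S -> exists u : nat -> H, (forall n, S (u n)) /\ hcvg u z.
Proof.
move=> dS; have ap n : exists w, S w /\ hnorm (w - z) <= n.+1%:R^-1.
  have e0 : 0 < n.+1%:R^-1 :> R by rewrite invr_gt0.
  by have [w Sw hw] := dense_approx z dS e0; exists w; rewrite hnorm_distC ltW.
have [u hu] := choice ap; exists u; split=> [n|]; first by case: (hu n).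
apply: (@hcvg_le _ _ _ _ (fun n => n.+1%:R^-1)); last exact: cvg_harmonic.
by move=> n; case: (hu n).
Qed.

Lemma opbd_dense (S : set H) (T : H -> K) (c : R) : dense S -> bounded_op T ->
  (forall x, S x -> hnorm (T x) <= c * hnorm x) -> opbd T c.
Proof.
move=> dS bT h v; have [u [Su uv]] := dense_sequence v dS.
rewrite -subr_le0; apply: (@lim_le_cst _ (fun n => hnorm (T (u n)) - c * hnorm (u n))).
  by move=> n; rewrite subr_le0 h.
apply: cvgB; first exact: hcvg_hnorm (hcvg_op bT uv).
by apply: cvgM; [exact: cvg_cst | exact: hcvg_hnorm].
Qed.
End DenseBounds.

(** Elements of the real group ring are kept as lists of terms that are never
    collected: products and adjoints are then maps of lists, and nonnegativity
    of the coefficients is visibly preserved. *)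
Section FormalSums.
Context (R : realType) (G : groupType).
Implicit Types s t : seq (R * G).

Definition fmul s t : seq (R * G) := [seq (p.1 * q.1, (p.2 * q.2)%g) | p <- s, q <- t].
Definition fadj s : seq (R * G) := [seq (p.1, p.2^-1%g) | p <- s].
Definition fexp s n : seq (R * G) := iter n (fmul s) [:: (1, 1%g)].
Definition fnonneg s := all (fun p => 0 <= p.1) s.

Lemma fnonneg_mul s t : fnonneg s -> fnonneg t -> fnonneg (fmul s t).
Proof.
move=> /allP hs /allP ht; apply/allP => _ /allpairsP[[p q] /= [ps qt ->]] /=.
by rewrite mulr_ge0 ?(hs p ps) ?(ht q qt).
Qed.
Lemma fnonneg_adj s : fnonneg s -> fnonneg (fadj s).
Proof. by rewrite /fnonneg all_map. Qed.
Lemma fnonneg_exp s n : fnonneg s -> fnonneg (fexp s n).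
Proof.
move=> hs; elim: n => [|n IH]; first by rewrite /fnonneg /= ler01.
exact: fnonneg_mul.
Qed.

Definition unitary_rep (H : hilbert R) (pi : G -> op H) :=
  [/\ (forall g, bounded_op (pi g)), pi 1%g = id,
      (forall g h, pi (g * h)%g = pi g \o pi h) &
      (forall g x y, rdot (pi g x) y = rdot x (pi g^-1%g y))].

Section Representation.
Context (H : hilbert R) (pi : G -> op H) (hpi : unitary_rep pi).
Definition frep s : op H := fun v => \sum_(p <- s) rc p.1 *: pi p.2 v.

Lemma rep_linear g : linear (pi g). Proof. by case: hpi => h _ _ _; exact: bounded_linear. Qed.
Lemma frep_bounded s : bounded_op (frep s).
Proof.
elim: s => [|p s IH].
  rewrite (_ : frep [::] = fun=> 0); first exact: bounded_0.
  by apply/funext => v; rewrite /frep big_nil.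
rewrite (_ : frep (p :: s) = fun v => rc p.1 *: pi p.2 v + frep s v).
  by apply: bounded_lin => //; case: hpi.
by apply/funext => v; rewrite /frep big_cons.
Qed.
Lemma frep_linear s : linear (frep s). Proof. exact: bounded_linear (frep_bounded s). Qed.
Lemma frep_mul s t v : frep (fmul s t) v = frep s (frep t v).
Proof.
rewrite /frep big_allpairs_dep; apply: eq_bigr => p _.
rewrite (lin_sum (rep_linear _)) scaler_sumr; apply: eq_bigr => q _ /=.
rewrite (linZ (rep_linear _)) scalerA rcM; congr (_ *: _).
by case: hpi => _ _ -> _.
Qed.
Lemma frep_exp s n v : frep (fexp s n) v = iter n (frep s) v.
Proof.
elim: n => [|n IH] /=; last by rewrite -IH -frep_mul.
by rewrite /frep /fexp /= big_seq1 /= scale1r; case: hpi => _ -> _ _.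
Qed.
Lemma rdot_frep s x y : rdot (frep s x) y = rdot x (frep (fadj s) y).
Proof.
rewrite /frep rdot_suml big_map rdot_sumr; apply: eq_bigr => p _ /=.
by rewrite rdotZl rdotZr; case: hpi => _ _ _ ->.
Qed.
Lemma rdot_frepl s x y : rdot (frep (fadj s) x) y = rdot x (frep s y).
Proof. by rewrite rdotC -rdot_frep rdotC. Qed.
Lemma frep_exp_opbd s (c : R) n : 0 <= c -> opbd (frep s) c -> opbd (frep (fexp s n)) (c ^+ n).
Proof.
move=> c0 h v; rewrite frep_exp; elim: n => [|n IH] /=; first by rewrite expr0 mul1r.
by rewrite (le_trans (h _))// exprS -mulrA ler_wpM2l.
Qed.
Lemma frep_square_opbd s (c : R) : 0 <= c -> opbd (frep s) c ->
  opbd (frep (fmul (fadj s) s)) (c ^+ 2).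
Proof.
move=> c0 h v; rewrite frep_mul expr2 -mulrA.
have ha : opbd (frep (fadj s)) c by apply: opbd_of_adj c0 _ h; exact: rdot_frep.
by rewrite (le_trans (ha _))// ler_wpM2l.
Qed.

(** The power trick for s^* s: an estimate of the matrix coefficient of z with
    a constant depending on z bounds the norm at z without that constant. *)
Lemma frep_power_trick s z (c C : R) : 0 < c ->
  (forall k, rdot (frep (fexp (fmul (fadj s) s) k) z) z <= C * (c ^+ 2) ^+ k) ->
  hnorm (frep s z) <= c * hnorm z.
Proof.
move=> c0 hC; pose Y := frep (fmul (fadj s) s).
have YE x y : rdot (Y x) y = rdot (frep s x) (frep s y) by rewrite /Y frep_mul rdot_frepl.
have := @symmetric_power_trick _ H setT (@rdot _ H) Y z C (c ^+ 2).
rewrite exprn_gt0// YE -!sqr_hnorm -exprMn.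
rewrite ler_pXn2r ?nnegrE ?hnorm_ge0 ?mulr_ge0 ?hnorm_ge0 ?(ltW c0)//; apply=> //.
- move=> x y _ _; rewrite -!sqr_hnorm -exprMn -real_normK ?num_real//.
  by rewrite ler_pXn2r ?nnegrE ?normr_ge0 ?mulr_ge0 ?hnorm_ge0// abs_rdot.
- by move=> x _; exact: rdot_ge0.
- by move=> x y _ _; rewrite YE rdotC -YE rdotC.
- by move=> k; rewrite -frep_exp; exact: hC.
Qed.
End Representation.
End FormalSums.

Section PositiveCoefficients.
Context (R : realType) (G : groupType) (K : hilbert R) (delta : G -> K).
Context (lambda : G -> op K) (reg : is_left_regular delta lambda).

Lemma lambda_rep : unitary_rep lambda.
Proof.
split; [exact: lambda_bounded reg | exact: lambda1 reg | exact: lambdaM reg|].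
exact: rdot_lambda reg.
Qed.

Lemma finite_expansion s (x := comb delta s) :
  x = \sum_(g <- undup (map snd s)) dotp x (delta g) *: delta g.
Proof.
apply: (basis_inj (reg_spans reg)) => h; rewrite [RHS]dotp_suml.
under [RHS]eq_bigr do rewrite dotpZl (reg_orth reg).
have [hs|hs] := boolP (h \in undup (map snd s)).
  rewrite [RHS](big_rem h hs) /= eqxx mulr1 [X in _ = _ + X]big_seq [X in _ = _ + X]big1 ?addr0// => g.
  rewrite (mem_rem_uniq _ (undup_uniq _)) inE => /andP[/negPf-> _].
  by rewrite mulr0.
rewrite [RHS]big_seq [RHS]big1; last first.
  move=> g gs; case: eqVneq gs => [->|_ _]; last by rewrite mulr0.
  by move=> h'; rewrite h' in hs.
rewrite /x dotp_suml big_seq big1// => p ps; rewrite dotpZl (reg_orth reg).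
case: eqVneq => [e|_]; last by rewrite mulr0.
by move: hs; rewrite mem_undup -e map_f.
Qed.

Lemma sqr_hnorm_uniq (us : seq G) (a : G -> R[i]) : uniq us ->
  hnorm (\sum_(g <- us) a g *: delta g) ^+ 2 = \sum_(g <- us) modulus (a g) ^+ 2.
Proof.
move=> uus; rewrite sqr_hnorm rdot_suml big_seq [RHS]big_seq; apply: eq_bigr => g gus.
rewrite rdot_sumr (big_rem g gus) /= big_seq big1 ?addr0; last first.
  move=> h; rewrite (mem_rem_uniq _ uus) inE => /andP[hg _].
  by rewrite /rdot dotpZl dotpZr (reg_orth reg) eq_sym (negPf hg) !mulr0.
rewrite /rdot dotpZl dotpZr (reg_orth reg) eqxx mulr1 sqr_modulus cReM cRe_conj cIm_conj.
by ring.
Qed.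

(** For nonnegative coefficients the matrix coefficient at x, y is at most b times
    the undamped one at |x|, |y|, where moduli are taken coordinatewise. *)
Lemma damped_opbd (s : seq (R * G)) (w : G -> R[i]) (b c : R) : fnonneg s ->
  0 <= b -> 0 <= c -> (forall g, modulus (w g) <= b) -> opbd (frep lambda s) c ->
  opbd (fun v => \sum_(p <- s) (rc p.1 * w p.2) *: lambda p.2 v) (b * c).
Proof.
move=> s0 b0 c0 wb hc; pose T v := \sum_(p <- s) (rc p.1 * w p.2) *: lambda p.2 v.
have bT : bounded_op T.
  rewrite /T {s0 hc T}; elim: s => [|p s IH].
    by under eq_fun do rewrite big_nil; exact: bounded_0.
  under eq_fun do rewrite big_cons.
  by apply: bounded_lin => //; exact: lambda_bounded reg _.
apply: (opbd_dense (reg_spans reg) bT) => _ [t ->].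
set x := comb delta t; have ex := finite_expansion t; rewrite -/x in ex.
pose ax := \sum_(g <- undup (map snd t)) rc (modulus (dotp x (delta g))) *: delta g.
have nax : hnorm ax = hnorm x.
  apply/eqP; rewrite -(@eqrXn2 _ 2) ?hnorm_ge0// [in X in _ == X]ex.
  rewrite !sqr_hnorm_uniq ?undup_uniq//; apply/eqP; apply: eq_bigr => g _.
  by rewrite modulus_rc ger0_norm ?modulus_ge0.
apply: (dense_rdot_le (reg_spans reg)); first by rewrite !mulr_ge0 ?hnorm_ge0.
move=> _ [r ->].
set y := comb delta r; have ey := finite_expansion r; rewrite -/y in ey.
pose ay := \sum_(g <- undup (map snd r)) rc (modulus (dotp y (delta g))) *: delta g.
have nay : hnorm ay = hnorm y.
  apply/eqP; rewrite -(@eqrXn2 _ 2) ?hnorm_ge0// [in X in _ == X]ey.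
  rewrite !sqr_hnorm_uniq ?undup_uniq//; apply/eqP; apply: eq_bigr => g _.
  by rewrite modulus_rc ger0_norm ?modulus_ge0.
apply: (@le_trans _ _ (b * rdot (frep lambda s ax) ay)); last first.
  rewrite -!mulrA ler_wpM2l// (le_trans (cauchy_schwarz_rdot _ _))// nay mulrA.
  by rewrite ler_wpM2r ?hnorm_ge0// -nax hc.
rewrite /T /frep !rdot_suml mulr_sumr big_seq [leRHS]big_seq; apply: ler_sum => p ps.
have p0 : 0 <= p.1 by move/allP: s0 => /(_ p ps).
have lp := bounded_linear (lambda_bounded reg p.2).
rewrite {1}ex /ax !(lin_sum lp) scaler_sumr rdot_suml rdotZl rdot_suml !mulr_sumr.
apply: ler_sum => g _; rewrite !(linZ lp) (lambda_delta reg).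
rewrite {1}ey /ay rdotZl !rdot_sumr !mulr_sumr; apply: ler_sum => h _.
rewrite rdotZr /rdot dotpZr !dotpZl (reg_orth reg).
case: eqP => _; last by rewrite !mulr0.
rewrite !mulr1 /= (le_trans (ler_norm _))// (le_trans (Re_le_modulus _))//.
rewrite !modulusM modulus_conj modulus_rc (ger0_norm p0).
set m1 := modulus (dotp x _); set m2 := modulus (dotp y _).
rewrite (_ : m2 * (p.1 * modulus (w p.2) * m1) = modulus (w p.2) * (p.1 * (m1 * m2))); last by ring.
by rewrite ler_wpM2r ?wb// !mulr_ge0 ?modulus_ge0.
Qed.

Lemma filter_opbd (s : seq (R * G)) (P : pred G) (c : R) : fnonneg s -> 0 <= c ->
  opbd (frep lambda s) c -> opbd (frep lambda [seq p <- s | P p.2]) c.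
Proof.
move=> s0 c0 hc; have := @damped_opbd s (fun g => if P g then 1 else 0) 1 c s0 ler01 c0 _ hc.
rewrite mul1r => h v; rewrite /frep big_filter big_mkcond /=.
rewrite (eq_bigr (fun p => (rc p.1 * (if P p.2 then 1 else 0)) *: lambda p.2 v)).
  by apply: h => g; case: ifP; rewrite ?modulus1 ?modulus0.
by move=> p _; case: ifP; rewrite ?mulr1// mulr0 scale0r.
Qed.
End PositiveCoefficients.

Section BimoduleConjugation.
Context (R : realType) (H : hilbert R) (M : set (op H)) (vM : von_neumann M).
Context (G : groupType) (u : G -> op H).
Context (Mu : forall g, M (u g)) (u1 : u 1%g = id) (uM : forall g h, u (g * h)%g = u g \o u h).
Context (ua : forall g, adj (u g) = u g^-1%g).

Definition conj_rep (B : bimodule M) (g : G) : op B :=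
  fun v => ract B (u g^-1%g) (lact B (u g) v).

Arguments conj_rep B g v : clear implicits.

Lemma conj_rep_unitary (B : bimodule M) : unitary_rep (conj_rep B).
Proof.
have lmap := lact_map B; have rmap := ract_map B.
split.
- move=> g; apply: (bounded_comp (S := ract B (u g^-1%g)) (T := lact B (u g))).
    exact: (star_map_bounded rmap).
  exact: (star_map_bounded lmap).
- apply/funext => v; rewrite /conj_rep invg1 u1.
  by rewrite (star_map_id lmap) (star_map_id rmap).
- move=> g h; apply/funext => v; rewrite /conj_rep /= invgM !uM.
  by rewrite (lactM v (Mu g) (Mu h)) (ractM _ (Mu h^-1%g) (Mu g^-1%g)) (lract _ (Mu g) (Mu h^-1%g)).
- move=> g x y; rewrite /conj_rep.
  rewrite (rdot_adj (star_map_bounded rmap (Mu g^-1%g))) -(star_map_adj rmap (Mu g^-1%g)) ua.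
  rewrite (rdot_adj (star_map_bounded lmap (Mu g))) -(star_map_adj lmap (Mu g)) ua.
  by rewrite (lract _ (Mu g^-1%g) (Mu g^-1^-1%g)).
Qed.

Lemma frep_bimod_rep (B : bimodule M) (s : seq (R * G)) :
  frep (conj_rep B) s =
  bimod_rep B (fun i : 'I_(size s) => fun v => rc (nth (0, 1%g) s i).1 *: u (nth (0, 1%g) s i).2 v)
    (fun i : 'I_(size s) => u (nth (0, 1%g) s i).2^-1%g).
Proof.
apply/funext => v; rewrite /frep /bimod_rep (big_nth (0, 1%g)) big_mkord.
apply: eq_bigr => i _.
rewrite (star_mapZ vM (lact_map B))//.
by rewrite (linZ (star_map_lin (ract_map B) (Mu _))).
Qed.

Lemma conj_rep_weak_containment (B T : bimodule M) (s : seq (R * G)) (c : R) :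
  weakly_contained B T -> 0 <= c -> opbd (frep (conj_rep T) s) c ->
  opbd (frep (conj_rep B) s) c.
Proof.
move=> wc c0 h.
apply/(opnorm_le (frep_linear (conj_rep_unitary B) s) c0).
move: h => /(opnorm_le (frep_linear (conj_rep_unitary T) s) c0).
apply: le_trans; rewrite !frep_bimod_rep; apply: wc => i; last exact: Mu.
exact: (vN_scale vM).
Qed.
End BimoduleConjugation.
Arguments conj_rep {R H M G} u B g v.

Section CoarseGap.
Context (R : realType) (H : hilbert R) (M : set (op H)) (vM : von_neumann M).
Context (tau : op H -> R[i]).
Context (G : groupType) (K : hilbert R) (delta : G -> K) (lambda : G -> op K).
Context (reg : is_left_regular delta lambda).
Local Notation A := (groupvN lambda).
Context (N : set (op H)) (NM : N `<=` M).
Context (theta : op K -> op H) (iso : star_iso A N theta).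
Let u g := theta (lambda g).
Let Mu g : M (u g). Proof. exact: (gunitM reg NM iso). Qed.

(** A matrix coefficient of sum_g a_g u_g (x) u_g^* between elementary tensors is
    one of sum_g a_g w(g) u_g, where w is a coefficient of the second factor and
    hence bounded.  Damping by w and transport by theta do not increase norms,
    and the power trick removes the constants that sums of tensors bring in. *)
Lemma coarse_conj_opbd (T : bimodule M) (s : seq (R * G)) (c : R) :
  is_coarse tau T -> fnonneg s -> 0 < c -> opbd (frep lambda s) c ->
  opbd (frep (conj_rep u T) s) c.
Proof.
move=> [L [hat [tens [hL [tdot tdense tl tr]]]]] s0 c0 hc.
have vA := groupvN_von_neumann reg.
have rep := conj_rep_unitary Mu (gunit1 reg iso) (gunit_mul reg iso) (gunit_adj reg iso) T.
have lrep := lambda_rep reg.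
apply: (opbd_dense tdense (frep_bounded rep s)) => _ [n [x [y ->]]].
set z := \sum_(i < n) tens (x i) (y i).
pose b i j := hnorm (y i) * hnorm (y j).
pose C := \sum_(j < n) \sum_(i < n) b i j * (hnorm (x i) * hnorm (x j)).
apply: (@frep_power_trick _ _ _ _ rep s z c C c0) => k.
set D := fexp (fmul (fadj s) s) k.
have D0 : fnonneg D by apply/fnonneg_exp/fnonneg_mul => //; exact: fnonneg_adj.
have Dc : opbd (frep lambda D) ((c ^+ 2) ^+ k).
  apply: (frep_exp_opbd lrep); first by rewrite exprn_ge0// ltW.
  by apply: (frep_square_opbd lrep) => //; exact: ltW.
have lmap : star_map A (fun a => lact L (theta a)).
  left; apply: (@star_hom_comp _ _ _ _ A M theta) (lact_hom L); first by case: iso.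
  by move=> a /(iso_mem iso)/NM.
rewrite /z rdot_sumr /C mulr_suml; apply: ler_sum => j _.
rewrite /frep rdot_suml mulr_suml.
have E p : rdot (rc p.1 *: conj_rep u T p.2 (\sum_(i < n) tens (x i) (y i))) (tens (x j) (y j)) =
    \sum_(i < n) complex.Re (rc p.1 * dotp (ract L (u p.2^-1%g) (y i)) (y j) *
      dotp (lact L (u p.2) (x i)) (x j)).
  rewrite rdotZl (lin_sum (rep_linear rep p.2)) rdot_suml mulr_sumr.
  apply: eq_bigr => i _; rewrite /conj_rep tl// tr// /rdot tdot -Re_rcM; congr complex.Re.
  by ring.
under eq_bigr do rewrite E.
rewrite exchange_big /=; apply: ler_sum => i _.
pose w g := dotp (ract L (u g^-1%g) (y i)) (y j).
have wb g : modulus (w g) <= b i j.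
  rewrite /w (le_trans (cauchy_schwarz _ _))// /b ler_wpM2r ?hnorm_ge0//.
  rewrite -[leRHS]mul1r; apply: (star_map_opbd vM (ract_map L) (Mu _) ler01).
  exact: (gunit_opbd reg iso).
have b0 : 0 <= b i j by rewrite mulr_ge0 ?hnorm_ge0.
have cc : 0 <= (c ^+ 2) ^+ k by rewrite !exprn_ge0// ltW.
have hd := damped_opbd reg D0 b0 cc wb Dc.
have Ap (p : R * G) : A (fun v => (rc p.1 * w p.2) *: lambda p.2 v).
  by apply: (vN_scale vA); exact: (groupvN_lambda reg).
have AT : A (fun v => \sum_(p <- D) (rc p.1 * w p.2) *: lambda p.2 v).
  exact: (vN_sum vA D (F := fun p : R * G => fun v => (rc p.1 * w p.2) *: lambda p.2 v)).
have hdT := star_map_opbd vA lmap AT (mulr_ge0 b0 cc) hd (x i).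
rewrite -cRe_sum.
have -> : \sum_(p <- D) rc p.1 * dotp (ract L (u p.2^-1%g) (y i)) (y j) *
      dotp (lact L (u p.2) (x i)) (x j) =
    dotp (lact L (theta (fun v => \sum_(p <- D) (rc p.1 * w p.2) *: lambda p.2 v)) (x i)) (x j).
  rewrite (star_map_sum vA lmap D (F := fun p : R * G => fun v => (rc p.1 * w p.2) *: lambda p.2 v))//.
  rewrite dotp_suml; apply: eq_bigr => p _.
  by rewrite (star_mapZ vA lmap) ?dotpZl//; exact: (groupvN_lambda reg).
rewrite (le_trans (ler_norm _))// (le_trans (Re_le_modulus _))//.
rewrite (le_trans (cauchy_schwarz _ _))//.
rewrite (@le_trans _ _ (b i j * (c ^+ 2) ^+ k * hnorm (x i) * hnorm (x j)))//.
  by rewrite ler_wpM2r ?hnorm_ge0.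
by rewrite le_eqVlt; apply/orP; left; apply/eqP; rewrite /b; ring.
Qed.
End CoarseGap.

(** * Finitely supported fields over the group *)

Section FiniteSupportSums.
Context (R : realType) (G : choiceType).
Implicit Types (a b : G -> R) (S : seq G).

Definition fsupp a := exists S, forall h, h \notin S -> a h = 0.
Definition fsum a : R := \sum_(h \in [set: G]) a h.

Lemma fsum_seq a S : uniq S -> (forall h, h \notin S -> a h = 0) ->
  fsum a = \sum_(h <- S) a h.
Proof.
move=> uS a0; rewrite (fsbig_seq _ a uS); symmetry; apply: fsbig_widen => // h [_ /= /negP hS].
exact: a0.
Qed.

Lemma fsum_seq2 a b : fsupp a -> fsupp b -> exists S,
  [/\ uniq S, forall h, h \notin S -> a h = 0 & forall h, h \notin S -> b h = 0].
Proof.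
move=> [S hS] [S' hS']; exists (undup (S ++ S')); rewrite undup_uniq.
by split=> // h; rewrite mem_undup mem_cat negb_or => /andP[? ?]; [apply: hS|apply: hS'].
Qed.

Lemma fsumD a b : fsupp a -> fsupp b -> fsum (fun h => a h + b h) = fsum a + fsum b.
Proof.
move=> ha hb; have [S [uS aS bS]] := fsum_seq2 ha hb.
rewrite (fsum_seq uS aS) (fsum_seq uS bS) (fsum_seq uS) ?big_split// => h hS.
by rewrite aS// bS// addr0.
Qed.
Lemma fsumZ r a : fsupp a -> fsum (fun h => r * a h) = r * fsum a.
Proof.
move=> ha; have [S [uS aS _]] := fsum_seq2 ha ha.
rewrite (fsum_seq uS aS) (fsum_seq uS) ?mulr_sumr// => h hS.
by rewrite aS// mulr0.
Qed.
Lemma fsum_le a b : fsupp a -> fsupp b -> (forall h, a h <= b h) -> fsum a <= fsum b.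
Proof.
move=> ha hb ab; have [S [uS aS bS]] := fsum_seq2 ha hb.
by rewrite (fsum_seq uS aS) (fsum_seq uS bS); apply: ler_sum.
Qed.
Lemma fsum0 : fsum (fun=> 0) = 0.
Proof. by rewrite (@fsum_seq _ [::])// big_nil. Qed.
Lemma fsum_ge0 a : (forall h, 0 <= a h) -> 0 <= fsum a.
Proof. by move=> h; apply: fsumr_ge0. Qed.
Lemma fsum_reindex a (f : G -> G) : bijective f -> fsum a = fsum (a \o f).
Proof. exact: reindex_fsbigT. Qed.

Lemma fsuppD a b : fsupp a -> fsupp b -> fsupp (fun h => a h + b h).
Proof.
move=> ha hb; have [S [uS aS bS]] := fsum_seq2 ha hb; exists S => h hS.
by rewrite aS// bS// addr0.
Qed.
Lemma fsuppZ r a : fsupp a -> fsupp (fun h => r * a h).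
Proof. by move=> [S aS]; exists S => h hS; rewrite aS// mulr0. Qed.
Lemma fsupp_reindex a (f g : G -> G) : cancel f g -> cancel g f -> fsupp a -> fsupp (a \o f).
Proof.
move=> fg gf [S aS]; exists (map g S) => h hS /=; apply: aS.
by apply: contra hS => fS; rewrite -[h]fg map_f.
Qed.
End FiniteSupportSums.

(** Finitely supported fields of vectors over G: the algebraic version of the
    tensor product of a Hilbert space with l^2(G). *)
Section Fields.
Context (R : realType) (G : groupType) (X : hilbert R).
Implicit Types (f : G -> X).

Definition fin f := exists S : seq G, forall h, h \notin S -> f h = 0.
Definition ip f (g : G -> X) : R := fsum (fun h => rdot (f h) (g h)).

Lemma fin_ip f (g : G -> X) : fin f -> fsupp (fun h => rdot (f h) (g h)).
Proof. by move=> [S fS]; exists S => h hS; rewrite fS// rdot0l. Qed.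
Lemma ipC f (g : G -> X) : ip f g = ip g f.
Proof. by rewrite /ip; congr fsum; apply/funext => h; rewrite rdotC. Qed.
Lemma finD f (g : G -> X) : fin f -> fin g -> fin (fun h => f h + g h).
Proof.
move=> [S fS] [S' gS']; exists (S ++ S') => h; rewrite mem_cat negb_or => /andP[hS hS'].
by rewrite fS// gS'// addr0.
Qed.
Lemma finZ c f : fin f -> fin (fun h => c *: f h).
Proof. by move=> [S fS]; exists S => h hS; rewrite fS// scaler0. Qed.
Lemma ipD f f' (g : G -> X) : fin f -> fin f' -> ip (fun h => f h + f' h) g = ip f g + ip f' g.
Proof.
move=> hf hf'; rewrite /ip -fsumD; [|exact: fin_ip..].
by congr fsum; apply/funext => h; rewrite rdotDl.
Qed.
Lemma ipZ r f (g : G -> X) : fin f -> ip (fun h => rc r *: f h) g = r * ip f g.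
Proof.
move=> hf; rewrite /ip -fsumZ; last exact: fin_ip.
by congr fsum; apply/funext => h; rewrite rdotZl.
Qed.
Lemma ip_ge0 f : 0 <= ip f f.
Proof. by apply: fsum_ge0 => h; exact: rdot_ge0. Qed.
Lemma ip_cauchy_schwarz f (g : G -> X) : fin f -> fin g -> ip f g ^+ 2 <= ip f f * ip g g.
Proof.
move=> hf hg; apply: quadratic_discriminant; last exact: ip_ge0.
move=> s; have := ip_ge0 (fun h => f h + rc s *: g h).
have hsg := finZ (rc s) hg.
have e1 : ip f (fun h => f h + rc s *: g h) = ip f f + s * ip f g.
  by rewrite ipC ipD// ipZ// (ipC g f).
have e2 : ip g (fun h => f h + rc s *: g h) = ip f g + s * ip g g.
  by rewrite ipC ipD// ipZ.
rewrite ipD// ipZ// e1 e2 => h; move: h; congr (_ <= _); ring.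
Qed.

Context (pi : G -> op X) (hpi : unitary_rep pi).

(** The tensor product of pi with the conjugation representation on l^2(G). *)
Definition fact (g : G) f : G -> X := fun h => pi g (f (conjg h g)).
Definition frep_field (s : seq (R * G)) f : G -> X :=
  fun h => \sum_(p <- s) rc p.1 *: fact p.2 f h.

Lemma conjg_bij (g : G) : bijective (fun h => conjg h g).
Proof. by exists (fun h => conjg h g^-1%g) => h; rewrite ?conjgK ?conjgKV. Qed.

Lemma fin_fact g f : fin f -> fin (fact g f).
Proof.
move=> [S fS]; exists (map (fun h => conjg h g^-1%g) S) => h hS; rewrite /fact fS.
  exact: lin0 (rep_linear hpi g).
apply: contra hS => hgS; have := map_f (fun h => conjg h g^-1%g) hgS.
by rewrite conjgK.
Qed.
Lemma fin_frep_field s f : fin f -> fin (frep_field s f).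
Proof.
move=> hf; elim: s => [|p s [S hS]].
  by exists [::] => h _; rewrite /frep_field big_nil.
have [S' hS'] := finZ (rc p.1) (fin_fact p.2 hf).
exists (S ++ S') => h; rewrite mem_cat negb_or => /andP[h1 h2].
by rewrite /frep_field big_cons hS'// [X in _ + X]hS// addr0.
Qed.
Lemma ip_fact g f f' : ip (fact g f) f' = ip f (fact g^-1%g f').
Proof.
rewrite /ip [RHS](fsum_reindex _ (conjg_bij g)); congr fsum; apply/funext => h /=.
by rewrite /fact conjgK; case: hpi => _ _ _ ->.
Qed.
Lemma ip_frep_field s f f' : fin f -> fin f' ->
  ip (frep_field s f) f' = ip f (frep_field (fadj s) f').
Proof.
move=> hf hf'; elim: s => [|p s IH].
  rewrite /ip /frep_field; congr fsum; apply/funext => h.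
  by rewrite !big_nil rdot0l rdot0r.
have e1 : frep_field (p :: s) f = fun h => rc p.1 *: fact p.2 f h + frep_field s f h.
  by apply/funext => h; rewrite /frep_field big_cons.
have e2 : frep_field (fadj (p :: s)) f' =
    fun h => rc p.1 *: fact p.2^-1%g f' h + frep_field (fadj s) f' h.
  by apply/funext => h; rewrite /frep_field big_cons.
rewrite e1 e2 ipD; [|exact/finZ/fin_fact|exact: fin_frep_field].
rewrite [RHS]ipC ipD; [|exact/finZ/fin_fact|exact: fin_frep_field].
rewrite !ipZ; [|exact: fin_fact..].
by rewrite IH ip_fact (ipC (fact _ _)) (ipC (frep_field (fadj s) f')).
Qed.
Lemma frep_field_mul s t f : frep_field (fmul s t) f = frep_field s (frep_field t f).
Proof.
apply/funext => h; rewrite /frep_field big_allpairs_dep; apply: eq_bigr => p _.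
rewrite /fact (lin_sum (rep_linear hpi _)) scaler_sumr; apply: eq_bigr => q _ /=.
rewrite (linZ (rep_linear hpi _)) scalerA rcM conjgM; congr (_ *: _).
by case: hpi => _ _ -> _.
Qed.
Lemma frep_field_exp s n f : frep_field (fexp s n) f = iter n (frep_field s) f.
Proof.
elim: n => [|n IH] /=; last by rewrite -IH -frep_field_mul.
apply/funext => h; rewrite /frep_field /fexp /= big_seq1 /= scale1r /fact conjg1.
by case: hpi => _ -> _ _.
Qed.

Context (K : hilbert R) (delta : G -> K) (lambda : G -> op K).
Context (reg : is_left_regular delta lambda).
Hypothesis weak : forall (s : seq (R * G)) (c : R), fnonneg s -> 0 < c ->
  opbd (frep lambda s) c -> opbd (frep pi s) c.

(** Fell absorption: tensoring a representation weakly contained in the regular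
    one with the permutation representation on the conjugation action does not
    increase norms.  The matrix coefficient at (h', h) involves only the g with
    g^-1 h g = h', a subsum with nonnegative coefficients. *)
Lemma field_opbd (s : seq (R * G)) (c : R) f : fnonneg s -> 0 < c ->
  opbd (frep lambda s) c -> fin f ->
  ip (frep_field s f) (frep_field s f) <= c ^+ 2 * ip f f.
Proof.
move=> s0 c0 hc hf; pose D := fmul (fadj s) s.
(* D is s^* s, whose powers have nonnegative coefficients again. *)
have YE x y : fin x -> fin y -> ip (frep_field D x) y = ip (frep_field s x) (frep_field s y).
  move=> hx hy; rewrite frep_field_mul ipC [RHS]ipC ip_frep_field//.
  exact: fin_frep_field.
have [S0 hS0] := hf; pose S := undup S0.
have fS h : h \notin S -> f h = 0 by rewrite mem_undup; exact: hS0.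
pose C := \sum_(h <- S) \sum_(h' <- S) hnorm (f h') * hnorm (f h).
rewrite -YE//.
apply: (@symmetric_power_trick _ _ fin ip (frep_field D) f C (c ^+ 2)) => //.
- by move=> x hx; exact: fin_frep_field.
- exact: ip_cauchy_schwarz.
- by move=> x _; exact: ip_ge0.
- by move=> x y hx hy; rewrite YE// ipC -YE// ipC.
- by rewrite exprn_gt0.
move=> k; rewrite -frep_field_exp; set Dk := fexp D k.
have Dk0 : fnonneg Dk by apply/fnonneg_exp/fnonneg_mul => //; exact: fnonneg_adj.
have lrep := lambda_rep reg.
have Dkc : opbd (frep lambda Dk) ((c ^+ 2) ^+ k).
  apply: (frep_exp_opbd lrep); first by rewrite exprn_ge0// ltW.
  by apply: (frep_square_opbd lrep) => //; exact: ltW.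
have ck : 0 < (c ^+ 2) ^+ k by rewrite !exprn_gt0.
rewrite ipC /ip (@fsum_seq _ _ _ S) ?undup_uniq//; last first.
  by move=> h hS; rewrite fS// rdot0l.
rewrite /C mulr_suml; apply: ler_sum => h _; rewrite rdotC mulr_suml.
have E : frep_field Dk f h = \sum_(h' <- S) frep pi [seq p <- Dk | conjg h p.2 == h'] (f h').
  rewrite /frep_field /frep.
  under [RHS]eq_bigr do rewrite big_filter big_mkcond.
  rewrite exchange_big /=; apply: eq_bigr => p _; rewrite /fact.
  have [hpS|hpS] := boolP (conjg h p.2 \in S).
    rewrite (big_rem _ hpS) /= eqxx big_seq big1 ?addr0// => h'.
    by rewrite (mem_rem_uniq _ (undup_uniq _)) inE eq_sym => /andP[/negPf-> _].
  rewrite fS// (lin0 (rep_linear hpi _)) scaler0 big_seq big1// => h' h'S.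
  by case: eqVneq => // e; move: hpS; rewrite e h'S.
rewrite E rdot_suml; apply: ler_sum => h' _.
have hP : opbd (frep pi [seq p <- Dk | conjg h p.2 == h']) ((c ^+ 2) ^+ k).
  apply: weak => //.
    by apply/allP => p; rewrite mem_filter => /andP[_]; exact: (allP Dk0).
  exact: (@filter_opbd _ _ _ _ _ reg Dk (fun g => conjg h g == h') _ Dk0 (ltW ck) Dkc).
rewrite (le_trans (cauchy_schwarz_rdot _ _))// mulrAC ler_wpM2r ?hnorm_ge0//.
by rewrite mulrC.
Qed.

(** The average of the translates of f under F has norm at most rho |f|, but its
    inner product with f is nearly |f|^2. *)
Lemma almost_invariant_field_small (F : seq G) (rho d : R) f : (0 < size F)%N -> 0 < rho ->
  (forall v, hnorm (\sum_(g <- F) lambda g v) <= rho * (size F)%:R * hnorm v) ->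
  fin f ->
  (forall g, g \in F -> ip (fun h => fact g f h - f h) (fun h => fact g f h - f h) <= d) ->
  (1 - rho) * ip f f <= d / 2.
Proof.
move=> F0 rho0 gap hf hd; pose s : seq (R * G) := [seq (1, g) | g <- F].
pose N : R := (size F)%:R; have N0 : 0 < N by rewrite ltr0n.
have s0 : fnonneg s by rewrite /fnonneg all_map; apply/allP => g _ /=; exact: ler01.
have hs : opbd (frep lambda s) (rho * N).
  move=> v; rewrite /frep big_map /=; under eq_bigr do rewrite scale1r.
  exact: gap.
have rN : 0 < rho * N by rewrite mulr_gt0.
have h1 := field_opbd s0 rN hs hf.
have hsf := fin_frep_field s hf.
have h2 : ip (frep_field s f) f <= rho * N * ip f f.
  have := ip_cauchy_schwarz hsf hf.
  have a0 := ip_ge0 f; set a := ip f f in a0 h1 *; set b := ip _ f => h3.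
  have : b ^+ 2 <= (rho * N * a) ^+ 2.
    by rewrite (le_trans h3)// exprMn [X in _ <= _ * X]expr2 mulrA ler_wpM2r.
  have ra : 0 <= rho * N * a by rewrite mulr_ge0// ltW.
  have [b0|b0 _] := leP 0 b; first by rewrite ler_pXn2r.
  by rewrite (le_trans (ltW b0)).
have ipN x y : fin x -> ip (fun h => - x h) y = - ip x y.
  move=> hx; rewrite -[RHS]mulN1r -ipZ//; congr ip; apply/funext => h.
  by rewrite -[LHS]scaleN1r rcN rc1.
have h3 g : g \in F -> ip f f - d / 2 <= ip (fact g f) f.
  move=> gF; have := hd g gF; have hg := fin_fact g hf.
  have hn : fin (fun h => - f h).
    by case: hf => S hS; exists S => h hS'; rewrite hS// oppr0.
  rewrite ipD// ![ip _ (fun h => fact g f h - _)]ipC !ipD// ipN// ipN//.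
  rewrite ![ip _ (fun h => - f h)]ipC !ipN//.
  have -> : ip (fact g f) (fact g f) = ip f f.
    rewrite ip_fact; congr ip; apply/funext => h; rewrite /fact conjgKV.
    have /(congr1 (@^~ (f h))) : pi g^-1%g \o pi g = id.
      by case: hpi => _ <- hM _; rewrite -hM mulVg.
    by [].
  by rewrite (ipC f (fact g f)); move: (ip f f) (ip (fact g f) f) => *; lra.
have h4 : ip (frep_field s f) f = \sum_(g <- F) ip (fact g f) f.
  rewrite /s; elim: F {F0 rho0 gap hd N N0 s0 hs rN h1 hsf h2 h3 s} => [|g F IH].
    rewrite big_nil /ip /frep_field -[RHS](@fsum0 R G); congr fsum; apply/funext => h.
    by rewrite big_nil rdot0l.
  rewrite big_cons -IH -ipD; [|exact: fin_fact|exact: fin_frep_field].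
  by congr ip; apply/funext => h; rewrite /frep_field big_cons /= scale1r.
have h5 : N * (ip f f - d / 2) <= rho * N * ip f f.
  rewrite (le_trans _ h2)// h4 /N -sum1_size natr_sum mulr_suml big_seq [leRHS]big_seq.
  by apply: ler_sum => g gF; rewrite mul1r; exact: h3.
rewrite -(ler_pM2l N0); move: h5; rewrite mulrBr => h5.
by move: h5; rewrite (mulrC rho) -mulrA mulrBl mul1r mulrBr; move: (N * ip f f) (N * (rho * _)) (N * (d / 2)) => *; lra.
Qed.
End Fields.

(** * The Hahn-Banach theorem and integration against a mean *)

Section HahnBanach.
Context (R : realType) (V : lmodType R) (W : set V).
Hypotheses (WD : forall x y, W x -> W y -> W (x + y))
  (WZ : forall (c : R) x, W x -> W (c *: x)).
Implicit Types (p q : V -> R).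

Definition sublinear q :=
  (forall x y, W x -> W y -> q (x + y) <= q x + q y) /\
  (forall (c : R) x, 0 < c -> W x -> q (c *: x) <= c * q x).

Lemma le_infD (A B : set R) z : A !=set0 -> B !=set0 ->
  (forall a b, A a -> B b -> z <= a + b) -> z <= inf A + inf B.
Proof.
move=> A0 B0 h; rewrite -lerBlDr; apply: lb_le_inf => // a Aa.
rewrite lerBlDr addrC -lerBlDr; apply: lb_le_inf => // b Bb.
by rewrite lerBlDr addrC; exact: h.
Qed.

Lemma le_infZ (A : set R) c z : 0 < c -> A !=set0 -> (forall a, A a -> z <= c * a) -> z <= c * inf A.
Proof.
move=> c0 A0 h; rewrite -ler_pdivrMl//; apply: lb_le_inf => // a Aa.
by rewrite ler_pdivrMl//; exact: h.
Qed.

Lemma sublinear_hom q (c : R) x : sublinear q -> 0 < c -> W x -> q (c *: x) = c * q x.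
Proof.
move=> [_ qZ] c0 Wx; apply/eqP; rewrite eq_le qZ//=.
have ci : 0 < c^-1 by rewrite invr_gt0.
have := qZ c^-1 _ ci (WZ c Wx).
by rewrite scalerA mulVf ?gt_eqF// scale1r ler_pdivlMl.
Qed.

Lemma sublinear0 q x : sublinear q -> W x -> q 0 = 0.
Proof.
move=> sq Wx; have W0 : W 0 by rewrite -(scale0r x); exact: WZ.
have := sublinear_hom (c := 2) sq (ltr0n _ 2) W0.
by rewrite scaler0; move: (q 0) => r *; lra.
Qed.

Lemma sublinear_ge q x : sublinear q -> W x -> - q (- x) <= q x.
Proof.
move=> sq Wx; have [qD _] := sq; have Wn : W (- x) by rewrite -scaleN1r; exact: WZ.
by have := qD _ _ Wx Wn; rewrite subrr (sublinear0 sq Wx); move: (q x) (q (- x)) => *; lra.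
Qed.

(** The functional x |-> inf_s (q (x + s y) - s q y) is sublinear and below q, so
    minimality puts q below it; at s = 1 this is superadditivity. *)
Lemma minimal_sublinear_additive q : sublinear q ->
  (forall q', sublinear q' -> (forall x, W x -> q' x <= q x) -> forall x, W x -> q x <= q' x) ->
  forall x y, W x -> W y -> q (x + y) = q x + q y.
Proof.
move=> sq qmin x y Wx Wy; have [qD qZ] := sq.
pose S z := [set q (z + s *: y) - s * q y | s in [set s : R | 0 <= s]].
have W0 : W 0 by rewrite -(scale0r x); exact: WZ.
have S0 z : S z (q z) by exists 0; rewrite /= ?lexx// scale0r mul0r addr0 subr0.
have Sn z : S z !=set0 by exists (q z).
have qs s : 0 <= s -> q (s *: y) = s * q y.
  rewrite le_eqVlt => /predU1P[<-|s0]; last exact: sublinear_hom.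
  by rewrite scale0r mul0r (sublinear0 sq Wx).
have Sl z : W z -> has_lbound (S z).
  move=> Wz; exists (- q (- z)) => _ [s s0 <-].
  have Wn : W (- z) by rewrite -scaleN1r; exact: WZ.
  have := qD _ _ (WD Wz (WZ s Wy)) Wn.
  rewrite addrAC subrr add0r qs//.
  by move: (q (- z)) (q (z + _)) (s * _) => *; lra.
have qle z : W z -> inf (S z) <= q z by move=> Wz; apply: ge_inf => //; exact: Sl.
have /(_ x Wx) : forall x, W x -> q x <= inf (S x).
  apply: qmin => //; split.
    move=> z z' Wz Wz'; apply: le_infD => // _ _ [s s0 <-] [s' s'0 <-].
    apply: (@le_trans _ _ (q (z + z' + (s + s') *: y) - (s + s') * q y)).
      by apply: ge_inf; [exact/Sl/WD|exists (s + s') => //; exact: addr_ge0].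
    have := qD _ _ (WD Wz (WZ s Wy)) (WD Wz' (WZ s' Wy)).
    rewrite scalerDl addrACA mulrDl.
    by move: (q (_ + _)) (q (z + _)) (q (z' + _)) (s * _) (s' * _) => *; lra.
  move=> c z c0 Wz; apply: le_infZ => // _ [s s0 <-].
  apply: (@le_trans _ _ (q (c *: z + (c * s) *: y) - (c * s) * q y)).
    by apply: ge_inf; [exact/Sl/WZ|exists (c * s) => //; exact: mulr_ge0 (ltW c0) s0].
  rewrite -scalerA -scalerDr mulrBr mulrA lerB// qZ//.
  exact/WD/WZ.
move=> h; apply/eqP; rewrite eq_le qD//= -lerBrDr (le_trans h)//.
by apply: ge_inf; [exact: Sl|exists 1; rewrite /= ?ler01// scale1r mul1r].
Qed.

(** Hahn-Banach: Zorn's lemma provides a minimal sublinear functional below p,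
    and it is linear. *)
Lemma hahn_banach p : sublinear p ->
  exists f, [/\ (forall x y, W x -> W y -> f (x + y) = f x + f y),
    (forall (c : R) x, W x -> f (c *: x) = c * f x) & forall x, W x -> f x <= p x].
Proof.
move=> sp; pose Q := {q : V -> R | sublinear q /\ forall x, W x -> q x <= p x}.
pose p0 : Q := exist _ p (conj sp (fun x _ => lexx _)).
pose le (a b : Q) := `[< forall x, W x -> sval b x <= sval a x >].
have [|||[q [sq qp]] qmin] := @ZL_preorder Q p0 le.
- by move=> a; apply/asboolP.
- move=> a b c /asboolP ab /asboolP bc; apply/asboolP => x Wx.
  exact: le_trans (bc x Wx) (ab x Wx).
- move=> A totA; have [A0|/set0P[a0 Aa0]] := eqVneq A set0.
    by exists p0 => s; rewrite A0.
  pose S x := [set sval a x | a in A].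
  have Sn x : S x !=set0 by exists (sval a0 x), a0.
  have Sl x : W x -> has_lbound (S x).
    move=> Wx; exists (- p (- x)) => _ [[a [sa ap]] /= Aa <-].
    rewrite (le_trans _ (sublinear_ge sa Wx))// lerN2 ap//.
    by rewrite -scaleN1r; exact: WZ.
  have qle a x : A a -> W x -> inf (S x) <= sval a x.
    by move=> Aa Wx; apply: ge_inf; [exact: Sl|exists a].
  have sq : sublinear (fun x => inf (S x)).
    split=> [x y Wx Wy|c x c0 Wx].
      apply: le_infD => // _ _ [a Aa <-] [b Ab <-].
      have [c [Ac ca cb]] : exists c, [/\ A c, sval c x <= sval a x & sval c y <= sval b y].
        by have [/asboolP h|/asboolP h] := totA a b Aa Ab; [exists b|exists a]; split=> //; exact: h.
      apply: (le_trans (qle c _ Ac (WD Wx Wy))).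
      by apply: le_trans (lerD ca cb); apply: (svalP c).1.1.
    apply: le_infZ => // _ [a Aa <-]; apply: (le_trans (qle a _ Aa (WZ c Wx))).
    exact: (svalP a).1.2.
  have qp x : W x -> inf (S x) <= p x.
    by move=> Wx; rewrite (le_trans (qle a0 x Aa0 Wx))//; apply: (svalP a0).2.
  pose q1 : Q := exist _ (fun x => inf (S x)) (conj sq qp).
  by exists q1 => a Aa; apply/asboolP => x Wx /=; exact: qle.
have fD : forall x y, W x -> W y -> q (x + y) = q x + q y.
  apply: minimal_sublinear_additive => // q' sq' q'q x Wx.
  have q'p z : W z -> q' z <= p z by move=> Wz; rewrite (le_trans (q'q z Wz))// qp.
  have /asboolP := qmin (exist _ q' (conj sq' q'p)) ltac:(exact/asboolP).
  exact.
exists q; split=> // c x Wx.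
have qN z : W z -> q (- z) = - q z.
  move=> Wz; have Wn : W (- z) by rewrite -scaleN1r; exact: WZ.
  by have := fD _ _ Wz Wn; rewrite subrr (sublinear0 sq Wx); move: (q z) (q (- z)) => *; lra.
have [c0|c0|<-] := ltgtP 0 c; first exact: sublinear_hom.
  rewrite -[c]opprK scaleNr qN; last exact: WZ.
  by rewrite sublinear_hom ?oppr_gt0// !mulNr.
by rewrite scale0r mul0r (sublinear0 sq Wx).
Qed.
End HahnBanach.

Section MeanIntegrals.
Context (R : realType) (G : groupType) (m : set G -> R).
Hypothesis hm : is_mean m.

Lemma mean0 : m set0 = 0.
Proof.
have [_ _ mU] := hm; have := mU set0 set0 (setI0 _); rewrite setU0.
by move: (m set0) => r *; lra.
Qed.

Lemma mean_bigcup (T : finType) (c : G -> T) (P : pred T) :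
  m [set h | P (c h)] = \sum_(t | P t) m (c @^-1` [set t]).
Proof.
have [_ _ mU] := hm.
suff E s : uniq s -> m [set h | c h \in s] = \sum_(t <- s) m (c @^-1` [set t]).
  rewrite -big_filter -E; last by rewrite filter_uniq// index_enum_uniq.
  by congr m; apply/seteqP; split=> h /=; rewrite mem_filter mem_index_enum andbT.
elim: s => [_|t s IH /= /andP[ts us]].
  by rewrite big_nil -mean0; congr m; apply/seteqP; split.
rewrite big_cons -IH// -mU; last first.
  by apply/seteqP; split=> // h [/= ->] /= h'; move: ts; rewrite h'.
congr m; apply/seteqP; split=> h /=; rewrite inE.
  by case/predU1P; [left|right].
by case=> [->|->]; rewrite ?eqxx ?orbT.
Qed.

Lemma mean_sum_image (T J : finType) (c : G -> T) (psi : T -> J) (phi : J -> R) :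
  \sum_t phi (psi t) * m (c @^-1` [set t]) =
  \sum_j phi j * m ((psi \o c) @^-1` [set j]).
Proof.
rewrite (partition_big psi xpredT)//=; apply: eq_bigr => j _.
rewrite (_ : _ @^-1` _ = [set h | (fun t => psi t == j) (c h)]); last first.
  by apply/seteqP; split=> h /= /eqP.
rewrite (@mean_bigcup _ c (fun t => psi t == j)) mulr_sumr; apply: eq_bigr => t /eqP ->.
by [].
Qed.

Lemma mean_sum1 (T : finType) (c : G -> T) : \sum_t m (c @^-1` [set t]) = 1.
Proof.
have [_ <- _] := hm; rewrite -(mean_bigcup c xpredT).
by congr m; apply/seteqP; split.
Qed.

Lemma mean_sum_ge (T : finType) (c : G -> T) (phi : T -> R) e :
  (forall h, e <= phi (c h)) -> e <= \sum_t phi t * m (c @^-1` [set t]).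
Proof.
move=> he; have [m0 _ _] := hm.
rewrite -[e]mulr1 -(mean_sum1 c) mulr_sumr; apply: ler_sum => t _.
have [->|/set0P[h /= <-]] := eqVneq (c @^-1` [set t]) set0.
  by rewrite mean0 !mulr0.
by rewrite ler_wpM2r.
Qed.

Lemma mean_le (S T : set G) : S `<=` T -> m S <= m T.
Proof.
have [m0 _ mU] := hm => ST.
rewrite -(setDUK ST) mU ?lerDl//.
by apply/seteqP; split=> // x [Sx [_]].
Qed.

Hypothesis minv : forall (g : G) (S : set G), m [set (g * x * g^-1)%g | x in S] = m S.

Lemma mean_conj (T : finType) (c : G -> T) (g : G) t :
  m ((fun h => c (g * h * g^-1)%g) @^-1` [set t]) = m (c @^-1` [set t]).
Proof.
rewrite -[RHS](minv g^-1%g); congr m; apply/seteqP; split=> h /=.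
  move=> <-; exists (g * h * g^-1)%g => //.
  by rewrite invgK !mulgA mulVg mul1g -mulgA mulVg mulg1.
move=> [x cx <-]; rewrite invgK -cx; congr c.
by rewrite !mulgA mulgV mul1g -mulgA mulgV mulg1.
Qed.

(** A mean only measures sets, so it integrates functions through their values
    on a grid: here the points j / N.+1 - 1 of [-1, 1]. *)
Lemma bounded_discretization (f : G -> R) (N : nat) : (forall h, `|f h| <= 1) ->
  exists c : G -> 'I_(2 * N.+1).+1, forall h,
    `|f h - ((c h)%:R / N.+1%:R - 1)| <= N.+1%:R^-1.
Proof.
move=> f1; have N0 : (0 : R) < N.+1%:R by rewrite ltr0n.
have key h : exists j : 'I_(2 * N.+1).+1, `|f h - (j%:R / N.+1%:R - 1)| <= N.+1%:R^-1.
  pose x := (f h + 1) * N.+1%:R; have /andP[fl fu] : -1 <= f h <= 1 by rewrite -ler_norml.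
  have x0 : 0 <= x by apply: (mulr_ge0 _ (ltW N0)); move: fl; lra.
  have xl : x <= 2 * N.+1%:R by rewrite (ler_wpM2r (ltW N0))//; move: fu; lra.
  have /andP[t1 t2] := truncn_itv x0.
  have jl : (Num.truncn x < (2 * N.+1).+1)%N.
    by rewrite ltnS -(ler_nat R) natrM (le_trans t1).
  exists (Ordinal jl) => /=.
  have -> : f h - ((Num.truncn x)%:R / N.+1%:R - 1) = (x - (Num.truncn x)%:R) / N.+1%:R.
    have E (a b : R) : b != 0 -> f h - (a / b - 1) = ((f h + 1) * b - a) / b by move=> b0; field.
    by apply: E; rewrite gt_eqF.
  have Ni : (0 : R) <= N.+1%:R^-1 by rewrite invr_ge0 ltW.
  rewrite normrM (ger0_norm Ni) -[X in _ <= X]mul1r (ler_wpM2r Ni)// ger0_norm ?subr_ge0//.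
  by rewrite lerBlDl -natr1 addrC in t2 *; rewrite ltW// addrC.
by have [c hc] := choice key; exists c.
Qed.

(** The integral of each f (g h g^-1) - f h against the invariant mean vanishes,
    and so does that of \1_Bad - m Bad.  The mean being only finitely additive,
    the functions are discretised first, at a cost of half of e. *)
Lemma no_positive_coboundary (n : nat) (g_ : 'I_n -> G) (f : 'I_n -> G -> R) (Bad : set G) (s e : R) :
  (forall i h, `|f i h| <= 1) -> 0 < e ->
  ~ (forall h, e <= \sum_i (f i (g_ i * h * (g_ i)^-1)%g - f i h) + s * (\1_Bad h - m Bad)).
Proof.
move=> f1 e0 hf; have [m0 m1 mU] := hm.
pose N := Num.truncn (4 * n%:R / e); have N0 : (0 : R) < N.+1%:R by rewrite ltr0n.
have Ne : 2 * n%:R / N.+1%:R <= e / 2.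
  have x0 : 0 <= 4 * n%:R / e by rewrite divr_ge0 ?mulr_ge0// ltW.
  have /andP[_ h] := truncn_itv x0.
  rewrite ler_pdivrMr//; move: h; rewrite -/N ltr_pdivrMr//.
  by rewrite (mulrC _ e) (mulrAC e); move: (e * _) (n%:R : R) => x y h; move: h; lra.
have [b hb] := choice (fun i => bounded_discretization N (f1 i)).
pose I := 'I_(2 * N.+1).+1; pose T := ({ffun 'I_n -> I * I} * bool)%type.
pose c h : T := ([ffun i => (b i (g_ i * h * (g_ i)^-1)%g, b i h)], `[< Bad h >]).
pose val (j : I) : R := j%:R / N.+1%:R - 1.
pose phi (t : T) : R := \sum_i (val (t.1 i).1 - val (t.1 i).2) + s * ((t.2 : nat)%:R - m Bad).
have : e / 2 <= \sum_t phi t * m (c @^-1` [set t]).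
  apply: mean_sum_ge => h; have := hf h.
  have -> : \1_Bad h = (`[< Bad h >] : nat)%:R :> R.
    by rewrite indicE; congr (_%:R); congr nat_of_bool; apply/asboolP/asboolP; rewrite inE.
  rewrite /phi /=; move: (s * _) => z h1.
  have : \sum_i (f i (g_ i * h * (g_ i)^-1)%g - f i h) <=
    \sum_i (val (b i (g_ i * h * (g_ i)^-1)%g) - val (b i h) + 2 / N.+1%:R).
    apply: ler_sum => i _.
    have := hb i (g_ i * h * (g_ i)^-1)%g; have := hb i h; rewrite -/(val _) -/(val _) !ler_norml.
    by move: (val _) (val _) (f i _) (f i _) (N.+1%:R^-1 : R) => *; lra.
  rewrite [X in _ <= X -> _]big_split /= [X in _ <= _ + X -> _]sumr_const card_ord -[_ *+ n]mulr_natr mulrAC.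
  under [in X in _ -> _ <= X]eq_bigr do rewrite ffunE /=.
  by move: Ne h1; move: (2 * _ / _) (\sum_i _) (\sum_i _) => *; lra.
have -> : \sum_t phi t * m (c @^-1` [set t]) = 0; last by rewrite leNgt divr_gt0.
pose w t := m (c @^-1` [set t]).
have -> : \sum_t phi t * m (c @^-1` [set t]) =
   \sum_i (\sum_(t : T) val (t.1 i).1 * w t - \sum_(t : T) val (t.1 i).2 * w t) +
   s * (\sum_(t : T) (t.2 : nat)%:R * w t - m Bad * \sum_t w t).
  rewrite mulrBr [in X in _ + (X - _)]mulr_sumr mulr_sumr mulr_sumr -sumrB.
  under [in X in _ = X + _]eq_bigr do rewrite -sumrB.
  rewrite [X in _ = X + _]exchange_big -big_split; apply: eq_bigr => t _ /=.
  rewrite /phi mulrDl mulr_suml; congr (_ + _); last by rewrite /w; ring.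
  by apply: eq_bigr => i _; rewrite mulrBl.
rewrite mean_sum1 mulr1 big1 ?add0r => [|i _].
  rewrite (mean_sum_image c snd (fun b : bool => (b : nat)%:R)) big_bool /= mul1r mul0r addr0.
  rewrite (_ : _ @^-1` _ = Bad) ?subrr ?mulr0//.
  by apply/seteqP; split=> h /= /asboolP.
rewrite (mean_sum_image c (fun t : T => (t.1 i).1) val) (mean_sum_image c (fun t : T => (t.1 i).2) val).
apply/eqP; rewrite subr_eq0; apply/eqP; apply: eq_bigr => j _; congr (_ * _).
rewrite -[RHS](mean_conj _ (g_ i)); congr m; apply/seteqP; split=> h /=; by rewrite !ffunE.
Qed.
End MeanIntegrals.

(** * Almost invariant measures *)

Section MoreFiniteSums.
Context (R : realType) (T : choiceType).
Implicit Types (a b : T -> R).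

Lemma fsum_inj_le (U : choiceType) (phi : U -> T) a : injective phi ->
  fsupp a -> fsupp (a \o phi) -> (forall t, 0 <= a t) -> fsum (a \o phi) <= fsum a.
Proof.
move=> phi_inj ha hb a0; have [S [uS aS _]] := fsum_seq2 ha ha.
have [S' [uS' aS' _]] := fsum_seq2 hb hb.
rewrite (fsum_seq uS' aS').
rewrite (@fsum_seq _ _ a (map phi S' ++ [seq t <- S | t \notin map phi S'])).
- by rewrite big_cat big_map/= lerDl sumr_ge0.
- rewrite cat_uniq map_inj_uniq// uS' filter_uniq// andbT /=.
  by apply/hasPn => t; rewrite mem_filter => /andP[].
- move=> t; rewrite mem_cat mem_filter; case: (t \in map phi S') => //= tS.
  exact: aS.
Qed.

Lemma fsum_ge_term a t : fsupp a -> (forall t, 0 <= a t) -> a t <= fsum a.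
Proof.
move=> ha a0; have hb : fsupp (a \o (fun _ : unit => t)).
  by exists [:: tt] => -[]; rewrite inE.
have := fsum_inj_le (phi := fun _ : unit => t) _ ha hb a0.
rewrite (@fsum_seq _ _ (a \o fun=> t) [:: tt])//.
by rewrite big_seq1; apply; case; case.
Qed.

Lemma fsupp_comp a (phi : R -> R) : phi 0 = 0 -> fsupp a -> fsupp (fun t => phi (a t)).
Proof. by move=> p0 [S aS]; exists S => h hS; rewrite aS. Qed.

Definition point_mass (t : T) : T -> R := fun t' => (t == t')%:R.

Lemma fsupp_point_mass t : fsupp (point_mass t).
Proof.
by exists [:: t] => t'; rewrite inE /point_mass eq_sym => /negPf ->.
Qed.

Lemma fsum_point_mass t (a : T -> R) : fsum (fun t' => point_mass t t' * a t') = a t.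
Proof.
rewrite (@fsum_seq _ _ _ [:: t])// ?big_seq1 /point_mass ?eqxx ?mul1r//.
by move=> t'; rewrite inE eq_sym => /negPf ->; rewrite mul0r.
Qed.

Definition norm1 a : R := fsum (fun t => `|a t|).

Lemma fsupp_norm a : fsupp a -> fsupp (fun t => `|a t|).
Proof. by apply: (fsupp_comp (phi := Num.norm)); rewrite normr0. Qed.

Lemma norm1D a b : fsupp a -> fsupp b -> norm1 (fun t => a t + b t) <= norm1 a + norm1 b.
Proof.
move=> ha hb; rewrite /norm1 -fsumD; [|exact: fsupp_norm..].
apply: fsum_le; [exact/fsupp_norm/fsuppD|by apply: fsuppD; exact: fsupp_norm|].
by move=> t; exact: ler_normD.
Qed.

Lemma norm1Z r a : fsupp a -> norm1 (fun t => r * a t) = `|r| * norm1 a.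
Proof.
move=> ha; rewrite /norm1 -fsumZ; last exact: fsupp_norm.
by congr fsum; apply/funext => t; rewrite normrM.
Qed.
End MoreFiniteSums.
Arguments point_mass {R T}.

Section ApproximateInvariance.
Context (R : realType) (G : groupType) (m : set G -> R).
Hypothesis hm : is_mean m.
Hypothesis minv : forall (g : G) (S : set G), m [set (g * x * g^-1)%g | x in S] = m S.
Context (n : nat) (g_ : 'I_n -> G) (Bad : set G).

Let T := option ('I_n * G).
Let V : lmodType R := T -> R^o.
Let W : set V := [set v | fsupp (v : T -> R)].

(** One vector of l^1 collects everything that nu should make small: the failure
    of invariance under each g_ i, and the error in the measure of Bad. *)
Definition defect (nu : G -> R) : T -> R := fun t =>
  match t with
  | Some (i, k) => nu (conjg k (g_ i)) - nu k
  | None => fsum (fun h => nu h * (\1_Bad h - m Bad))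
  end.

Lemma fsuppM (a b : G -> R) : fsupp a -> fsupp (fun h => a h * b h).
Proof. by move=> [S aS]; exists S => h hS; rewrite aS// mul0r. Qed.

Lemma fsupp_conj (nu : G -> R) g : fsupp nu -> fsupp (fun k => nu (conjg k g)).
Proof.
apply: (@fsupp_reindex _ _ nu (fun k => conjg k g) (fun k => conjg k g^-1%g)) => k.
  by rewrite conjgK.
by rewrite conjgKV.
Qed.

Lemma fsupp_defect nu : fsupp nu -> fsupp (defect nu).
Proof.
move=> hnu; have [S_ hS] := choice (fun i => fsuppD (fsupp_conj (g_ i) hnu) (fsuppZ (-1) hnu)).
exists (None :: flatten [seq [seq Some (i, k) | k <- S_ i] | i <- enum 'I_n]).
case=> [[i k]|]; rewrite !inE ?eqxx//= => h; rewrite -[- _]mulN1r; apply: hS.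
apply: contra h => kS; apply/flattenP; exists [seq Some (i, k) | k <- S_ i].
  by apply/mapP; exists i; rewrite ?mem_enum.
exact: (map_f (fun k => Some (i, k))).
Qed.

Lemma defectD nu nu' : fsupp nu -> fsupp nu' ->
  defect (fun h => nu h + nu' h) = fun t => defect nu t + defect nu' t.
Proof.
move=> h h'; apply/funext => -[[i k]|] /=; first by rewrite opprD addrACA.
rewrite -fsumD; [|exact: fsuppM..].
by congr fsum; apply/funext => x; rewrite mulrDl.
Qed.

Lemma defectZ r nu : fsupp nu -> defect (fun h => r * nu h) = fun t => r * defect nu t.
Proof.
move=> h; apply/funext => -[[i k]|] /=; first by rewrite mulrBr.
rewrite -fsumZ; last exact: fsuppM.
by congr fsum; apply/funext => x; rewrite mulrA.
Qed.

Lemma defect_point_mass h : defect (point_mass h) = fun t =>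
  \sum_i (point_mass (Some (i, (g_ i * h * (g_ i)^-1)%g)) t - point_mass (Some (i, h)) t) +
  (\1_Bad h - m Bad) * point_mass (None : T) t.
Proof.
apply/funext => -[[i k]|] /=; last first.
  by rewrite fsum_point_mass /point_mass eqxx mulr1 big1 ?add0r// => i _; rewrite /= subr0.
have -> : point_mass (None : T) (Some (i, k)) = 0 :> R by [].
rewrite mulr0 addr0 (bigD1 i)//= [X in _ = _ + X]big1 ?addr0 => [|j ji].
  congr (_ - _); rewrite /point_mass; congr (nat_of_bool _)%:R.
    apply/eqP/eqP => [->|[<-]]; first by rewrite /conjg !mulgA mulgV mul1g -mulgA mulgV mulg1.
    by rewrite /conjg !mulgA mulVg mul1g -mulgA mulVg mulg1.
  by apply/eqP/eqP => [->//|[]].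
have E k1 : (Some (j, k1) == Some (i, k) :> T) = false by apply/eqP => -[e]; rewrite e eqxx in ji.
by rewrite /point_mass !E subr0.
Qed.

(** If the l^1 norm of the defect were bounded below on probability measures,
    Hahn-Banach would separate it from 0.  The separating functional, evaluated
    at point masses, would contradict no_positive_coboundary. *)
Lemma small_defect (e : R) : 0 < e -> exists nu : G -> R,
  [/\ fsupp nu, forall h, 0 <= nu h, fsum nu = 1 & norm1 (defect nu) <= e].
Proof.
move=> e0; apply: contrapT => no.
(* By homogeneity the defect is bounded below by e times the mass. *)
have low nu : fsupp nu -> (forall h, 0 <= nu h) -> e * fsum nu <= norm1 (defect nu).
  move=> hnu nu0; rewrite leNgt; apply/negP => lt; apply: no.
  have := fsum_ge0 nu0; rewrite le_eqVlt => /predU1P[z|s0].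
    move: lt; rewrite -z mulr0 ltNge => /negP[].
    by apply: fsum_ge0 => t; exact: normr_ge0.
  have si : 0 < (fsum nu)^-1 by rewrite invr_gt0.
  exists (fun h => (fsum nu)^-1 * nu h); split.
  - exact: fsuppZ.
  - by move=> h; rewrite mulr_ge0// ltW.
  - by rewrite fsumZ// mulVf// gt_eqF.
  - rewrite defectZ// norm1Z; last exact: fsupp_defect.
    by rewrite gtr0_norm// ler_pdivrMl// mulrC ltW.
pose Nu : set (G -> R) := [set nu | fsupp nu /\ forall h, 0 <= nu h].
pose S (v : V) := [set norm1 (fun t => v t + defect nu t) - e * fsum nu | nu in Nu].
have Nu0 : Nu (fun=> 0) by split=> //; exists [::].
have Sn v : S v !=set0 by exists (norm1 (fun t => v t + defect (fun=> 0) t) - e * fsum (fun _ : G => 0)), (fun=> 0).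
have WD x y : W x -> W y -> W (x + y) by move=> hx hy; exact: fsuppD hx hy.
have WZ (c : R) x : W x -> W (c *: x) by move=> hx; exact: (@fsuppZ R T c x hx).
have Sl v : W v -> has_lbound (S v).
  move=> Wv; exists (- norm1 v) => _ [nu [hnu nu0] <-].
  have := low nu hnu nu0; have hd := fsupp_defect hnu.
  have := norm1D (fsuppD Wv hd) (fsuppZ (-1) Wv); rewrite norm1Z// normrN1 mul1r.
  rewrite (_ : (fun t => _) = defect nu); last by apply/funext => t; rewrite mulN1r addrAC subrr add0r.
  by move: (norm1 _) (norm1 _) (norm1 _) (e * _) => *; lra.
(* The gauge of the cone of defects; the term e keeps f positive on it. *)
pose p v := inf (S v).
have sp : sublinear W p.
  split=> [x y Wx Wy|c x c0 Wx].
    apply: le_infD => // _ _ [nu [hnu nu0] <-] [nu' [hnu' nu'0] <-].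
    have hd := fsupp_defect hnu; have hd' := fsupp_defect hnu'.
    apply: (@le_trans _ _ (norm1 (fun t => (x + y) t + defect (fun h => nu h + nu' h) t) - e * fsum (fun h => nu h + nu' h))).
      apply: ge_inf; first exact/Sl/WD.
      by exists (fun h => nu h + nu' h) => //; split; [exact: fsuppD|move=> h; rewrite addr_ge0].
    rewrite fsumD// defectD//; have := norm1D (fsuppD Wx hd) (fsuppD Wy hd').
    rewrite (_ : (fun t => (x + y) t + _) = (fun t => x t + defect nu t + (y t + defect nu' t))).
      by rewrite mulrDr; move: (norm1 _) (norm1 _) (norm1 _) (e * _) (e * _) => *; lra.
    by apply/funext => t; rewrite addrACA.
  apply: le_infZ => // _ [nu [hnu nu0] <-]; have hd := fsupp_defect hnu.
  apply: (@le_trans _ _ (norm1 (fun t => (c *: x) t + defect (fun h => c * nu h) t) - e * fsum (fun h => c * nu h))).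
    apply: ge_inf; first exact/Sl/WZ.
    exists (fun h => c * nu h) => //; split; first exact: fsuppZ.
    by move=> h; rewrite mulr_ge0// ltW.
  rewrite fsumZ// defectZ// (_ : (fun t => (c *: x) t + _) = (fun t => c * (x t + defect nu t))).
    by rewrite norm1Z ?gtr0_norm//; [rewrite mulrBr mulrCA|exact: fsuppD].
  by apply/funext => t; rewrite mulrDr.
have [f [fD fZ fp]] := hahn_banach WD WZ sp.
have pm t : W (point_mass t) by exact: fsupp_point_mass.
have f0 : f 0 = 0 by have := fZ 0 _ (pm None); rewrite scale0r mul0r.
have fsumE (I : Type) (r : seq I) (v : I -> V) : (forall i, W (v i)) ->
    W (\sum_(i <- r) v i) /\ f (\sum_(i <- r) v i) = \sum_(i <- r) f (v i).
  move=> Wv; elim: r => [|i r [IH1 IH2]].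
    by rewrite !big_nil f0; split=> //; exists [::].
  by rewrite !big_cons fD ?IH2//; split=> //; exact: WD.
have fle v : W v -> f v <= norm1 v.
  move=> Wv; apply: (le_trans (fp v Wv)); apply: ge_inf; first exact: Sl.
  exists (fun=> 0) => //; rewrite fsum0 mulr0 subr0; congr norm1; apply/funext => t.
  rewrite (_ : defect _ t = 0) ?addr0//; case: t => [[i k]|] /=; first by rewrite subrr.
  by rewrite -[RHS](fsum0 R G); congr fsum; apply/funext => h; rewrite mul0r.
have fbd t : `|f (point_mass t)| <= 1.
  have n1 : norm1 (point_mass (R := R) t) = 1.
    rewrite -[RHS](fsum_point_mass (R := R) t (fun=> 1)); congr fsum; apply/funext => t'.
    by rewrite mulr1 ger0_norm.
  have h1 := fle _ (pm t).
  have := fle _ (WZ (-1) _ (pm t)); rewrite fZ// -[norm1 _]/(norm1 (fun t' => -1 * point_mass t t')).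
  rewrite norm1Z; last exact: fsupp_point_mass.
  rewrite normrN1 mul1r n1 in h1 *; rewrite ler_norml h1 andbT mulN1r.
  by rewrite lerNl.
apply: (@no_positive_coboundary R G m hm minv n g_ (fun i h => f (point_mass (Some (i, h)))) Bad (f (point_mass None)) e) => // h.
have Wd : W (defect (point_mass h)) by exact/fsupp_defect/fsupp_point_mass.
have : e <= f (defect (point_mass h)).
  have := fp _ (WZ (-1) _ Wd); rewrite fZ// mulN1r => h1; rewrite -lerN2 (le_trans h1)//.
  apply: ge_inf; first exact/Sl/WZ.
  exists (point_mass h); first by split=> [|k]; [exact: fsupp_point_mass|rewrite /point_mass].
  rewrite (_ : norm1 _ = 0) ?sub0r.
    rewrite (_ : fsum _ = 1) ?mulr1//.
    by rewrite -[RHS](fsum_point_mass (R := R) h (fun=> 1)); congr fsum; apply/funext => k; rewrite mulr1.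
  rewrite -[RHS](fsum0 R T); congr fsum; apply/funext => t.
  change (`| -1 * defect (point_mass h) t + defect (point_mass h) t| = 0).
  by rewrite mulN1r addNr normr0.
pose v i : V := point_mass (Some (i, (g_ i * h * (g_ i)^-1)%g)) + -1 *: (point_mass (Some (i, h)) : V).
have Wv i : W (v i) by apply: WD => //; exact: WZ.
have -> : (defect (point_mass h) : V) = \sum_i v i + (\1_Bad h - m Bad) *: (point_mass None : V).
  rewrite defect_point_mass; apply/funext => t; rewrite fctE fct_sumE; congr (_ + _).
  by apply: eq_bigr => i _; rewrite -[- _]mulN1r.
have [WS fS] : W (\sum_i v i) /\ f (\sum_i v i) = \sum_i f (v i) by exact: fsumE.
rewrite fD ?fZ ?fS//; last exact: WZ.
move=> /le_trans; apply; rewrite mulrC lerD2r; apply: ler_sum => i _.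
by rewrite /v fD ?fZ// ?mulN1r//; exact: WZ.
Qed.
End ApproximateInvariance.

(** Day's convexity argument for the conjugation action.  The set Bad is carried
    along because the measure is later tested on it. *)
Lemma near_invariant_measure (R : realType) (G : groupType) (m : set G -> R) (F : seq G) (Bad : set G) (e : R) :
  is_mean m -> (forall (g : G) (S : set G), m [set (g * x * g^-1)%g | x in S] = m S) -> 0 < e ->
  exists nu : G -> R, [/\ fsupp nu, forall h, 0 <= nu h, fsum nu = 1,
    forall g, g \in F -> fsum (fun h => `|nu (conjg h g) - nu h|) <= e &
    m Bad - e <= fsum (fun h => nu h * \1_Bad h)].
Proof.
move=> hm minv e0; pose g_ (i : 'I_(size F)) := tnth (in_tuple F) i.
have [nu [hnu nu0 nu1 hd]] := small_defect hm minv g_ Bad e0.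
have fd := fsupp_norm (fsupp_defect m g_ Bad hnu).
exists nu; split=> //.
  move=> g /(tnthP (in_tuple F))[i ->]; apply: le_trans hd.
  apply: (@fsum_inj_le _ _ _ (fun k => Some (i, k)) _ _ fd) => //.
    by move=> k k' [].
  apply: fsupp_norm; rewrite /=; have := fsuppD (fsupp_conj (g_ i) hnu) (fsuppZ (-1) hnu).
  by congr fsupp; apply/funext => k; rewrite mulN1r.
have := le_trans (fsum_ge_term None fd (fun=> normr_ge0 _)) hd.
rewrite /= ler_norml => /andP[+ _].
have -> : (fun h => nu h * (\1_Bad h - m Bad)) = (fun h => nu h * \1_Bad h + - m Bad * nu h).
  by apply/funext => h; rewrite mulrBr mulNr mulrC [m Bad * _]mulrC.
rewrite fsumD; [|exact: fsuppM|exact: fsuppZ].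
by rewrite fsumZ// nu1; move: (fsum _) => *; lra.
Qed.

(** * Almost equivariant fields and mixing *)

Section Means.
Context (R : realType) (G : groupType) (m : set G -> R).
Hypotheses (hm : is_mean m) (m1 : forall g, m [set g] = 0).

Lemma mean_setC S : m (~` S) = 1 - m S.
Proof.
have [_ <- mU] := hm; rewrite -[in RHS](setvU S) mU ?addrK//.
exact: setICl.
Qed.

Lemma mean_seq (s : seq G) : m [set` s] = 0.
Proof.
have [m0 _ mU] := hm; elim: s => [|x s IH].
  by rewrite -(mean0 hm); congr m; apply/seteqP; split.
apply/eqP; rewrite eq_le m0 andbT.
have -> : [set` x :: s] = [set x] `|` ([set` s] `\` [set x]).
  apply/seteqP; split=> y /=; rewrite inE.
    by have [->|yx /= ys] := eqVneq y x; [left|right; split=> // e; rewrite e eqxx in yx].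
  by case=> [->|[->]]; rewrite ?eqxx ?orbT.
by rewrite mU ?setDIK// m1 add0r -IH mean_le.
Qed.

Lemma positive_mean_sequence S : 0 < m S -> exists h_ : nat -> G, injective h_ /\ forall n, S (h_ n).
Proof.
move=> mS; have /infiniteP/card_leP[f] : infinite_set S.
  by move=> /finite_seqP[s e]; move: mS; rewrite e mean_seq ltxx.
exists (fun n => val (f (SigSub (mem_set (I : [set: nat] n))))); split=> [x y /val_inj|n].
  by move/(@inj _ _ _ f) => /(_ (mem_set I) (mem_set I)) [].
by apply: set_mem; exact: valP.
Qed.

Lemma mean_two_large (S S' : set G) : 2 / 3 <= m S -> 2 / 3 <= m S' -> 0 < m (S `&` S').
Proof.
have [m0 _ mU] := hm => h h'.
have := mean_setC S'; have := mean_le hm (@subIsetr _ S (~` S')).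
have : m S = m (S `&` S') + m (S `&` ~` S').
  by rewrite -mU -?setIUr ?setUv ?setIT// setIACA setICr setI0.
by move: h h'; move: (m S) (m S') (m (~` S')) (m _) (m _) => *; lra.
Qed.
End Means.

Section LargeSet.
Context (R : realType) (G : groupType) (m : set G -> R).
Hypothesis hm : is_mean m.
Hypothesis minv : forall (g : G) (S : set G), m [set (g * x * g^-1)%g | x in S] = m S.
Context (X K : hilbert R) (pi : G -> op X) (hpi : unitary_rep pi).
Context (delta : G -> K) (lambda : G -> op K).
Context (reg : is_left_regular delta lambda).
Hypothesis weak : forall (s : seq (R * G)) (c : R), fnonneg s -> 0 < c ->
  opbd (frep lambda s) c -> opbd (frep pi s) c.

Lemma sqrt_diff_sq (a b : R) : 0 <= a -> 0 <= b ->
  (Num.sqrt a - Num.sqrt b) ^+ 2 <= `|a - b|.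
Proof.
move=> a0 b0; rewrite -{2}(sqr_sqrtr a0) -{2}(sqr_sqrtr b0) subr_sqr normrM expr2.
have sa := sqrtr_ge0 a; have sb := sqrtr_ge0 b.
rewrite -expr2 -real_normK ?num_real// expr2 ler_wpM2l//.
rewrite (ger0_norm (addr_ge0 sa sb)) ler_norml.
by move: sa sb; move: (Num.sqrt a) (Num.sqrt b) => *; apply/andP; split; lra.
Qed.

Lemma rep_isometry g x : hnorm (pi g x) = hnorm x.
Proof.
have [_ p1 pM pa] := hpi.
apply/eqP; rewrite -(@eqrXn2 _ 2) ?hnorm_ge0// !sqr_hnorm pa.
by rewrite -[pi _ (pi _ _)]/((pi g^-1%g \o pi g) x) -pM mulVg p1.
Qed.

(** Weighting xi by the square roots of an almost invariant measure gives a
    finitely supported field that is almost fixed by F, hence small; its size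
    bounds the measure of the set where xi exceeds r. *)
Lemma large_set_small_mean (F : seq G) (rho eta r : R) (xi : G -> X) :
  (0 < size F)%N -> 0 < rho -> rho < 1 ->
  (forall v, hnorm (\sum_(g <- F) lambda g v) <= rho * (size F)%:R * hnorm v) ->
  (forall h, hnorm (xi h) <= 2) -> 0 <= eta -> 0 <= r ->
  (forall g h, g \in F -> hnorm (pi g (xi (conjg h g)) - xi h) <= eta) ->
  (1 - rho) * r ^+ 2 * m [set h | r < hnorm (xi h)] <= eta ^+ 2.
Proof.
move=> F0 rho0 rho1 gap xi2 eta0 r0 heta; set Bad := [set h | _].
have key (e : R) : 0 < e ->
    (1 - rho) * r ^+ 2 * m Bad <= eta ^+ 2 + (4 + (1 - rho) * r ^+ 2) * e.
  move=> e0; have [nu [hnu nu0 nu1 hF hB]] := near_invariant_measure F Bad hm minv e0.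
  pose z h := rc (Num.sqrt (nu h)) *: xi h.
  have hz : fin z by case: hnu => S hS; exists S => h /hS e1; rewrite /z e1 sqrtr0 rc0 scale0r.
  have nuc g := fsupp_conj g hnu.
  have small : (1 - rho) * ip z z <= (8 * e + 2 * eta ^+ 2) / 2.
    apply: (almost_invariant_field_small hpi reg weak F0 rho0 gap hz) => g gF.
    have fd : fsupp (fun h => `|nu (conjg h g) - nu h|).
      apply: fsupp_norm; have := fsuppD (nuc g) (fsuppZ (-1) hnu).
      by congr fsupp; apply/funext => k; rewrite mulN1r.
    apply: (@le_trans _ _ (fsum (fun h => 8 * `|nu (conjg h g) - nu h| + 2 * eta ^+ 2 * nu h))).
      apply: fsum_le.
      - by apply: fin_ip; apply: finD; [exact: fin_fact|case: hz => S hS; exists S => h /hS ->; rewrite oppr0].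
      - by apply: fsuppD; exact: fsuppZ.
      move=> h; rewrite -sqr_hnorm /fact /z (linZ (rep_linear hpi _)).
      set a := Num.sqrt _; set b := Num.sqrt _; set y := pi g _.
      have -> : rc a *: y - rc b *: xi h = rc (a - b) *: y + rc b *: (y - xi h).
        by rewrite rcD rcN scalerBr scalerDl scaleNr addrA subrK.
      have y2 : hnorm y ^+ 2 <= 4.
        rewrite (_ : 4 = 2 ^+ 2) ?lerXn2r ?nnegrE ?hnorm_ge0//; last by rewrite expr2 -natrM.
        by rewrite /y rep_isometry.
      have d2 : hnorm (y - xi h) ^+ 2 <= eta ^+ 2 by rewrite lerXn2r ?nnegrE ?hnorm_ge0// heta.
      have ab := sqrt_diff_sq (nu0 (conjg h g)) (nu0 h); rewrite -/a -/b in ab.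
      have b2 : b ^+ 2 = nu h by rewrite /b sqr_sqrtr.
      have p1 := parallelogram (rc (a - b) *: y) (rc b *: (y - xi h)).
      have := sqr_ge0 (hnorm (rc (a - b) *: y - rc b *: (y - xi h))); rewrite p1.
      rewrite !hnormZr !exprMn !real_normK ?num_real//.
      have q1 : (a - b) ^+ 2 * hnorm y ^+ 2 <= `|nu (conjg h g) - nu h| * 4.
        by apply: ler_pM => //; exact: sqr_ge0.
      have q2 : b ^+ 2 * hnorm (y - xi h) ^+ 2 <= eta ^+ 2 * nu h.
        by rewrite b2 mulrC ler_wpM2r.
      move: q1 q2; rewrite -(mulrA 2 (eta ^+ 2)).
      move: ((a - b) ^+ 2 * _) (b ^+ 2 * _) (`|nu _ - _|) (eta ^+ 2 * _).
      by move: (hnorm (_ + _) ^+ 2) => *; lra.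
    rewrite fsumD; [|exact: fsuppZ..]; rewrite !fsumZ// nu1 mulr1 lerD2r ler_pM2l//.
    exact: hF.
  have large : r ^+ 2 * (m Bad - e) <= ip z z.
    apply: (@le_trans _ _ (r ^+ 2 * fsum (fun h => nu h * \1_Bad h))).
      by rewrite ler_wpM2l// sqr_ge0.
    have fb : fsupp (fun h => nu h * \1_Bad h) by exact: fsuppM.
    rewrite -fsumZ//; apply: fsum_le; [exact: fsuppZ|exact: fin_ip|] => h.
    rewrite -sqr_hnorm /z hnormZr exprMn real_normK ?num_real// sqr_sqrtr// indicE.
    have [hB'|hB'] := boolP (h \in Bad); last by rewrite /= !mulr0 mulr_ge0// sqr_ge0.
    rewrite mulr1 mulrC ler_wpM2l// lerXn2r ?nnegrE ?hnorm_ge0// ltW//.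
    by rewrite inE in hB'.
  have r1 : 0 <= 1 - rho by rewrite subr_ge0 ltW.
  have := ler_wpM2l r1 large => h1; have := le_trans h1 small.
  rewrite mulrA mulrBr mulrDl; move: ((1 - rho) * r ^+ 2) (eta ^+ 2) => A B.
  by move: (A * m Bad) (A * e) => *; lra.
apply/ler_addgt0Pr => e e0; set A := (1 - rho) * r ^+ 2 in key *.
have A0 : 0 < 4 + A by rewrite ltr_wpDr// mulr_ge0 ?sqr_ge0// subr_ge0 ltW.
have := key (e / (4 + A)); rewrite mulrCA divff ?gt_eqF// mulr1; apply.
exact: divr_gt0.
Qed.
End LargeSet.

Section Mixing.
Context (R : realType) (H : hilbert R) (M : set (op H)) (vM : von_neumann M).
Context (tau : op H -> R[i]) (ft : faithful_normal_trace M tau).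

Lemma tr_scalar c : tau (fun v => c *: v) = c.
Proof. by rewrite (trZ vM ft c (vN_id vM)) (tr1 ft) mulr1. Qed.

Lemma trace_is_cond_exp : is_cond_exp M (@scalars R H) tau (fun x v => tau x *: v).
Proof.
split.
- by move=> x Mx; exists (tau x).
- by move=> _ [c ->]; rewrite tr_scalar.
- move=> v c x y Mx My; rewrite (trD ft) ?(trZ vM ft)//; last exact: vN_scale.
  by rewrite scalerDl scalerA.
- move=> x Mx v; rewrite dotp0l dotpZl dotp_hnorm.
  case: ft => _ [h _ _ _ _]; rewrite mulr_ge0// ?h//.
  by rewrite lecE /= eqxx sqr_ge0.
split; last by move=> x Mx; rewrite tr_scalar.
move=> _ x _ [a ->] Mx [b ->]; apply/funext => v /=; have lx := vN_linear vM Mx.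
have -> : (fun v0 => a *: v0) \o x \o (fun v0 => b *: v0) = fun v => (a * b) *: x v.
  by apply/funext => w /=; rewrite (linZ lx) scalerA.
by rewrite (trZ vM ft)// !scalerA mulrAC.
Qed.

(** The conditional expectation onto the scalars is determined on M by preserving
    the trace. *)
Lemma norm2_cond_exp_scalars x : M x ->
  norm2 tau (cond_exp M (@scalars R H) tau x) = modulus (tau x).
Proof.
move=> Mx; have [E1 _ _ _ [_ E5]] := xgetPex (id : op H -> op H) (ex_intro _ _ trace_is_cond_exp).
rewrite -/(cond_exp M (@scalars R H) tau) in E1 E5.
have [c hc] := E1 x Mx; have := E5 x Mx; rewrite hc tr_scalar => <-.
have Mc : M (fun v => c *: v) := vN_scale vM c (vN_id vM).
have ac : adj (fun v : H => c *: v) = fun v => Num.conj c *: v.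
  apply: adj_unique; first exact: (vN_bounded vM Mc).
  by move=> v w; rewrite /rdot dotpZl dotpZr conjCK.
rewrite /norm2 ac [_ \o _](_ : _ = fun v => (Num.conj c * c) *: v); last first.
  by apply/funext => v /=; rewrite scalerA.
rewrite tr_scalar cReM cRe_conj cIm_conj mulNr opprK -!expr2.
by rewrite modulusE.
Qed.
End Mixing.

(** * The odd part of the deformation *)

Section Deformation.
Context (R : realType) (H : hilbert R) (M Mt : set (op H)).
Context (vM : von_neumann M) (vMt : von_neumann Mt) (MMt : M `<=` Mt).
Context (tau : op H -> R[i]) (ftM : faithful_normal_trace M tau).
Context (ft : faithful_normal_trace Mt tau).
Context (L : bimodule Mt) (hat : op H -> L) (hL : is_L2 tau hat).
Context (alpha : R -> op H -> op H).
Hypothesis aut : forall t, trace_aut Mt tau (alpha t).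
Hypothesis alpha0 : forall x, Mt x -> alpha 0 x = x.
Hypothesis alphaD : forall s t x, Mt x -> alpha (s + t) x = alpha s (alpha t x).
Context (beta : op H -> op H) (bet : trace_aut Mt tau beta).
Hypothesis beta_M : forall x, M x -> beta x = x.
Hypothesis beta_alpha : forall t x, Mt x -> beta (alpha t x) = alpha (- t) (beta x).

Let iso t : star_iso Mt Mt (alpha t) := (aut t).1.
Let alphaM t x : Mt x -> Mt (alpha t x). Proof. exact: (iso_mem (iso t)). Qed.

Definition disp t x := hnorm (hat (alpha t x) - hat x).

Lemma disp_hat t x : Mt x -> disp t x = hnorm (hat (fun v => alpha t x v - x v)).
Proof. by move=> Mx; rewrite (hatB hL)//; exact: alphaM. Qed.

Lemma disp_adj t x : Mt x -> disp t (adj x) = disp t x.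
Proof.
move=> Mx; have Ma := vN_adj vMt Mx; have Max := alphaM t Mx.
rewrite !disp_hat// (iso_adj (iso t))// -[RHS](hat_adj vMt ft hL); last exact: vN_sub.
congr (hnorm (hat _)); symmetry; apply: adj_unique.
  by apply: (vN_bounded vMt); exact: vN_sub.
move=> v w; rewrite rdotBl rdotBr; congr (_ - _).
  by rewrite rdot_adj//; exact: (vN_bounded vMt).
by rewrite rdot_adj//; exact: (vN_bounded vMt).
Qed.

Lemma disp_opp t x : Mt x -> disp (- t) x = disp t x.
Proof.
move=> Mx; rewrite !disp_hat//.
rewrite -(hat_aut vMt hL (aut t)); last by apply: vN_sub => //; exact: alphaM.
rewrite (isoB (iso t))//; last exact: alphaM.
rewrite -alphaD// subrr alpha0// !(hatB hL)//; try exact: alphaM.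
exact: hnorm_distC.
Qed.

(** Unlike alpha t x - x, the odd part is orthogonal to M, since beta exchanges its
    two terms and fixes M.  Applying alpha t to it gives the displacement at
    time 2 t, so nothing is lost. *)
Definition oddpart t x : op H := fun v => alpha t x v - alpha (- t) x v.

Lemma oddpart_mem t x : Mt x -> Mt (oddpart t x).
Proof. by move=> Mx; apply: vN_sub => //; exact: alphaM. Qed.

Lemma hnorm_oddpart t x : Mt x -> hnorm (hat (oddpart t x)) = disp (t + t) x.
Proof.
move=> Mx; rewrite disp_hat// -(hat_aut vMt hL (aut t)); last exact: oddpart_mem.
rewrite (isoB (iso t)); [|exact: alphaM..].
by rewrite -!alphaD// subrr alpha0.
Qed.

Lemma oddpart_orth t x y : M x -> M y -> dotp (hat (oddpart t x)) (hat y) = 0.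
Proof.
move=> Mx My; have Mtx := MMt Mx; have Mty := MMt My; have Ma := vN_adj vM My.
rewrite (hatB hL) ?dotpBl; [|exact: alphaM..].
rewrite !(dotp_hat hL)//; [|exact: alphaM..].
have [biso btr] := bet.
have Mc : Mt (adj y \o alpha t x) by apply: (vN_comp vMt); [exact: MMt|exact: alphaM].
rewrite -(btr _ Mc) (isoM biso (MMt Ma) (alphaM t Mtx)) (beta_M Ma) (beta_alpha t Mtx) (beta_M Mx).
exact: subrr.
Qed.

(** Telescoping a x b - a' x b' = (a - a') x b + a' x (b - b'). *)
Lemma hat_sandwich (a a' b b' x : op H) : Mt a -> Mt a' -> Mt b -> Mt b' -> Mt x ->
  opbd a' 1 -> opbd b 1 -> opbd x 1 ->
  hnorm (hat (a \o x \o b) - hat (a' \o x \o b')) <= hnorm (hat a - hat a') + hnorm (hat b - hat b').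
Proof.
move=> Ma Ma' Mb Mb' Mx a1 b1 x1.
have Mxb := vN_comp vMt Mx Mb; have Max := vN_comp vMt Ma' Mx.
have M1 := vN_comp vMt (vN_comp vMt Ma Mx) Mb.
have M2 := vN_comp vMt Max Mb; have M3 := vN_comp vMt Max Mb'.
apply: (le_trans (hnorm_tri (hat (a' \o x \o b)) _ _)); apply: lerD.
  rewrite -!(hatB hL)//.
  have -> : (fun v => (a \o x \o b) v - (a' \o x \o b) v) = (fun v => a v - a' v) \o (x \o b) by [].
  have xb1 : opbd (x \o b) 1.
    by move=> v /=; rewrite mul1r (le_trans (x1 _))// mul1r (le_trans (b1 _))// mul1r.
  by have := hat_mulr vMt hL (vN_sub vMt Ma Ma') Mxb ler01 xb1; rewrite mul1r.
rewrite -!(hatB hL)//.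
have -> : (fun v => (a' \o x \o b) v - (a' \o x \o b') v) = (a' \o x) \o (fun v => b v - b' v).
  by apply/funext => v /=; rewrite (linB (vN_linear vMt Mx)) (linB (vN_linear vMt Ma')).
have ax1 : opbd (a' \o x) 1.
  by move=> v /=; rewrite mul1r (le_trans (a1 _))// mul1r (le_trans (x1 _))// mul1r.
by have := hat_mull vMt hL Max (vN_sub vMt Mb Mb') ler01 ax1; rewrite mul1r.
Qed.

(** The automorphism alpha_s sends a z b to alpha_s(a) alpha_s(z) alpha_s(b), in
    which alpha_s(a) and alpha_s(b) may be replaced by a and b. *)
Lemma oddpart_sandwich t a z b : Mt a -> Mt z -> Mt b -> opbd a 1 -> opbd z 1 -> opbd b 1 ->
  hnorm (hat (a \o oddpart t z \o b) - hat (oddpart t (a \o z \o b))) <= 2 * (disp t a + disp t b).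
Proof.
move=> Ma Mz Mb a1 z1 b1; have bd s x : Mt x -> opbd x 1 -> opbd (alpha s x) 1.
  by move=> Mx; apply: (star_map_opbd vMt (iso_map (iso s))).
have Mab s : Mt (a \o alpha s z \o b).
  by apply: (vN_comp vMt) => //; apply: (vN_comp vMt) => //; exact: alphaM.
have key s : hnorm (hat (a \o alpha s z \o b) - hat (alpha s (a \o z \o b))) <= disp s a + disp s b.
  rewrite (isoM (iso s))//; last exact: (vN_comp vMt).
  rewrite (isoM (iso s))// (le_trans (hat_sandwich _ _ _ _ _ _ _ _))//; try exact: alphaM; try exact: bd.
  by rewrite lerD// hnorm_distC.
have Mazb : Mt (a \o z \o b) by apply: (vN_comp vMt) => //; exact: (vN_comp vMt).
have -> : a \o oddpart t z \o b = fun v => (a \o alpha t z \o b) v - (a \o alpha (- t) z \o b) v.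
  by apply/funext => v /=; rewrite (linB (vN_linear vMt Ma)).
rewrite (hatB hL)// (hatB hL); [|exact: alphaM..].
have := key t; have := key (- t); rewrite !disp_opp//.
set p := hat _; set q := hat _; set p' := hat _; set q' := hat _.
have -> : p' - p - (q' - q) = (p' - q') - (p - q) by rewrite !opprB addrACA [RHS]addrACA [- p + _]addrC.
have := hnormB (p' - q') (p - q).
by move: (hnorm _) (hnorm _) (hnorm _) (disp t a) (disp t b) => *; lra.
Qed.
End Deformation.

(** * Rigidity *)

Section Rigidity.
Context (R : realType) (H : hilbert R) (M Mt : set (op H)).
Context (vM : von_neumann M) (vMt : von_neumann Mt) (MMt : M `<=` Mt).
Context (tau : op H -> R[i]) (ftM : faithful_normal_trace M tau).
Context (ft : faithful_normal_trace Mt tau).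
Context (L : bimodule Mt) (hat : op H -> L) (hL : is_L2 tau hat).
Context (alpha : R -> op H -> op H).
Hypothesis aut : forall t, trace_aut Mt tau (alpha t).
Hypothesis alpha0 : forall x, Mt x -> alpha 0 x = x.
Hypothesis alphaD : forall s t x, Mt x -> alpha (s + t) x = alpha s (alpha t x).
Hypothesis alpha_cont : forall x, Mt x ->
  norm2 tau (fun v => alpha t x v - x v) @[t --> (0 : R)] --> (0 : R).
Context (beta : op H -> op H) (bet : trace_aut Mt tau beta).
Hypothesis beta_M : forall x, M x -> beta x = x.
Hypothesis beta_alpha : forall t x, Mt x -> beta (alpha t x) = alpha (- t) (beta x).
Context (X T : bimodule M) (U : {linear X -> L}).
Hypothesis UP : [/\ (forall u v : X, dotp (U u) (U v) = dotp u v),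
        range U = [set w : L | forall x, M x -> dotp w (hat x) = 0],
        (forall x u, M x -> U (lact X x u) = lact L x (U u)) &
        (forall x u, M x -> U (ract X x u) = ract L x (U u))].
Hypothesis mix : mixing_rel (@scalars R H) tau X.
Hypothesis coarse : is_coarse tau T.
Hypothesis wc : weakly_contained X T.
Context (G : groupType) (m : set G -> R) (hm : is_mean m).
Hypothesis m1 : forall g : G, m [set g] = 0.
Hypothesis minv : forall (g : G) (S : set G), m [set (g * x * g^-1)%g | x in S] = m S.
Hypothesis nonam : ~ amenable_group R G.
Context (K : hilbert R) (delta : G -> K) (lambda : G -> op K).
Context (reg : is_left_regular delta lambda).
Context (N : set (op H)) (vN : von_neumann N) (NM : N `<=` M).
Context (theta : op K -> op H) (iso : star_iso (groupvN lambda) N theta).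

Local Notation disp := (disp hat alpha).
Local Notation u := (gunit lambda theta).

Let Mu g : M (u g). Proof. exact: (gunitM reg NM iso). Qed.
Let Mtu g : Mt (u g). Proof. exact/MMt/Mu. Qed.
Let u1 g : opbd (u g) 1. Proof. exact: (gunit_opbd reg iso). Qed.
Let uM := gunit_mul reg iso.
Let ua := gunit_adj reg iso.
Let alphaM t x : Mt x -> Mt (alpha t x). Proof. exact: (iso_mem (aut t).1). Qed.

Lemma hnorm_U v : hnorm (U v) = hnorm v.
Proof.
have [Ud _ _ _] := UP.
by apply/eqP; rewrite -(@eqrXn2 _ 2) ?hnorm_ge0// !sqr_hnorm /rdot Ud.
Qed.

(** The complement of L^2(M) is only given through its isometric image under U, so
    the odd parts are lifted along U. *)
Lemma oddpart_lift t : exists d : op H -> X, forall x, M x -> U (d x) = hat (oddpart alpha t x).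
Proof.
have [_ Ur _ _] := UP.
have key x : exists k : X, M x -> U k = hat (oddpart alpha t x).
  have [Mx|nMx] := pselect (M x); last by exists 0.
  have : range U (hat (oddpart alpha t x)).
    by rewrite Ur => y My; exact: (oddpart_orth vM vMt MMt hL aut bet beta_M beta_alpha).
  by case=> k _ kE; exists k.
by have [d hd] := choice key; exists d.
Qed.

Lemma disp_cvg x : Mt x -> (disp t x) @[t --> (0 : R)] --> (0 : R).
Proof.
move=> Mx; rewrite (_ : (fun t => disp t x) = fun t => norm2 tau (fun v => alpha t x v - x v)).
  exact: alpha_cont.
apply/funext => t.
by rewrite (norm2_hat hL) ?(hatB hL)//; [exact: alphaM|apply: vN_sub => //; exact: alphaM].
Qed.

Lemma disp_gunit_le2 t g : disp t (u g) <= 2.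
Proof.
have hu : hnorm (hat (u g)) <= 1.
  have := hat_mulr vMt hL (vN_id vMt) (Mtu g) ler01 (u1 g).
  by rewrite (hat_id vMt ft hL) mulr1.
rewrite (le_trans (hnormB _ _))// (hat_aut vMt hL (aut t))//.
by move: hu; move: (hnorm _) => *; lra.
Qed.

Lemma disp_gunitV t g : disp t (u g^-1%g) = disp t (u g).
Proof. by rewrite -ua (disp_adj vMt ft hL aut). Qed.

Lemma U_conj_rep g x v : Mt x -> U v = hat x ->
  U (conj_rep u X g v) = hat (u g \o x \o u g^-1%g).
Proof.
move=> Mx hv; have [_ _ Ul Ur] := UP.
by rewrite /conj_rep Ur// Ul// hv (lact_hat hL)// (ract_hat hL)//; exact: vN_comp.
Qed.

(** The lifts of the odd parts of alpha_t (u_h) form a field over h that is almost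
    equivariant under the finite set F of the spectral gap, uniformly in h: the
    error involves only the displacements of the u_g with g in F, which tend to 0
    with t. *)
Lemma small_displacement_mean r : 0 < r -> exists t0 : R, 0 < t0 /\
  forall t, `|t| < t0 -> m [set h | r < disp (t + t) (u h)] <= 1 / 3.
Proof.
move=> r0; have [F [rho [F0 rho0 rho1 gap]]] := nonamenable_gap reg nonam.
have r1 : 0 < 1 - rho by rewrite subr_gt0.
pose q := (1 - rho) * r ^+ 2; have q0 : 0 < q by rewrite mulr_gt0// exprn_gt0.
(* Chosen so that eta^2 / q is the bound 1 / 3 asked for. *)
pose eta := Num.sqrt (q / 3); have eta0 : 0 < eta by rewrite sqrtr_gt0 divr_gt0.
have /nbhs_ballP[t0 /= t00 ht0] : \forall t \near (0 : R), forall g, g \in F -> disp t (u g) < eta / 4.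
  elim: (F) => [|g s IH]; first by near=> t.
  have hg : \forall t \near (0 : R), disp t (u g) < eta / 4.
    have := disp_cvg (Mtu g) => /cvgrPdist_lt /(_ _ (divr_gt0 eta0 (ltr0n _ 4))).
    by apply: filterS => t; rewrite sub0r normrN ger0_norm ?hnorm_ge0.
  by apply: filterS2 hg IH => t h1 h2 g'; rewrite inE => /predU1P[->|/h2].
exists t0; split=> // t tt0; have small : forall g, g \in F -> disp t (u g) < eta / 4.
  by apply: ht0; rewrite /ball /= sub0r normrN.
have [d hd] := oddpart_lift t.
have nd h : hnorm (d (u h)) = disp (t + t) (u h).
  by rewrite -hnorm_U hd// (hnorm_oddpart vMt hL aut alpha0 alphaD).
have := @large_set_small_mean R G m hm minv X K (conj_rep u X) _ delta lambda reg _ F rho eta r (fun h => d (u h)).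
have -> : [set h | r < hnorm (d (u h))] = [set h | r < disp (t + t) (u h)].
  by apply/seteqP; split=> h /=; rewrite nd.
move=> h; rewrite -(ler_pM2l q0); apply: (le_trans (h _ _ F0 rho0 rho1 gap _ (ltW eta0) (ltW r0) _)).
- exact: (conj_rep_unitary Mu (gunit1 reg iso) uM ua).
- move=> s c s0 c0 hc; apply: (conj_rep_weak_containment vM Mu (gunit1 reg iso) uM ua wc (ltW c0)).
  exact: (coarse_conj_opbd vM reg NM iso coarse s0 c0 hc).
- by move=> k; rewrite nd disp_gunit_le2.
- move=> g k gF; rewrite -hnorm_U linearB /= hd//.
  rewrite (U_conj_rep _ _ (hd _ (Mu _))); last exact: (oddpart_mem vMt aut).
  have e : u k = u g \o u (conjg k g) \o u g^-1%g.
    by rewrite -!uM; congr u; rewrite /conjg !mulgA mulgV mul1g -mulgA mulgV mulg1.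
  rewrite [in X in _ - X]e.
  rewrite (le_trans (oddpart_sandwich vMt hL aut alpha0 alphaD _ _ _ _ _ _ _))// disp_gunitV.
  by have := small g gF; move: (disp _ _) => z; lra.
rewrite sqr_sqrtr; last exact/ltW/divr_gt0.
by rewrite mul1r.
Unshelve. all: end_near.
Qed.

(** The hypothesis of mixing is tau (a u_k b) -> 0, as the conditional expectation
    onto the scalars is the trace.  Mixing is uniform over the unit ball on the
    right, which is what lets u_h vary with n. *)
Lemma mixing_small (h_ k_ : nat -> G) (v : X) (e : R) : injective k_ -> 0 < e ->
  exists n, modulus (dotp (ract X (u (h_ n)) (lact X (u (k_ n)) v)) v) < e.
Proof.
move=> k_inj e0; have ub g : unit_ball M (u g).
  by split=> //; apply/opnorm_le; rewrite ?ler01//; exact: (vN_linear vM (Mu g)).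
(* tau (a u_k b) = tau (u_k b a) tends to 0 along distinct k. *)
have hmix : forall a b, M a -> M b ->
    norm2 tau (cond_exp M (@scalars R H) tau (a \o u (k_ n) \o b)) @[n --> \oo] --> (0 : R).
  move=> a b Ma Mb; have Mba := vN_comp vM Mb Ma.
  have := gunit_decay vMt ft hL reg vN (subset_trans NM MMt) iso k_inj (MMt Mba).
  rewrite (_ : (fun n => modulus _) = fun n => norm2 tau (cond_exp M (@scalars R H) tau (a \o u (k_ n) \o b)))//.
  apply/funext => n; symmetry.
  have Mk := Mu (k_ n); have Mak := vN_comp vM Ma Mk; have Makb := vN_comp vM Mak Mb.
  rewrite (norm2_cond_exp_scalars vM ftM Makb); congr modulus.
  have e1 : tau (a \o u (k_ n) \o b) = tau (b \o (a \o u (k_ n))) := trC ftM Mak Mb.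
  have e2 : tau ((b \o a) \o u (k_ n)) = tau (u (k_ n) \o (b \o a)) := trC ftM Mba Mk.
  by rewrite e1 -e2.
have := mix (fun n => ub (k_ n)) hmix v v.
move=> /(_ [set y | (y < e%:E)%E]) h.
have /h[n _ hn] : nbhs (0%E : \bar R) [set y | (y < e%:E)%E].
  by apply: open_nbhs_nbhs; split; [exact: open_ereal_lt_ereal|rewrite /= lte_fin].
exists n; rewrite -lte_fin; apply: le_lt_trans (hn n (leqnn _)).
by apply: ereal_sup_ubound; exists (u (h_ n)).
Qed.

(** Write u_g = u_k^-1 u_g u_h with k = g h g^-1 and h both of displacement at
    most r.  The odd part v of u_g is then within 4 r of u_k^-1 v u_h.  Both sets
    of good elements have mean at least 2/3, so their intersection is infinite
    and h, k can tend to infinity; mixing makes u_k^-1 v u_h nearly orthogonal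
    to v. *)
Lemma displacement_everywhere s r g : 0 <= r -> m [set h | r < disp s (u h)] <= 1 / 3 ->
  disp (s + s) (u g) <= 4 * r.
Proof.
move=> r0 hr; pose S := [set h | disp s (u h) <= r].
have mS : 2 / 3 <= m S.
  have -> : S = ~` [set h | r < disp s (u h)].
    by apply/seteqP; split=> h; rewrite /S /= leNgt; [move/negP|move/negP].
  by rewrite mean_setC//; move: hr; move: (m _) => *; lra.
pose S' := [set h | S (g * h * g^-1)%g].
have mS' : 2 / 3 <= m S'.
  rewrite -(minv g); have -> : [set (g * x * g^-1)%g | x in S'] = S.
    apply/seteqP; split=> [_ [x xS <-]//|k kS].
    exists (g^-1 * k * g)%g; last by rewrite !mulgA mulgV mul1g -mulgA mulgV mulg1.
    by rewrite /S' /= !mulgA mulgV mul1g -mulgA mulgV mulg1.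
  exact: mS.
have [h_ [h_inj hS]] := positive_mean_sequence hm m1 (mean_two_large hm mS mS').
pose k_ n := (g * h_ n * g^-1)^-1%g.
have k_inj : injective k_.
  by move=> a b /invg_inj /mulIg /mulgI /h_inj.
have [d hd] := oddpart_lift s; set v := d (u g).
have [_ _ Ul Ur] := UP.
have Mo := oddpart_mem vMt aut s (Mtu g).
have close n : hnorm (ract X (u (h_ n)) (lact X (u (k_ n)) v) - v) <= 4 * r.
  rewrite -hnorm_U linearB /= Ur// Ul// hd// (lact_hat hL)// (ract_hat hL)//; last exact: vN_comp.
  have e : u g = u (k_ n) \o u g \o u (h_ n).
    by rewrite -!uM; congr u; rewrite /k_ !invgM invgK !mulgA !mulgVK.
  rewrite [in X in _ - X]e.
  rewrite (le_trans (oddpart_sandwich vMt hL aut alpha0 alphaD _ _ _ _ _ _ _))// disp_gunitV.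
  by case: (hS n) => h1 h2; move: h1 h2; rewrite /S' /S /=; move: (disp _ _) (disp _ _) => *; lra.
rewrite -(hnorm_oddpart vMt hL aut alpha0 alphaD)// -hd// hnorm_U -/v.
have v2 : hnorm v ^+ 2 <= 4 * r * hnorm v.
  apply/ler_addgt0Pr => e e0; have [n hn] := mixing_small h_ v k_inj e0.
  set w := ract X _ _ in hn; have := close n; rewrite -/w => cl.
  have -> : hnorm v ^+ 2 = rdot w v - rdot (w - v) v by rewrite sqr_hnorm rdotBl opprB addrC subrK.
  have := abs_rdot (w - v) v; rewrite ler_norml => /andP[h1 _].
  have := Re_le_modulus (dotp w v); rewrite ler_norml => /andP[_ h2].
  have := ler_wpM2r (hnorm_ge0 v) cl; rewrite -/(rdot _ _) in h2.
  by move: h1 h2 hn; move: (rdot _ _) (rdot _ _) (modulus _) (_ * _) (_ * hnorm v) => *; lra.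
have := hnorm_ge0 v; rewrite le_eqVlt => /predU1P[<-|v0]; first by rewrite mulr_ge0.
by rewrite -(ler_pM2r v0) -expr2.
Qed.

(** With s = t / 4, the spectral gap controls the displacement at time 2 s and
    mixing doubles the time; its factor 4 and the factor 2 lost in passing from
    the group to the unit ball account for e / 8. *)
Lemma group_algebra_rigid : unif_to_id tau alpha N.
Proof.
have bound (e : R) : 0 < e -> exists t0 : R, 0 < t0 /\ forall t, `|t| < t0 ->
    forall x, unit_ball N x -> norm2 tau (fun v => alpha t x v - x v) <= e.
  move=> e0; have [t0 [t00 ht]] := small_displacement_mean (divr_gt0 e0 (ltr0n _ 8)).
  exists t0; split=> // t tt x [Nx xb]; have [y Ay yx] := iso_surj iso Nx.
  have Mtx := MMt (NM Nx).
  rewrite (norm2_hat hL); last by apply: vN_sub => //; exact: alphaM.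
  rewrite (hatB hL)//; last exact: alphaM.
  have tE : t = t / 4 + t / 4 + (t / 4 + t / 4) by lra.
  have t4 : `|t / 4| < t0.
    rewrite normrM (@ger0_norm _ 4^-1) ?invr_ge0// ltr_pdivrMr// (lt_le_trans tt)// ler_pMr//.
    by rewrite ler1n.
  rewrite -yx; have := close_on_group_close_on_ball vMt ft hL reg vN (subset_trans NM MMt) iso (aut t) (r := e / 2) _ Ay.
  rewrite [2 * _]mulrC divfK//; apply.
    move=> g; rewrite [X in alpha X]tE.
    rewrite (le_trans (displacement_everywhere _ _ (ht _ t4)))//; first by rewrite divr_ge0// ltW.
    lra.
  by rewrite yx; apply/opnorm_le => //; exact: (vN_linear vN Nx).
have N0 : unit_ball N (fun=> 0).
  split; first exact: (vN_0 vN).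
  by apply/opnorm_le => //; [exact: (vN_linear vN (vN_0 vN))|move=> v; rewrite hnorm0 mul1r hnorm_ge0].
have sup0 t : (0 <= ereal_sup [set (norm2 tau (fun v => alpha t x v - x v))%:E | x in unit_ball N])%E.
  apply: (@le_trans _ _ (norm2 tau (fun v => alpha t (fun=> 0) v - (fun=> 0) v))%:E).
    by rewrite lee_fin sqrtr_ge0.
  by apply: ereal_sup_ubound; exists (fun=> 0).
have supE (e t : R) : (forall x, unit_ball N x -> norm2 tau (fun v => alpha t x v - x v) <= e) ->
    (ereal_sup [set (norm2 tau (fun v => alpha t x v - x v))%:E | x in unit_ball N] <= e%:E)%E.
  by move=> h; apply: ge_ereal_sup => _ [x xb <-]; rewrite lee_fin; exact: h.
apply/fine_cvgP; split.
  have [t0 [t00 ht]] := bound 1 ltr01.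
  apply/nbhs_ballP; exists t0 => //= t; rewrite /ball /= sub0r normrN => tt.
  rewrite ge0_fin_numE; last exact: sup0.
  exact: le_lt_trans (supE 1 t (ht t tt)) (ltry _).
apply/cvgrPdist_le => e e0; have [t0 [t00 ht]] := bound e e0.
apply/nbhs_ballP; exists t0 => //= t; rewrite /ball /= sub0r normrN => tt.
have := sup0 t; have := supE e t (ht t tt); move: (ereal_sup _) => [z| |]//=.
by rewrite !lee_fin sub0r normrN => h1 h2; rewrite ger0_norm.
Qed.
End Rigidity.

Theorem theorem5 (R : realType) (H : hilbert R) (M Mt : set (op H))
    (tau : op H -> R[i]) (alpha : R -> op H -> op H)
    (hM : class_M0_with M Mt tau alpha)
    (G : groupType) (hG : countable [set: G])
    (hna : ~ amenable_group R G) (hia : inner_amenable R G)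
    (LG : set (op H)) (hLG : is_group_vN G LG) (hsub : LG `<=` M) :
  unif_to_id tau alpha LG.
Proof.
have [[vM ftM _] _ [[vMt ft _] MMt _ [[aut a0 aD ac] [[beta [bet bM _ ba]] _]]]] := hM.
case=> X [T [[L [hat [U [hL hU]]]] mix coarse wc]].
have [m [hm m1 minv]] := hia.
have [K [delta [lambda [theta [reg vN iso]]]]] := hLG.
exact: (group_algebra_rigid vM vMt MMt ftM ft hL aut a0 aD ac bet bM ba hU mix coarse wc hm m1 minv hna reg vN hsub iso).
Qed.
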